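(* Let $\mathcal{A} \subseteq \mathcal{F}$ be a field of subsets of $\mathbb{N}$ and $p \in \{0\} \cup [1,\infty)$. Let $\phi : \mathcal{P}(\mathbb{N}) / \mathcal{N} \rightarrow \mathcal{P}(Y)$ be a representation of the Boolean algebra $\mathcal{P}(\mathbb{N}) / \mathcal{N}$. Then 1. $\phi(\sigma[\mathcal{A}]) \subseteq \langle \mathcal{F} \rangle_{\phi}$, 2. $\big( Y, \overline{\phi(\sigma[\mathcal{A}])}, \overline{\nu} \big)$ is a complete measure space, 3. $\mathcal{L}_p \big( Y, \overline{\phi(\sigma[\mathcal{A}])}, \overline{\nu} \big)$ is a Lebesgue function space, 4. $\mathcal{L}_p(\mathcal{A})$ is isometrically isomorphic to a dense subspace of $\mathcal{L}_p \big( Y,\phi(\sigma[\mathcal{A}]),\nu \big)$, and 5. $\mathcal{L}_p(\mathcal{A})$ is complete if and only if $\mathcal{L}_p(\mathcal{A}) \cong \mathcal{L}_p \big( Y,\phi(\sigma[\mathcal{A}]),\nu \big)$.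
   Context: $\mathbb{N} = \{1,2,3,\ldots\}$. $\mathcal{F}$ is the collection of all $A\subseteq\mathbb{N}$ for which $\nu(A) := \lim_{N\to\infty}\frac1N\sum_{n=1}^N I_A(n)$ exists ($I_A$ the indicator function), and $\mathcal{N} := \{A\in\mathcal{F}:\nu(A)=0\}$, an ideal of $\mathcal{P}(\mathbb{N})$. $[A]$ is the class of $A$ in the Boolean quotient $\mathcal{P}(\mathbb{N})/\mathcal{N}$ (under $A\sim B\iff A\triangle B\in\mathcal{N}$), $[\mathcal{C}] := \{[A]:A\in\mathcal{C}\}$ for $\mathcal{C}\subseteq\mathcal{P}(\mathbb{N})$, and $\nu[A]:=\nu(A)$ for $A\in\mathcal{F}$. A subset $\mathcal{M}$ of a Boolean algebra $\mathcal{B}$ is a monotone class if every non-decreasing sequence in $\mathcal{M}$ has an upper bound belonging to $\mathcal{M}$ that is a least upper bound in $\mathcal{B}$, and every non-increasing sequence in $\mathcal{M}$ has a lower bound belonging to $\mathcal{M}$ that is a greatest lower bound in $\mathcal{B}$. $[\mathcal{F}]$ is a monotone class in $\mathcal{P}(\mathbb{N})/\mathcal{N}$. For a field $\mathcal{A}\subseteq\mathcal{F}$, $\sigma[\mathcal{A}]$ is the smallest monotone class in $\mathcal{P}(\mathbb{N})/\mathcal{N}$ containing the subalgebra $[\mathcal{A}]$; equivalently, the smallest subalgebra containing $[\mathcal{A}]$ and containing suprema (taken in $\mathcal{P}(\mathbb{N})/\mathcal{N}$) of all its countable subsets. A representation of $\mathcal{P}(\mathbb{N})/\mathcal{N}$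 is a Boolean isomorphism $\phi$ of it onto a field of subsets of some set $Y$. $\langle A\rangle_\phi := \phi[A]$ and $\langle\mathcal{F}\rangle_\phi := \{\langle A\rangle_\phi : A\in\mathcal{F}\}$. On the field $\phi(\sigma[\mathcal{A}])$, $\nu$ is defined by $\nu(\phi(x)) := \nu(x)$. Charge spaces: a charge space $(X,\mathcal{B},\mu)$ is a set $X$, a field $\mathcal{B}$ of subsets, and a finitely additive $\mu:\mathcal{B}\to[0,\infty)$. Its Peano–Jordan completion is $(X,\overline{\mathcal{B}},\overline\mu)$ with $\overline{\mathcal{B}} := \{A\subseteq X:\forall\epsilon>0\ \exists B,C\in\mathcal{B}$ with $B\subseteq A\subseteq C$, $\mu(C\setminus B)<\epsilon\}$ and $\overline\mu(A):=\sup\{\mu(B):B\in\mathcal{B},B\subseteq A\}$. $\mu^*(A):=\inf\{\mu(B):B\in\mathcal{B},A\subseteq B\}$. $f,g:X\to\mathbb{R}$ are equal a.e. if $\mu^*(\{|f-g|>\epsilon\})=0$ for all $\epsilon>0$. A simple function is a finite sum $\sum_k c_kI_{A_k}$ with $c_k\in\mathbb{R}$, $\{A_k\}\subseteq\mathcal{B}$ a finite partition of $X$; its integral is $\sum_k c_k\mu(A_k)$. $f_n\to f$ hazily if $\mu^*(\{|f_n-f|>\epsilon\})\to0$ for all $\epsilon>0$. $L_0(X,\mathcal{B},\mu)$ is the set of $T_1$-measurable functions, i.e. hazy limits of sequences of simple functions, with pseudometric $d(f,g)=\inf_{\epsilon>0}\{\epsilon+\mu^*(|f-g|>\epsilon)\}$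 (which metrizes hazy convergence). $f$ is integrable if there are simple $f_n\to f$ hazily with $\int|f_n-f_m|d\mu\to0$ as $n,m\to\infty$, and then $\int f d\mu:=\lim_n\int f_nd\mu$. For $p\in[1,\infty)$, $L_p(X,\mathcal{B},\mu)$ is the set of $T_1$-measurable $f$ with $|f|^p$ integrable, with pseudonorm $(\int|f|^pd\mu)^{1/p}$. $\mathcal{L}_p$ denotes the quotient of $L_p$ by equality a.e., a normed space for $p\ge1$ and a metric space for $p=0$. $\mathcal{L}_p(\mathcal{A}):=\mathcal{L}_p(\mathbb{N},\mathcal{A},\nu)$. ''$\mathcal{L}_p$ is a Lebesgue function space'' means that it coincides with the conventional $\mathcal{L}_p$ space of the (countably additive) measure space in question (for $p=0$: the real-valued measurable functions modulo a.e. equality). $\cong$ denotes isometric isomorphism. *)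

(* Defs.v *)
From HB Require Import structures.
From mathcomp Require Import all_boot all_order all_algebra.
From mathcomp Require Import all_classical all_reals all_analysis.

Set Implicit Arguments.
Unset Strict Implicit.
Unset Printing Implicit Defensive.
Import Order.TTheory GRing.Theory Num.Theory.
Import numFieldNormedType.Exports.

Local Open Scope classical_set_scope.
Local Open Scope ring_scope.
Local Open Scope quotient_scope.

Definition set_field (X : Type) (B : set (set X)) : Prop :=
  [/\ B setT, setU_closed B & setC_closed B].

Definition posn : Type := {n : nat | (0 < n)%N}.

Definition pos_succ (i : nat) : posn := exist _ i.+1 isT.

Section Density.
Variable R : realType.
Implicit Types A B C : set posn.

(* The sum runs over the elements 1, ..., N of posn; the value at N = 0 is
   irrelevant to the limit. *)
Definition avg A (N : nat) : R := (\sum_(i < N) \1_A (pos_succ i)) / N%:R.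

Definition has_density : set (set posn) := [set A | cvgn (avg A)].

(* Meaningful on has_density only. *)
Definition asym_density A : R := limn (avg A).

Definition null : set (set posn) := [set A | has_density A /\ asym_density A = 0].

Lemma nullP A : null A <-> avg A @ \oo --> (0 : R).
Proof.
split=> [[cA A0]|A0]; first by rewrite -A0.
by split; [apply/cvg_ex; exists 0 | exact/cvg_lim].
Qed.

Lemma avg_ge0 A N : 0 <= avg A N.
Proof. by rewrite divr_ge0// sumr_ge0. Qed.

Lemma null0 : null set0.
Proof.
apply/nullP; rewrite (_ : avg set0 = fun=> 0); first exact: cvg_cst.
by apply/funext => N; rewrite /avg big1 ?mul0r// => i _; rewrite indic0.
Qed.

Lemma nullS A B : A `<=` B -> null B -> null A.
Proof.
move=> AB /nullP B0; apply/nullP.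
apply: squeeze_cvgr (cvg_cst 0) B0.
near=> N; rewrite avg_ge0/= /avg ler_wpM2r// ler_sum// => i _.
rewrite !indicE; case: (boolP (_ \in A)) => [|_]; last by rewrite ler0n.
by rewrite !inE => /AB Bi; rewrite mem_set.
Unshelve. all: by end_near. Qed.

Lemma nullU A B : null A -> null B -> null (A `|` B).
Proof.
move=> /nullP A0 /nullP B0; apply/nullP.
have AB0 : avg A \+ avg B @ \oo --> (0 : R).
  by rewrite -[X in _ --> X](addr0 (0 : R)); exact: cvgD.
apply: squeeze_cvgr (cvg_cst 0) AB0.
near=> N; rewrite avg_ge0/= /avg -mulrDl ler_wpM2r// -big_split/=.
rewrite ler_sum// => i _; rewrite !indicE in_setU.
by case: (_ \in A); case: (_ \in B); rewrite /= ?addr0 ?add0r// lerDl.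
Unshelve. all: by end_near. Qed.

Definition null_equiv A B : bool := `[< null (A `+` B) >].

Lemma null_equiv_refl : reflexive null_equiv.
Proof. by move=> A; apply/asboolP; rewrite setYK; exact: null0. Qed.

Lemma null_equiv_sym : symmetric null_equiv.
Proof. by move=> A B; rewrite /null_equiv setYC. Qed.

Lemma null_equiv_trans : transitive null_equiv.
Proof.
move=> B A C /asboolP AB /asboolP BC; apply/asboolP.
apply: nullS (nullU AB BC) => n /=; rewrite /setY/=.
by case: (pselect (B n)); tauto.
Qed.

Canonical null_equiv_canonical :=
  EquivRel null_equiv null_equiv_refl null_equiv_sym null_equiv_trans.

Definition pow_mod_null : Type := {eq_quot null_equiv}.
HB.instance Definition _ := Choice.on pow_mod_null.
HB.instance Definition _ := EqQuotient.on pow_mod_null.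

Definition cls A : pow_mod_null := \pi_pow_mod_null A.

Lemma clsP A B : cls A = cls B <-> null (A `+` B).
Proof. by split=> [/eqmodP/asboolP | AB]; [|apply/eqmodP/asboolP]. Qed.

Lemma repr_cls A : null (repr (cls A) `+` A).
Proof. by apply/clsP; rewrite /cls reprK. Qed.

Implicit Types x y z : pow_mod_null.

Definition pmn_meet x y : pow_mod_null := cls (repr x `&` repr y).
Definition pmn_join x y : pow_mod_null := cls (repr x `|` repr y).
Definition pmn_compl x : pow_mod_null := cls (~` repr x).
Definition pmn_le x y : bool := `[< null (repr x `\` repr y) >].
Definition pmn_lt x y : bool := (y != x) && pmn_le x y.

Lemma pmn_meet_cls A B : pmn_meet (cls A) (cls B) = cls (A `&` B).
Proof.
apply/clsP; apply: nullS (nullU (repr_cls A) (repr_cls B)) => n /=.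
rewrite /setY/=; case: (pselect (A n)); case: (pselect (B n));
  case: (pselect (repr (cls A) n)); case: (pselect (repr (cls B) n)); tauto.
Qed.

Lemma pmn_join_cls A B : pmn_join (cls A) (cls B) = cls (A `|` B).
Proof.
apply/clsP; apply: nullS (nullU (repr_cls A) (repr_cls B)) => n /=.
rewrite /setY/=; case: (pselect (A n)); case: (pselect (B n));
  case: (pselect (repr (cls A) n)); case: (pselect (repr (cls B) n)); tauto.
Qed.

Lemma pmn_compl_cls A : pmn_compl (cls A) = cls (~` A).
Proof.
apply/clsP; apply: nullS (repr_cls A) => n /=; rewrite /setY/=.
by case: (pselect (A n)); case: (pselect (repr (cls A) n)); tauto.
Qed.

Lemma cls_surj x : exists A, x = cls A.
Proof. by exists (repr x); rewrite /cls reprK. Qed.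

Lemma pmn_le_def x y : pmn_le x y = (pmn_meet x y == x).
Proof.
have E : null (repr x `\` repr y) <-> pmn_meet x y = x.
  rewrite -[in X in _ <-> _ = X](reprK x) /pmn_meet clsP.
  by split; apply: nullS => n; rewrite /setY/=;
    case: (pselect (repr y n)); tauto.
by apply/asboolP/eqP => /E.
Qed.

Lemma pmn_lt_def x y : pmn_lt x y = (y != x) && pmn_le x y.
Proof. by []. Qed.

Lemma pmn_meetC : commutative pmn_meet.
Proof. by move=> x y; rewrite /pmn_meet setIC. Qed.

Lemma pmn_joinC : commutative pmn_join.
Proof. by move=> x y; rewrite /pmn_join setUC. Qed.

Lemma pmn_meetA : associative pmn_meet.
Proof.
move=> x y z; have [[A ->] [B ->] [C ->]] := And3 (cls_surj x) (cls_surj y) (cls_surj z).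
by rewrite !pmn_meet_cls setIA.
Qed.

Lemma pmn_joinA : associative pmn_join.
Proof.
move=> x y z; have [[A ->] [B ->] [C ->]] := And3 (cls_surj x) (cls_surj y) (cls_surj z).
by rewrite !pmn_join_cls setUA.
Qed.

Lemma pmn_joinKI y x : pmn_meet x (pmn_join x y) = x.
Proof.
have [[A ->] [B ->]] := conj (cls_surj x) (cls_surj y).
by rewrite pmn_join_cls pmn_meet_cls setUC setKU.
Qed.

Lemma pmn_meetKU y x : pmn_join x (pmn_meet x y) = x.
Proof.
have [[A ->] [B ->]] := conj (cls_surj x) (cls_surj y).
by rewrite pmn_meet_cls pmn_join_cls setIC setKI.
Qed.

Lemma pmn_meetUl : left_distributive pmn_meet pmn_join.
Proof.
move=> x y z; have [[A ->] [B ->] [C ->]] := And3 (cls_surj x) (cls_surj y) (cls_surj z).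
by rewrite !(pmn_join_cls, pmn_meet_cls) setIUl.
Qed.

Lemma pmn_meetxx : idempotent_op pmn_meet.
Proof. by move=> x; rewrite /pmn_meet setIid /cls reprK. Qed.

Fact pmn_display : Order.disp_t. Proof. by []. Qed.

HB.instance Definition _ := Order.isMeetJoinDistrLattice.Build pmn_display
  pow_mod_null pmn_le_def pmn_lt_def pmn_meetC pmn_joinC pmn_meetA pmn_joinA
  pmn_joinKI pmn_meetKU pmn_meetUl pmn_meetxx.

Lemma pmn_le0x x : (cls set0 <= x)%O.
Proof.
have [A ->] := cls_surj x.
by rewrite leEmeet; apply/eqP; rewrite [LHS]pmn_meet_cls set0I.
Qed.

Lemma pmn_lex1 x : (x <= cls setT)%O.
Proof.
have [A ->] := cls_surj x.
by rewrite leEmeet; apply/eqP; rewrite [LHS]pmn_meet_cls setIT.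
Qed.

HB.instance Definition _ :=
  Order.hasBottom.Build pmn_display pow_mod_null pmn_le0x.
HB.instance Definition _ :=
  Order.hasTop.Build pmn_display pow_mod_null pmn_lex1.

Lemma pmn_joinxC x : (x `|` pmn_compl x = \top)%O.
Proof.
have [A ->] := cls_surj x.
by rewrite pmn_compl_cls [LHS]pmn_join_cls setUv.
Qed.

Lemma pmn_meetxC x : (x `&` pmn_compl x = \bot)%O.
Proof.
have [A ->] := cls_surj x.
by rewrite pmn_compl_cls [LHS]pmn_meet_cls setICr.
Qed.

HB.instance Definition _ := Order.TBDistrLattice_hasComplement.Build
  pmn_display pow_mod_null pmn_joinxC pmn_meetxC.

(* Meaningful on the classes of sets that have a density; there it does not
   depend on the representative. *)
Definition qdensity x : R := asym_density (repr x).

End Density.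

Arguments avg : clear implicits.
Arguments has_density : clear implicits.
Arguments asym_density : clear implicits.
Arguments null : clear implicits.
Arguments cls : clear implicits.

Section BooleanAlgebra.
Context {d : Order.disp_t} {L : ctbDistrLatticeType d}.

Definition monotone_class (M : set L) : Prop :=
  (forall x : nat -> L, (forall n, M (x n)) -> nondecreasing_seq x ->
     exists2 s, M s & supremums (range x) s) /\
  (forall x : nat -> L, (forall n, M (x n)) -> nonincreasing_seq x ->
     exists2 s, M s & infimums (range x) s).

(* A Boolean isomorphism onto a field of subsets of Y: the range of such a phi
   is a field of sets. *)
Definition representation (Y : Type) (phi : L -> set Y) : Prop :=
  [/\ injective phi,
      {morph phi : x y / (x `&` y)%O >-> x `&` y},
      {morph phi : x y / (x `|` y)%O >-> x `|` y} &
      {morph phi : x / (~` x)%O >-> ~` x}].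

End BooleanAlgebra.

Definition sigma_cls (R : realType) (A : set (set posn)) :
    set (pow_mod_null R) :=
  smallest monotone_class [set cls R a | a in A].
Arguments sigma_cls : clear implicits.

(* nu (phi x) := nu x; phi is injective, so that x is determined by phi x. *)
Definition density_rep (R : realType) (Y : Type) (phi : pow_mod_null R -> set Y)
    (S : set Y) : R :=
  qdensity (xget (\bot)%O [set x | phi x = S]).

(* Raw data, without axioms: the quotients below are metric vector spaces only
   when the underlying charge space is genuine. *)
Record mvspace (R : realType) (P : Type) := MVSpace {
  pts : set P ;
  vadd : P -> P -> P ;
  vscale : R -> P -> P ;
  vdist : P -> P -> R }.

Section MVSpace.
Variable R : realType.

Definition mv_coincide P (S T : mvspace R P) : Prop :=
  [/\ pts S = pts T,
      forall f g, pts S f -> pts S g -> vadd S f g = vadd T f g,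
      forall a f, pts S f -> vscale S a f = vscale T a f &
      forall f g, pts S f -> pts S g -> vdist S f g = vdist T f g].

Definition mv_isometric P Q (S : mvspace R P) (T : mvspace R Q) : Prop :=
  exists h : P -> Q,
    [/\ set_bij (pts S) (pts T) h,
        forall f g, pts S f -> pts S g -> h (vadd S f g) = vadd T (h f) (h g),
        forall a f, pts S f -> h (vscale S a f) = vscale T a (h f) &
        forall f g, pts S f -> pts S g -> vdist T (h f) (h g) = vdist S f g].

Definition mv_subspace P (S : mvspace R P) (D : set P) : Prop :=
  [/\ D `<=` pts S, D !=set0,
      forall f g, D f -> D g -> D (vadd S f g) &
      forall a f, D f -> D (vscale S a f)].

Definition mv_restrict P (S : mvspace R P) (D : set P) : mvspace R P :=
  MVSpace D (vadd S) (vscale S) (vdist S).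

Definition mv_dense P (S : mvspace R P) (D : set P) : Prop :=
  forall f, pts S f -> forall e, 0 < e -> exists2 g, D g & vdist S f g < e.

Definition mv_complete P (S : mvspace R P) : Prop :=
  forall u : nat -> P, (forall n, pts S (u n)) ->
    (fun k : nat * nat => vdist S (u k.1) (u k.2)) @ filter_prod \oo \oo
      --> (0 : R) ->
    exists2 f, pts S f & (fun n => vdist S (u n) f) @ \oo --> (0 : R).

(* The quotient of a space L of functions by an equivalence relation e, with
   the operations and the pseudometric d carried over; points are equivalence
   classes. *)
Section FunctionSpace.
Variables (X : Type) (L : set (X -> R)) (e : (X -> R) -> (X -> R) -> Prop).
Variable d : (X -> R) -> (X -> R) -> R.

Definition fclass (f : X -> R) : set (X -> R) := [set g | L g /\ e f g].

Definition frepr (F : set (X -> R)) : X -> R := xget (fun=> 0) F.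

Definition fquot : mvspace R (set (X -> R)) := {|
  pts := [set fclass f | f in L] ;
  vadd F G := fclass (fun x => frepr F x + frepr G x) ;
  vscale a F := fclass (fun x => a * frepr F x) ;
  vdist F G := d (frepr F) (frepr G) |}.

End FunctionSpace.

End MVSpace.

Section ChargeSpace.
Variables (R : realType) (X : Type) (B : set (set X)) (mu : set X -> R).
Implicit Types (A : set X) (f g : X -> R) (s : nat -> X -> R) (p : R).

Definition pj_field : set (set X) :=
  [set A | forall e : R, 0 < e -> exists b c,
     [/\ B b, B c, b `<=` A, A `<=` c & mu (c `\` b) < e]].

Definition pj_charge A : R := sup [set mu b | b in [set b | B b /\ b `<=` A]].

Definition outer A : R := inf [set mu b | b in [set b | B b /\ A `<=` b]].

Definition far f g (e : R) : set X := [set x | e < `|f x - g x|].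

Definition charge_ae_eq f g : Prop := forall e, 0 < e -> outer (far f g e) = 0.

Definition hazy_cvg s f : Prop :=
  forall e, 0 < e -> (fun n => outer (far (s n) f e)) @ \oo --> (0 : R).

Definition simple_repr n (c : 'I_n -> R) (A : 'I_n -> set X) f : Prop :=
  [/\ forall k, B (A k), partition setT A setT &
      forall x, f x = \sum_(k < n) c k * \1_(A k) x].

Definition simple f : Prop :=
  exists n (c : 'I_n -> R) (A : 'I_n -> set X), simple_repr c A f.

(* The sum does not depend on the representation of f. *)
Definition simple_integral f : R :=
  xget 0 [set r | exists n (c : 'I_n -> R) (A : 'I_n -> set X),
    simple_repr c A f /\ r = \sum_(k < n) c k * mu (A k)].

Definition determining s f : Prop :=
  [/\ forall n, simple (s n), hazy_cvg s f &
      (fun k : nat * nat =>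
         simple_integral (fun x => `|s k.1 x - s k.2 x|))
        @ filter_prod \oo \oo --> (0 : R)].

Definition charge_integrable f : Prop := exists s, determining s f.

(* The limit does not depend on the determining sequence. *)
Definition charge_integral f : R :=
  xget 0 [set r | exists2 s, determining s f &
    (fun n => simple_integral (s n)) @ \oo --> r].

Definition T1_measurable f : Prop :=
  exists2 s, (forall n, simple (s n)) & hazy_cvg s f.

Definition charge_Lfun p : set (X -> R) :=
  if p == 0 then [set f | T1_measurable f]
  else [set f | T1_measurable f /\ charge_integrable (fun x => `|f x| `^ p)].

Definition charge_dist p f g : R :=
  if p == 0 then inf [set e + outer (far f g e) | e in [set e : R | 0 < e]]
  else charge_integral (fun x => `|f x - g x| `^ p) `^ p^-1.

Definition charge_Lspace p : mvspace R (set (X -> R)) :=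
  fquot (charge_Lfun p) charge_ae_eq (charge_dist p).

End ChargeSpace.

Section Lebesgue.
Context {d : measure_display} {T : measurableType d} {R : realType}.
Variables (m : {measure set T -> \bar R}) (p : R).
Implicit Types f g : T -> R.

Definition lebesgue_Lfun : set (T -> R) :=
  if p == 0 then [set f | measurable_fun setT f]
  else [set f | f \in Lfun m p%:E].

Definition lebesgue_dist f g : R :=
  if p == 0 then inf [set e + fine (m (far f g e)) | e in [set e : R | 0 < e]]
  else fine ('N[m]_p%:E [EFin \o (f \- g)%R]).

Definition lebesgue_Lspace : mvspace R (set (T -> R)) :=
  fquot lebesgue_Lfun (fun f g => f = g %[ae m]) lebesgue_dist.

End Lebesgue.

Section MeasureSpace.
Variables (R : realType) (Y : pointedType) (B : set (set Y)) (mu : set Y -> R).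

(* The measurable sets of g_sigma_algebraType B are those of <<s B>>, that is,
   exactly B, as B is required to be a sigma-algebra. The library only has
   measurable spaces on pointed types; this excludes no representation, since
   phi \bot = set0 and phi \top = setT differ. *)
Definition measure_space
    (m : {measure set (g_sigma_algebraType B) -> \bar R}) : Prop :=
  sigma_algebra setT B /\ forall A, B A -> m A = (mu A)%:E.

Definition complete_measure_space : Prop :=
  exists2 m, measure_space m & measure_is_complete m.

Definition lebesgue_function_space (p : R) : Prop :=
  exists2 m, measure_space m &
    mv_coincide (charge_Lspace B mu p) (lebesgue_Lspace m p).

End MeasureSpace.

(* Main.v *)
Require Import Defs.
From HB Require Import structures.
From mathcomp Require Import all_boot all_order all_algebra.
From mathcomp Require Import all_classical all_reals all_analysis.
From mathcomp Require Import measurable_realfun ring lra.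

(** Densities are only finitely additive, but every charge space of the theorem
    maps into one complete measure space, and all questions about functions are
    answered there.

    The measure space comes from a property of the density: along an increasing
    sequence of sets with a density there is a set with a density that almost
    contains all terms, whose density is the limit of theirs, and that is the
    least such set up to null sets (dens_nondecreasing, dens_limit_least). So the
    classes of sets with a density form a monotone class, sigma[A] lies in it,
    and by the Boolean monotone class theorem sigma[A] is a subalgebra on which
    the density is additive and continuous along increasing sequences. Under a
    representation phi the supremum of a sequence may be larger than the union of
    the images, but only by sets of arbitrarily small charge. This is exactly
    what the Peano-Jordan completion absorbs: it is a sigma-algebra, and the
    extended charge is a complete measure (pj_bigcup_approx).

    For functions, let theta be a Boolean homomorphism from a charge space to a
    measure space that carries the charge to the measure. A simple function s
    lifts to the simple function with level sets theta (s = c); lifting commutes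
    with pointwise operations, and the integral of s is the Lebesgue integral of
    its lift (simple_integralE). A function f on the charge space corresponds to
    a measurable F when, at every precision, one simple function is close to f in
    outer charge while its lift is close to F in measure (tracks). Completeness
    of convergence in measure provides an F for each hazy limit f (T1_tracks); F
    is unique almost everywhere; the correspondence respects sums, multiples and
    continuous functions, and the outer charge of a set where f and g are far
    apart is the measure of the corresponding set for F and G, up to an
    arbitrarily small change of the threshold (tracks_outer_le,
    tracks_measure_le). It follows that f is in L_p if and only if F is, and that
    distances agree (charge_LfunP, charge_distE).

    With theta the identity, from phi(sigma[A]) or from its completion, every
    measurable function corresponds to itself, so the L_p spaces of these charge
    spaces are the Lebesgue space (id_coincide). With theta taking a in A to
    phi[a], the correspondence is an isometry of L_p(A) onto a subspace. It is
    dense because the elements of sigma[A] that can be approximated by classes of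
    sets of A form a monotone class (sigma_cls_approx). As Lebesgue spaces are
    complete, a complete dense subspace is everything, which is the last claim
    (fquot_complete_iff). *)

Set Implicit Arguments.
Unset Strict Implicit.
Unset Printing Implicit Defensive.
Import Order.TTheory Order.CTheory GRing.Theory Num.Theory.
Import numFieldNormedType.Exports.

Local Open Scope classical_set_scope.
Local Open Scope ring_scope.

(** * Monotone classes in Boolean algebras *)

Section MonotoneClass.
Context {d : Order.disp_t} {L : ctbDistrLatticeType d}.
Implicit Types (M G : set L) (a x y s : L).

Definition subalgebra M : Prop :=
  [/\ M \top%O, forall x y, M x -> M y -> M (x `|` y)%O &
      forall x, M x -> M (~` x)%O].

Lemma supremums_compl (u : nat -> L) s :
  supremums (range u) s -> infimums (range (fun n => ~` u n)%O) (~` s)%O.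
Proof.
move=> [us sl]; split.
  by move=> _ [n _ <-]; rewrite leC; apply: us; exists n.
move=> t tl; rewrite lexC; apply: sl => _ [n _ <-].
by rewrite -leC complK; apply: tl; exists n.
Qed.

Lemma infimums_compl (u : nat -> L) s :
  infimums (range u) s -> supremums (range (fun n => ~` u n)%O) (~` s)%O.
Proof.
move=> [us sl]; split.
  by move=> _ [n _ <-]; rewrite leC; apply: us; exists n.
move=> t tl; rewrite leCx; apply: sl => _ [n _ <-].
by rewrite -leC complK; apply: tl; exists n.
Qed.

Lemma supremums_join (u : nat -> L) s a :
  supremums (range u) s -> supremums (range (fun n => u n `|` a)%O) (s `|` a)%O.
Proof.
move=> [us sl]; split.
  by move=> _ [n _ <-]; rewrite leU2//; apply: us; exists n.
move=> t tl; rewrite leUx; apply/andP; split.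
  apply: sl => _ [n _ <-]; apply: (@le_trans _ _ (u n `|` a)%O).
    exact: leUl.
  by apply: tl; exists n.
apply: (@le_trans _ _ (u 0%N `|` a)%O); first exact: leUr.
by apply: tl; exists 0%N.
Qed.

(** The dual distributive law needs complements: a lower bound t of the joins
    with a yields the lower bound t minus a of the sequence itself. *)
Lemma infimums_join (u : nat -> L) s a :
  infimums (range u) s -> infimums (range (fun n => u n `|` a)%O) (s `|` a)%O.
Proof.
move=> [us sl]; split.
  by move=> _ [n _ <-]; rewrite leU2//; apply: us; exists n.
move=> t tl; rewrite joinC -leBLR; apply: sl => _ [n _ <-].
by rewrite leBLR joinC; apply: tl; exists n.
Qed.

(** Monotone classes are not stable under intersection by definition alone: it
    matters that suprema and infima are unique, so that all classes choose the
    same ones. *)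
Lemma smallest_monotone_class M0 G : monotone_class M0 -> G `<=` M0 ->
  monotone_class (smallest (@monotone_class d L) G).
Proof.
move=> M0m GM0; split=> x Mx xm.
- have [s _ xs] := M0m.1 x (fun n => Mx n M0 (conj M0m GM0)) xm.
  exists s => // M [Mm GM].
  have [s' Ms' xs'] := Mm.1 x (fun n => Mx n M (conj Mm GM)) xm.
  by rewrite (is_subset1_supremums xs xs').
- have [s _ xs] := M0m.2 x (fun n => Mx n M0 (conj M0m GM0)) xm.
  exists s => // M [Mm GM].
  have [s' Ms' xs'] := Mm.2 x (fun n => Mx n M (conj Mm GM)) xm.
  by rewrite (is_subset1_infimums xs xs').
Qed.

Lemma sub_smallest_monotone_class G : G `<=` smallest (@monotone_class d L) G.
Proof. by move=> x Gx M [_]; exact. Qed.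

Lemma smallest_monotone_class_ind M G : monotone_class M -> G `<=` M ->
  smallest (@monotone_class d L) G `<=` M.
Proof. by move=> Mm GM x; exact. Qed.

(** Complements exchange suprema and infima, so both halves of the definition
    of a monotone class are used. *)
Let monotone_class_compl M : monotone_class M ->
  monotone_class (M `&` [set x | M (~` x)%O]).
Proof.
move=> [Msup Minf]; split=> x Mx xm.
- have [s Ms xs] := Msup x (fun n => (Mx n).1) xm.
  exists s => //; split=> //=.
  have [|s' Ms' xs'] := Minf (fun n => ~` x n)%O (fun n => (Mx n).2).
    by move=> i j ij; rewrite leC; exact: xm.
  by rewrite (is_subset1_infimums (supremums_compl xs) xs').
- have [s Ms xs] := Minf x (fun n => (Mx n).1) xm.
  exists s => //; split=> //=.
  have [|s' Ms' xs'] := Msup (fun n => ~` x n)%O (fun n => (Mx n).2).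
    by move=> i j ij; rewrite leC; exact: xm.
  by rewrite (is_subset1_supremums (infimums_compl xs) xs').
Qed.

Let monotone_class_join M a : monotone_class M ->
  monotone_class (M `&` [set x | M (x `|` a)%O]).
Proof.
move=> [Msup Minf]; split=> x Mx xm.
- have [s Ms xs] := Msup x (fun n => (Mx n).1) xm.
  exists s => //; split=> //=.
  have [|s' Ms' xs'] := Msup (fun n => x n `|` a)%O (fun n => (Mx n).2).
    by move=> i j ij; rewrite leU2//; exact: xm.
  by rewrite (is_subset1_supremums (supremums_join a xs) xs').
- have [s Ms xs] := Minf x (fun n => (Mx n).1) xm.
  exists s => //; split=> //=.
  have [|s' Ms' xs'] := Minf (fun n => x n `|` a)%O (fun n => (Mx n).2).
    by move=> i j ij; rewrite leU2//; exact: xm.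
  by rewrite (is_subset1_infimums (infimums_join a xs) xs').
Qed.

(** The Boolean form of the monotone class theorem. Closure under joins takes
    two passes: against a fixed element of G first, which then allows an
    arbitrary element of the generated class on the other side. *)
Lemma smallest_monotone_class_subalgebra M0 G : monotone_class M0 ->
  G `<=` M0 -> subalgebra G -> subalgebra (smallest (@monotone_class d L) G).
Proof.
move=> M0m GM0 [G1 GU GC]; set M := smallest _ G.
have Mm : monotone_class M := smallest_monotone_class M0m GM0.
have GM : G `<=` M := @sub_smallest_monotone_class G.
have MC x : M x -> M (~` x)%O.
  have : M `<=` M `&` [set x | M (~` x)%O].
    apply: smallest_monotone_class_ind; first exact: monotone_class_compl.
    by move=> y Gy; split; apply: GM => //; exact: GC.
  by move=> /(_ x) /[apply] -[].
have MUG a x : G a -> M x -> M (x `|` a)%O.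
  move=> Ga; have : M `<=` M `&` [set x | M (x `|` a)%O].
    apply: smallest_monotone_class_ind; first exact: monotone_class_join.
    by move=> y Gy; split; apply: GM => //; exact: GU.
  by move=> /(_ x) /[apply] -[].
split=> //; first exact: GM.
move=> x a Mx Ma; have : M `<=` M `&` [set x | M (x `|` a)%O].
  apply: smallest_monotone_class_ind; first exact: monotone_class_join.
  by move=> y Gy; split; [exact: GM | rewrite /= joinC; exact: MUG].
by move=> /(_ x Mx) [].
Qed.

End MonotoneClass.

(** * Limits of sequences with explicit ranks *)

Lemma cvg_seqP (R : realType) (u : nat -> R) (l : R) :
  u @ \oo --> l <->
  forall e, 0 < e -> exists N, forall n, (N <= n)%N -> `|u n - l| < e.
Proof.
split=> [ul e e0|ul].
  have [N _ uN] := (@cvgrPdist_lt _ _ _ _ _ u l).1 ul e e0.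
  by exists N => n Nn; rewrite distrC; exact: uN.
apply/cvgrPdist_lt => e /ul[N uN]; exists N => // n /= Nn.
by rewrite distrC; exact: uN.
Qed.

(** * Asymptotic density *)

Section Density.
Variable R : realType.
Implicit Types (A B C : set posn) (a b l : R).
Local Notation avg := (avg R).
Local Notation cls := (cls R).
Local Notation null := (null R).

Lemma le_avg A B N : (forall i, (i < N)%N -> A (pos_succ i) -> B (pos_succ i)) ->
  avg A N <= avg B N.
Proof.
move=> AB; rewrite /Defs.avg ler_wpM2r ?invr_ge0// ler_sum// => i _.
rewrite !indicE; case: (boolP (_ \in A)) => [|_]; last exact: ler0n.
by rewrite !inE => /(AB _ (ltn_ord i)) Bi; rewrite mem_set.
Qed.

Lemma avgU A B N : avg (A `|` B) N <= avg A N + avg B N.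
Proof.
rewrite /Defs.avg -mulrDl ler_wpM2r ?invr_ge0// -big_split ler_sum// => i _ /=.
by rewrite !indicE in_setU; case: (_ \in A); case: (_ \in B);
  rewrite /= ?addr0 ?add0r// lerDl.
Qed.

Lemma avg_setU_disj A B N : A `&` B = set0 -> avg (A `|` B) N = avg A N + avg B N.
Proof.
move=> AB0; rewrite /Defs.avg -mulrDl; congr (_ / _); rewrite -big_split/=.
apply: eq_bigr => i _; rewrite !indicE in_setU.
case: (boolP (_ \in A)); case: (boolP (_ \in B)) => /=; rewrite ?addr0 ?add0r//.
rewrite !inE => Bi Ai; suff : (A `&` B) (pos_succ i) by rewrite AB0.
by split.
Qed.

Lemma avg_setT N : (0 < N)%N -> avg setT N = 1.
Proof.
move=> N0; rewrite /Defs.avg (eq_bigr (fun=> 1)).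
  by rewrite sumr_const card_ord divff// pnatr_eq0 -lt0n.
by move=> i _; rewrite indicT.
Qed.

Definition dens A l : Prop := avg A @ \oo --> l.

Lemma dens_has A l : dens A l -> has_density R A.
Proof. by move=> Al; apply/cvg_ex; exists l. Qed.

Lemma dens_asym A l : dens A l -> asym_density R A = l.
Proof. exact: cvg_lim. Qed.

Lemma has_dens A : has_density R A -> dens A (asym_density R A).
Proof. by []. Qed.

Lemma dens_ge0 A l : dens A l -> 0 <= l.
Proof.
by move=> Al; apply: cvgr_to_ge Al _; apply: nearW => N; exact: avg_ge0.
Qed.

Lemma dens_setT : dens setT 1.
Proof.
apply/cvg_seqP => e e0; exists 1%N => N N0.
by rewrite avg_setT// subrr normr0.
Qed.

Lemma densU A B a b : A `&` B = set0 -> dens A a -> dens B b ->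
  dens (A `|` B) (a + b).
Proof.
move=> AB0 Aa Bb; rewrite /dens (_ : avg (A `|` B) = avg A \+ avg B).
  exact: cvgD.
by apply/funext => N; rewrite avg_setU_disj.
Qed.

Lemma densD A B a b : A `<=` B -> dens A a -> dens B b -> dens (B `\` A) (b - a).
Proof.
move=> AB Aa Bb; rewrite /dens (_ : avg (B `\` A) = avg B \- avg A).
  exact: cvgB.
apply/funext => N /=.
have -> : avg B N = avg A N + avg (B `\` A) N; last by rewrite addrC addKr.
rewrite -{1}(setDUK AB) avg_setU_disj//.
by rewrite setDE setICA setICr setI0.
Qed.

Lemma densC A a : dens A a -> dens (~` A) (1 - a).
Proof. by move=> Aa; rewrite -setTD; apply: densD => //; exact: dens_setT. Qed.

Lemma le_dens A B a b : dens A a -> dens B b -> A `<=` B -> a <= b.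
Proof.
move=> Aa Bb AB; rewrite -subr_ge0; exact: dens_ge0 (densD AB Aa Bb).
Qed.

(** Changing a set on a null set changes its averages by a null sequence. *)
Lemma dens_null A B a : null (A `+` B) -> dens A a -> dens B a.
Proof.
move=> /nullP AB0 Aa.
apply/cvg_seqP => e e0.
have [|N1 HN1] := (cvg_seqP _ _).1 AB0 (e / 2); first exact: divr_gt0.
have [|N2 HN2] := (cvg_seqP _ _).1 Aa (e / 2); first exact: divr_gt0.
exists (maxn N1 N2) => N; rewrite geq_max => /andP[/HN1 + /HN2].
rewrite subr0 ger0_norm ?avg_ge0// => ABe Aae.
have AB1 : avg A N <= avg B N + avg (A `+` B) N.
  apply: le_trans (avgU _ _ _); apply: le_avg => i _; rewrite /setY/=.
  by case: (pselect (A (pos_succ i))); case: (pselect (B (pos_succ i))); tauto.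
have AB2 : avg B N <= avg A N + avg (A `+` B) N.
  apply: le_trans (avgU _ _ _); apply: le_avg => i _; rewrite /setY/=.
  by case: (pselect (A (pos_succ i))); case: (pselect (B (pos_succ i))); tauto.
by move: Aae; rewrite !ltr_norml => /andP[? ?]; apply/andP; split; lra.
Qed.

Lemma null_initial A (M : nat) : (forall x, A x -> (sval x <= M)%N) -> null A.
Proof.
move=> AM; apply/nullP.
have MN : (fun N => M%:R * N%:R^-1 : R) @ \oo --> (0 : R).
  rewrite -(mulr0 (M%:R : R)); apply: cvgMr.
  apply/gtr0_cvgV0; last exact: cvgr_idn.
  by exists 1%N => // n /=; rewrite ltr0n.
apply: squeeze_cvgr (cvg_cst 0) MN.
apply: nearW => N; rewrite avg_ge0/= /Defs.avg ler_wpM2r ?invr_ge0//.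
apply: (@le_trans _ _ (\sum_(i < N) (i < M)%N%:R)).
  apply: ler_sum => i _; rewrite indicE ler_nat.
  by case: (boolP (_ \in A)) => //; rewrite inE => /AM /= ->.
rewrite -natr_sum ler_nat.
suff : (\sum_(i < N) (i < M) <= minn N M)%N by rewrite leq_min => /andP[].
elim: N => [|N IH]; first by rewrite big_ord0.
rewrite big_ord_recr/=; case: (ltnP N M) => NM.
  rewrite addn1 (minn_idPl NM) ltnS; apply: leq_trans IH _; exact: geq_minl.
by rewrite addn0 (minn_idPr (leqW NM)); apply: leq_trans IH _; exact: geq_minr.
Qed.


(** Density is continuous along increasing sequences, with a limit set that
    almost contains every term. The union of the terms may fail to have a
    density, so each A k is cut off below a rank N k from which its average is
    close to its density. Up to N k.+1 the cut union S is then contained in A k,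
    and each A k loses only finitely many points. *)
Lemma dens_nondecreasing (A : nat -> set posn) (l : nat -> R) :
  (forall k, A k `<=` A k.+1) -> (forall k, dens (A k) (l k)) ->
  exists S s, [/\ dens S s, l @ \oo --> s & forall k, null (A k `\` S)].
Proof.
move=> AS Al.
have Amono : forall i j, (i <= j)%N -> A i `<=` A j.
  apply: homo_leq => [X|X Y Z|k]; [exact: subset_refl | exact: subset_trans |].
  exact: AS.
have lmono : nondecreasing_seq l.
  by move=> i j ij; apply: le_dens (Al i) (Al j) _; exact: Amono.
have lcvg : cvgn l.
  apply: nondecreasing_is_cvgn => //; exists 1 => _ [k _ <-].
  by apply: le_dens (Al k) dens_setT _.
set s := limn l in lcvg; have ls : l @ \oo --> s by [].
have les k : l k <= s by exact: nondecreasing_cvgn_le.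
have [M HM] : exists M : nat -> nat, forall k N, (M k <= N)%N ->
    `|avg (A k) N - l k| < k.+1%:R^-1.
  have :  forall k, exists Mk, forall N, (Mk <= N)%N ->
      `|avg (A k) N - l k| < k.+1%:R^-1.
    move=> k; have k0 : 0 < k.+1%:R^-1 :> R by rewrite invr_gt0.
    by have [Mk HMk] := (cvg_seqP _ _).1 (Al k) _ k0; exists Mk.
  by move=> /choice[M HM]; exists M.
(* Strictly increasing ranks, beyond the rank M k from which A k is controlled. *)
pose N := fix N k := if k is k'.+1 then maxn (M k) (N k').+1 else M 0%N.
have NS k : (N k < N k.+1)%N by rewrite /= leq_max leqnn orbT.
have MN k : (M k <= N k)%N by case: k => //= k; exact: leq_maxl.
have kN k : (k <= N k)%N by elim: k => // k IH; apply: leq_ltn_trans IH (NS k).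
have Nmono : forall i j, (i <= j)%N -> (N i <= N j)%N.
  by apply: (@homo_leq _ N leq) => [k|? ? ?|k]; [exact: leqnn | exact: leq_trans | exact/ltnW/NS].
pose S := [set x : posn | exists2 k, (N k < sval x)%N & A k x].
have nullAS k : null (A k `\` S).
  apply: (@null_initial _ (N k)) => x [Akx nSx].
  by rewrite leqNgt; apply/negP => Nx; apply: nSx; exists k.
exists S, s; split => //; apply/cvg_seqP => e e0.
have e20 : 0 < e / 2 by exact: divr_gt0.
have [k0 Hk0] := (cvg_seqP _ _).1 ls _ e20.
have [k1 _ Hk1] : \forall k \near \oo, k.+1%:R^-1 < e / 2 :> R.
  exact: (near_infty_natSinv_lt (PosNum e20)).
have {}Hk1 k : (k1 <= k)%N -> k.+1%:R^-1 < e / 2 :> R by exact: Hk1.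
pose k2 := maxn k0 k1.
have [|N1 HN1] := (cvg_seqP _ _).1 ((nullP _ _).1 (nullAS k2)) (e / 4).
  exact: divr_gt0.
have [|N2 HN2] := (cvg_seqP _ _).1 (Al k2) (e / 4); first exact: divr_gt0.
exists (maxn (N k2) (maxn N1 N2)) => n.
rewrite !geq_max => /and3P[N2n /HN1 n1 /HN2 n2].
have /ltr_normlP[_ lk2] : `|l k2 - s| < e / 2 by apply: Hk0; exact: leq_maxl.
have lo : avg (A k2) n <= avg S n + avg (A k2 `\` S) n.
  apply: le_trans (avgU _ _ _); apply: le_avg => i _ Ai.
  by case: (pselect (S (pos_succ i))); [left | right].
(* The block [N j, N j.+1] that contains n. *)
have [j [k2j Nj nN]] : exists j, [/\ (k2 <= j)%N, (N j <= n)%N & (n < N j.+1)%N].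
  have bnd j : (N j <= n)%N -> (j <= n)%N by exact: leq_trans (kN j).
  have ex : exists j, (N j <= n)%N by exists k2.
  have [j Nj jmax] := ex_maxnP ex bnd.
  exists j; split => //; first exact: jmax.
  by rewrite ltnNge; apply/negP => /jmax; rewrite ltnn.
have up : avg S n <= avg (A j) n.
  apply: le_avg => i ni [k /= Nk Ak]; apply: (@Amono k) Ak.
  rewrite -ltnS ltnNge; apply/negP => /Nmono.
  by rewrite leqNgt => /negP; apply; apply: (leq_trans Nk); apply: (leq_trans ni);
     exact: ltnW.
have /ltr_normlP[_ upj] : `|avg (A j) n - l j| < e / 2.
  apply: lt_trans (HM j n (leq_trans (MN j) Nj)) (Hk1 j _).
  by apply: leq_trans k2j; exact: leq_maxr.
have lj := les j.
rewrite subr0 in n1; move/ltr_normlP: n1 => [_ n1].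
move/ltr_normlP: n2 => [n2 _].
have /ltr_normlP[lk2' _] : `|l k2 - s| < e / 2 by apply: Hk0; exact: leq_maxl.
rewrite ltr_norml; apply/andP; split; last lra.
suff : s - l k2 < e / 2 by lra.
by lra.
Qed.

(** The limit set is the least one: S exceeds A k by a set of density at most
    s - l k. *)
Lemma dens_limit_least (A : nat -> set posn) (l : nat -> R) S s C :
  (forall k, dens (A k) (l k)) -> dens S s -> l @ \oo --> s ->
  (forall k, null (A k `\` S)) -> (forall k, null (A k `\` C)) ->
  null (S `\` C).
Proof.
move=> Al Ss ls AS AC; apply/nullP/cvg_seqP => e e0.
have e5 : 0 < e / 5 by exact: divr_gt0.
have [k Hk] := (cvg_seqP _ _).1 ls _ e5.
have {Hk} /ltr_normlP[lk _] := Hk k (leqnn k).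
have [N1 HN1] := (cvg_seqP _ _).1 (Al k) _ e5.
have [N2 HN2] := (cvg_seqP _ _).1 Ss _ e5.
have [N3 HN3] := (cvg_seqP _ _).1 ((nullP _ _).1 (AS k)) _ e5.
have [N4 HN4] := (cvg_seqP _ _).1 ((nullP _ _).1 (AC k)) _ e5.
exists (maxn (maxn N1 N2) (maxn N3 N4)) => n.
rewrite !geq_max => /andP[/andP[/HN1 /ltr_normlP[n1 _]]].
move=> /HN2 /ltr_normlP[_ n2] /andP[/HN3]; rewrite subr0 => /ltr_normlP[_ n3].
move=> /HN4; rewrite subr0 => /ltr_normlP[_ n4].
rewrite subr0 ger0_norm ?avg_ge0//.
have h1 : avg (S `\` C) n <= avg (S `\` A k) n + avg (A k `\` C) n.
  apply: le_trans (avgU _ _ _); apply: le_avg => i _ [Si nCi].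
  by case: (pselect (A k (pos_succ i))); [right | left].
have h2 : avg (S `\` A k) n + avg (S `&` A k) n <= avg S n.
  rewrite -avg_setU_disj; last by rewrite setDE setIACA setICl setI0.
  by apply: le_avg => i _ [[]|[]].
have h3 : avg (A k) n <= avg (S `&` A k) n + avg (A k `\` S) n.
  apply: le_trans (avgU _ _ _); apply: le_avg => i _ Ai.
  by case: (pselect (S (pos_succ i))); [left | right].
lra.
Qed.

End Density.
(** * The classes of sets with a density form a monotone class *)

Section DensityClasses.
Variable R : realType.
Implicit Types (A B C : set posn) (x y : pow_mod_null R).
Local Notation cls := (cls R).
Local Notation null := (null R).

Definition density_classes : set (pow_mod_null R) := cls @` has_density R.

Lemma le_cls A B : (cls A <= cls B)%O <-> null (A `\` B).
Proof.
rewrite leEmeet; split=> [/eqP|AB].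
  rewrite [(_ `&` _)%O]pmn_meet_cls => /clsP; apply: nullS => n [An nBn].
  by right; split=> // -[].
apply/eqP; rewrite [LHS]pmn_meet_cls; apply/clsP; apply: nullS AB => n.
by rewrite /setY/=; tauto.
Qed.

Lemma clsU A B : cls (A `|` B) = (cls A `|` cls B)%O.
Proof. by rewrite [RHS]pmn_join_cls. Qed.

Lemma clsI A B : cls (A `&` B) = (cls A `&` cls B)%O.
Proof. by rewrite [RHS]pmn_meet_cls. Qed.

Lemma clsC A : cls (~` A) = (~` cls A)%O.
Proof. by rewrite [RHS]pmn_compl_cls. Qed.

Lemma dens_qdensity A (l : R) : dens A l -> qdensity (cls A) = l.
Proof.
move=> Al; apply: dens_asym; apply: dens_null Al; rewrite setYC.
exact: repr_cls.
Qed.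

Lemma qdensity_cls A : has_density R A -> qdensity (cls A) = asym_density R A.
Proof. exact: dens_qdensity. Qed.

Lemma density_classesP x : density_classes x ->
  exists2 A, x = cls A & dens A (qdensity x).
Proof. by move=> [A Ad <-]; exists A => //; rewrite qdensity_cls. Qed.

Lemma dens_density_classes A (l : R) : dens A l -> density_classes (cls A).
Proof. by move=> Al; exists A => //; exact: dens_has Al. Qed.

Lemma qdensity_ge0 x : density_classes x -> 0 <= qdensity x.
Proof. by move=> /density_classesP[A _]; exact: dens_ge0. Qed.

(** Disjointness in the quotient is disjointness up to a null set, which is
    removed from one of the representatives. *)
Lemma qdensity_join x y : density_classes x -> density_classes y ->
  (x `&` y = \bot)%O -> qdensity (x `|` y)%O = qdensity x + qdensity y.
Proof.
move=> /density_classesP[A xA Ax] /density_classesP[B yB By] xy0.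
have AB0 : null (A `&` B).
  have /clsP : cls (A `&` B) = cls set0 by rewrite clsI -xA -yB xy0.
  by apply: nullS => n ABn; left; split => // -[].
have yE : y = cls (B `\` A).
  rewrite yB; apply/clsP; apply: nullS AB0 => n; rewrite /setY/=.
  by case: (pselect (A n)); tauto.
rewrite [in LHS]yE [in LHS]xA -clsU; apply: dens_qdensity.
apply: densU; last 2 first.
- by [].
- by apply: (dens_null _ By); apply/clsP; rewrite -yE.
by rewrite setDE setICA setICr setI0.
Qed.

Lemma density_classes_compl x : density_classes x -> density_classes (~` x)%O.
Proof.
move=> /density_classesP[A -> Ax]; rewrite -clsC.
exact: dens_density_classes (densC Ax).
Qed.

(** The whole analytic content of the monotone class property: the supremum
    exists, has a density, and the density is continuous. *)
Lemma qdensity_supremum (x : nat -> pow_mod_null R) :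
  (forall n, density_classes (x n)) -> nondecreasing_seq x ->
  exists s, [/\ density_classes s, supremums (range x) s &
                qdensity (x n) @[n --> \oo] --> qdensity s].
Proof.
move=> xF xm.
have /choice[B HB] n : exists B, x n = cls B by have [B ->] := cls_surj (x n); exists B.
(* The representatives are made increasing, not only increasing up to null
   sets. *)
pose A := fix A n := if n is n'.+1 then A n' `|` B n else B 0%N.
have xA n : x n = cls (A n).
  elim: n => [|n IH]; rewrite HB//= clsU -IH -HB.
  by rewrite join_r//; exact: xm.
have Ad n : dens (A n) (qdensity (x n)).
  by have [C xC] := density_classesP (xF n); apply: dens_null; apply/clsP; rewrite -xC.
have [|S [s [Ss qs AS]]] := dens_nondecreasing _ Ad.
  by move=> k; exact: subsetUl.
exists (cls S); split; [exact: dens_density_classes Ss | split | ].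
- by move=> _ [n _ <-]; rewrite xA; apply/le_cls.
- move=> y xy; have [C yC] := cls_surj y; rewrite yC; apply/le_cls.
  apply: (dens_limit_least Ad Ss qs AS) => k; apply/le_cls.
  by rewrite -xA -yC; apply: xy; exists k.
- by rewrite (dens_qdensity Ss).
Qed.

Lemma monotone_class_density : monotone_class density_classes.
Proof.
split=> x xF xm.
  by have [s [sF xs _]] := qdensity_supremum xF xm; exists s.
have [||s [sF xs _]] := @qdensity_supremum (fun n => ~` x n)%O.
- by move=> n; exact: density_classes_compl.
- by move=> i j ij; rewrite leC; exact: xm.
exists (~` s)%O; first exact: density_classes_compl.
rewrite (_ : range x = range (fun n => ~` ~` x n)%O).
  exact: supremums_compl xs.
by apply: eq_imagel => n _; rewrite complK.
Qed.

End DensityClasses.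
Arguments density_classes : clear implicits.

(** * The charge that the density induces on the generated monotone class *)

Section SigmaCls.
Variables (R : realType) (A : set (set posn)).
Hypotheses (Af : set_field A) (Ad : A `<=` has_density R).
Local Notation M := (sigma_cls R A).

Lemma sigma_cls_generators : [set cls R a | a in A] `<=` density_classes R.
Proof. by move=> _ [a /Ad ad <-]; exists a. Qed.

Lemma sigma_cls_density : M `<=` density_classes R.
Proof.
apply: smallest_monotone_class_ind; first exact: monotone_class_density.
exact: sigma_cls_generators.
Qed.

Lemma sigma_cls_monotone : monotone_class M.
Proof.
exact: (smallest_monotone_class (@monotone_class_density R) sigma_cls_generators).
Qed.

Lemma sigma_cls_subalgebra : subalgebra M.
Proof.
apply: smallest_monotone_class_subalgebra (@monotone_class_density R) _ _.
  exact: sigma_cls_generators.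
have [AT AU AC] := Af; split.
- by exists setT.
- by move=> _ _ [a Aa <-] [b Ab <-]; exists (a `|` b); [exact: AU|exact: clsU].
- by move=> _ [a Aa <-]; exists (~` a); [exact: AC|exact: clsC].
Qed.

(** The supremum in the generated class is the one found among the classes with
    a density, so continuity is inherited. *)
Lemma sigma_cls_supremum (x : nat -> pow_mod_null R) :
  (forall n, M (x n)) -> nondecreasing_seq x ->
  exists s, [/\ M s, supremums (range x) s &
                qdensity (x n) @[n --> \oo] --> qdensity s].
Proof.
move=> xM xm.
have [s sM xs] := sigma_cls_monotone.1 x xM xm.
have [s' [_ xs' qs]] := qdensity_supremum (fun n => sigma_cls_density (xM n)) xm.
rewrite -(is_subset1_supremums xs xs') in qs.
by exists s.
Qed.

End SigmaCls.

(** * Charge spaces *)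

Definition is_charge (R : realType) (X : Type) (B : set (set X))
    (mu : set X -> R) : Prop :=
  [/\ set_field B, forall A, B A -> 0 <= mu A &
      forall A A', B A -> B A' -> A `&` A' = set0 -> mu (A `|` A') = mu A + mu A'].

Lemma bigsetU_le (T : Type) (F G : nat -> set T) n : (forall i, F i `<=` G i) ->
  \big[setU/set0]_(i < n) F i `<=` \big[setU/set0]_(i < n) G i.
Proof.
move=> FG; elim: n => [|n IH]; first by rewrite !big_ord0.
by rewrite !big_ord_recr; exact: setUSS.
Qed.

Section SetField.
Variables (X : Type) (B : set (set X)).
Hypothesis Bf : set_field B.

Lemma set_field_setT : B setT. Proof. by case: Bf. Qed.

Lemma set_fieldU A A' : B A -> B A' -> B (A `|` A').
Proof. by case: Bf => _ BU _; exact: BU. Qed.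

Lemma set_fieldC A : B A -> B (~` A).
Proof. by case: Bf => _ _ BC; exact: BC. Qed.

Lemma set_field_set0 : B set0.
Proof. by rewrite -setCT; apply: set_fieldC; exact: set_field_setT. Qed.

Lemma set_fieldI A A' : B A -> B A' -> B (A `&` A').
Proof.
by move=> BA BA'; rewrite -[A `&` A']setCK setCI;
  apply/set_fieldC/set_fieldU; exact: set_fieldC.
Qed.

Lemma set_fieldD A A' : B A -> B A' -> B (A `\` A').
Proof. by move=> BA BA'; rewrite setDE; apply: set_fieldI => //; exact: set_fieldC. Qed.

Lemma set_field_bigsetU (I : Type) (r : seq I) (P : pred I) (F : I -> set X) :
  (forall i, P i -> B (F i)) -> B (\big[setU/set0]_(i <- r | P i) F i).
Proof.
by move=> BF; elim/big_ind : _ => //; [exact: set_field_set0|exact: set_fieldU].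
Qed.

End SetField.

Section Charge.
Variables (R : realType) (X : Type) (B : set (set X)) (mu : set X -> R).
Hypothesis muB : is_charge B mu.

Let Bf : set_field B. Proof. by case: muB. Qed.

Lemma charge_ge0 A : B A -> 0 <= mu A. Proof. by case: muB => _ mu0 _; exact: mu0. Qed.

Lemma charge_setU A A' : B A -> B A' -> A `&` A' = set0 ->
  mu (A `|` A') = mu A + mu A'.
Proof. by case: muB => _ _ muU; exact: muU. Qed.

Lemma charge_set0 : mu set0 = 0.
Proof.
have B0 := set_field_set0 Bf.
have := charge_setU B0 B0 (set0I _); rewrite set0U => /eqP.
by rewrite addrC -subr_eq subrr eq_sym => /eqP.
Qed.

Lemma charge_setD A A' : B A -> B A' -> A `<=` A' -> mu (A' `\` A) = mu A' - mu A.
Proof.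
move=> BA BA' AA'; rewrite -{2}(setDUK AA') charge_setU//.
- by rewrite addrC addrA addNr add0r.
- exact: set_fieldD.
- by rewrite setDE setICA setICr setI0.
Qed.

Lemma le_charge A A' : B A -> B A' -> A `<=` A' -> mu A <= mu A'.
Proof.
move=> BA BA' AA'; rewrite -subr_ge0 -charge_setD//; apply: charge_ge0.
exact: set_fieldD.
Qed.

Lemma charge_subadd A A' : B A -> B A' -> mu (A `|` A') <= mu A + mu A'.
Proof.
move=> BA BA'; have -> : A `|` A' = A `|` (A' `\` A).
  by apply/seteqP; split=> x; case: (pselect (A x)); rewrite /setD/=; tauto.
rewrite charge_setU//; last 2 first.
- exact: set_fieldD.
- by rewrite setDE setICA setICr setI0.
rewrite lerD2l; apply: le_charge => //; exact: set_fieldD.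
Qed.

Implicit Types E F : set X.

Let outer_set E := [set mu b | b in [set b | B b /\ E `<=` b]].

Let outer_has_inf E : has_inf (outer_set E).
Proof.
split; first by exists (mu setT), setT => //; split=> //; exact: set_field_setT.
by exists 0 => _ [b [Bb _] <-]; exact: charge_ge0.
Qed.

Lemma outer_ge0 E : 0 <= outer B mu E.
Proof.
apply: lb_le_inf; first by case: (outer_has_inf E).
by move=> _ [b [Bb _] <-]; exact: charge_ge0.
Qed.

Lemma outer_le E b : B b -> E `<=` b -> outer B mu E <= mu b.
Proof.
move=> Bb Eb; apply: ge_inf; first by case: (outer_has_inf E).
by exists b.
Qed.

Lemma outer_lt E e : outer B mu E < e -> exists b, [/\ B b, E `<=` b & mu b < e].
Proof.
move=> Ee; have [|_ [b [Bb Eb] <-]] := @inf_adherent _ _ (e - outer B mu E) _ (outer_has_inf E).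
  by rewrite subr_gt0.
by rewrite -/(outer B mu E) addrC subrK => be; exists b.
Qed.

Lemma outerE b : B b -> outer B mu b = mu b.
Proof.
move=> Bb; apply/eqP; rewrite eq_le outer_le//=.
apply: lb_le_inf; first by case: (outer_has_inf b).
by move=> _ [c [Bc bc] <-]; exact: le_charge.
Qed.

Lemma le_outer E F : E `<=` F -> outer B mu E <= outer B mu F.
Proof.
move=> EF; apply: lb_le_inf; first by case: (outer_has_inf F).
by move=> _ [c [Bc Fc] <-]; apply: outer_le => //; exact: subset_trans Fc.
Qed.

Lemma outerU_lt E F e e' : outer B mu E < e -> outer B mu F < e' ->
  outer B mu (E `|` F) < e + e'.
Proof.
move=> /outer_lt[b [Bb Eb be]] /outer_lt[c [Bc Fc ce]].
apply: le_lt_trans (ltrD be ce); apply: le_trans (charge_subadd Bb Bc).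
by apply: outer_le; [exact: set_fieldU | exact: setUSS].
Qed.

Lemma outerU E F : outer B mu (E `|` F) <= outer B mu E + outer B mu F.
Proof.
apply/ler_addgt0Pr => e e0; apply/ltW.
rewrite [e]splitr addrACA; apply: outerU_lt; rewrite ltrDl divr_gt0//.
Qed.

End Charge.

(** * The Peano-Jordan completion as a complete measure space *)

Section PeanoJordan.
Variables (R : realType) (Y : pointedType) (S : set (set Y)) (mu : set Y -> R).
Hypothesis muS : is_charge S mu.
Hypothesis mu_sup : forall F : nat -> set Y, (forall n, S (F n)) ->
  (forall n, F n `<=` F n.+1) ->
  exists C, [/\ S C, forall n, F n `<=` C & mu (F n) @[n --> \oo] --> mu C].

Local Notation pj := (pj_field S mu).
Local Notation pjmu := (pj_charge S mu).

Let Sf : set_field S. Proof. by case: muS. Qed.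

Let inner_set A := [set mu b | b in [set b | S b /\ b `<=` A]].

Let inner_nonempty A : inner_set A !=set0.
Proof.
by exists (mu set0), set0 => //; split; [exact: set_field_set0 | exact: sub0set].
Qed.

Let inner_bounded A : has_ubound (inner_set A).
Proof.
exists (mu setT) => _ [b [Sb _] <-].
by apply: (le_charge muS) => //; exact: set_field_setT.
Qed.

Lemma pj_charge_ge A b : S b -> b `<=` A -> mu b <= pjmu A.
Proof. by move=> Sb bA; apply: ub_le_sup; [exact: inner_bounded | exists b]. Qed.

Lemma pj_charge_le A c : S c -> A `<=` c -> pjmu A <= mu c.
Proof.
move=> Sc Ac; apply: ge_sup; first exact: inner_nonempty.
move=> _ [b [Sb bA] <-]; apply: (le_charge muS) => //.
exact: subset_trans Ac.
Qed.

Lemma pj_charge_ge0 A : 0 <= pjmu A.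
Proof.
rewrite -(charge_set0 muS); apply: pj_charge_ge; last exact: sub0set.
exact: set_field_set0.
Qed.

Lemma pj_chargeE A : S A -> pjmu A = mu A.
Proof. by move=> SA; apply/eqP; rewrite eq_le pj_charge_le// pj_charge_ge. Qed.

Lemma le_pj_charge A A' : A `<=` A' -> pjmu A <= pjmu A'.
Proof.
move=> AA'; apply: ge_sup; first exact: inner_nonempty.
by move=> _ [b [Sb bA] <-]; apply: pj_charge_ge => //; exact: subset_trans AA'.
Qed.

Lemma sub_pj_field : S `<=` pj.
Proof.
by move=> A SA e e0; exists A, A; split => //; rewrite setDv (charge_set0 muS).
Qed.

Lemma pj_fieldC A : pj A -> pj (~` A).
Proof.
move=> pA e /pA[b [c [Sb Sc bA Ac bce]]]; exists (~` c), (~` b).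
split; [exact: set_fieldC|exact: set_fieldC|exact: subsetC|exact: subsetC|].
by rewrite setDE setCK setIC -setDE.
Qed.

(** A countable union is pinned between a finite union of inner sets and a
    single outer set: the outer sets have an almost exact common upper bound
    in S, and the errors are summed geometrically. *)
Lemma pj_bigcup_approx (F : nat -> set Y) (e : R) :
  (forall n, pj (F n)) -> 0 < e -> exists n b c,
  [/\ S b, S c, b `<=` \big[setU/set0]_(i < n) F i, \bigcup_i F i `<=` c &
      mu (c `\` b) < e].
Proof.
(* The n-th set is approximated within r n.+1, so that the first n errors add up
   to at most e / 2 - r n. *)
move=> pF e0; pose r n : R := e / 2 / 2 ^+ n.
have r0 n : 0 < r n by rewrite !divr_gt0// exprn_gt0.
have rS n : r n = r n.+1 + r n.+1.
  by rewrite /r exprSr invfM mulrA -splitr.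
have /choice[bc Hbc] n : exists bc : set Y * set Y,
    [/\ S bc.1, S bc.2, bc.1 `<=` F n, F n `<=` bc.2 & mu (bc.2 `\` bc.1) < r n.+1].
  by have [b [c ?]] := pF n _ (r0 n.+1); exists (b, c).
pose U n := \big[setU/set0]_(i < n) (bc i).2.
pose V n := \big[setU/set0]_(i < n) (bc i).1.
have SU n : S (U n) by apply: set_field_bigsetU => // i _; case: (Hbc i).
have SV n : S (V n) by apply: set_field_bigsetU => // i _; case: (Hbc i).
have UVr n : mu (U n `\` V n) <= e / 2 - r n.
  elim: n => [|n IH].
    by rewrite /U /V !big_ord0 setDv (charge_set0 muS) /r expr0 divr1 subrr.
  have [Sb Sc bF Fc bcr] := Hbc n.
  apply: (@le_trans _ _ (mu ((U n `\` V n) `|` ((bc n).2 `\` (bc n).1)))).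
    apply: (le_charge muS); [exact: set_fieldD | | ].
      by apply: set_fieldU => //; exact: set_fieldD.
    by move=> x; rewrite /U /V !big_ord_recr/= /setD/= => -[[]]; tauto.
  apply: le_trans (charge_subadd muS _ _) _; [exact: set_fieldD..|].
  by have := rS n; lra.
have [C [SC UC muC]] : exists C, [/\ S C, forall n, U n `<=` C &
    mu (U n) @[n --> \oo] --> mu C].
  by apply: mu_sup => // n; rewrite /U big_ord_recr; exact: subsetUl.
have [|N HN] := (cvg_seqP _ _).1 muC (e / 2); first exact: divr_gt0.
exists N, (V N), C; split => //.
- by apply: (@bigsetU_le _ (fun i => (bc i).1) F) => i; case: (Hbc i).
- move=> x [i _ Fix]; apply: (UC i.+1); rewrite /U big_ord_recr/=; right.
  by case: (Hbc i) => _ _ _ + _; exact.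
- have VU : V N `<=` U N.
    apply: (@bigsetU_le _ (fun i => (bc i).1) (fun i => (bc i).2)) => i.
    by case: (Hbc i) => _ _ bF Fc _; exact: subset_trans Fc.
  have := HN N (leqnn N); rewrite distrC => /ltr_normlP[_].
  rewrite (charge_setD muS)//; last exact: (subset_trans VU (UC N)).
  by have := UVr N; rewrite (charge_setD muS)//; have := r0 N; lra.
Qed.

Lemma pj_bigcup (F : nat -> set Y) : (forall n, pj (F n)) -> pj (\bigcup_i F i).
Proof.
move=> pF e e0; have [n [b [c [Sb Sc bF Fc bce]]]] := pj_bigcup_approx pF e0.
exists b, c; split => //; apply: (subset_trans bF).
exact: bigsetU_bigcup.
Qed.

Lemma pj_sigma_algebra : sigma_algebra setT pj.
Proof.
split; [by apply: sub_pj_field; exact: set_field_set0 | | exact: pj_bigcup].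
by move=> A pA; rewrite setTD; exact: pj_fieldC.
Qed.

Lemma pj_fieldU A A' : pj A -> pj A' -> pj (A `|` A').
Proof.
move=> pA pA'; rewrite -bigcup2E; apply: pj_bigcup => -[|[|n]] //=.
by apply: sub_pj_field; exact: set_field_set0.
Qed.

(** The form in which membership in the completion is used below. *)
Lemma pj_approx A e : pj A -> 0 < e -> exists b c,
  [/\ S b, S c, b `<=` A, A `<=` c & mu c < mu b + e].
Proof.
move=> pA /pA[b [c [Sb Sc bA Ac bce]]]; exists b, c; split => //.
rewrite (charge_setD muS) in bce; [|by []|by []|exact: subset_trans Ac].
by rewrite -ltrBlDl.
Qed.

Lemma pj_chargeU A A' : pj A -> pj A' -> A `&` A' = set0 ->
  pjmu (A `|` A') = pjmu A + pjmu A'.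
Proof.
move=> pA pA' AA'0; apply/eqP; rewrite eq_le; apply/andP.
suff H e : 0 < e -> pjmu (A `|` A') < pjmu A + pjmu A' + e /\
    pjmu A + pjmu A' < pjmu (A `|` A') + e.
  by split; apply/ler_addgt0Pr => e /H[H1 H2]; apply/ltW.
move=> e0; have e20 : 0 < e / 2 by rewrite divr_gt0.
have [b [c [Sb Sc bA Ac bce]]] := pj_approx pA e20.
have [b' [c' [Sb' Sc' bA' Ac' bce']]] := pj_approx pA' e20.
have := pj_charge_ge Sb bA; have := pj_charge_ge Sb' bA'.
have := pj_charge_le (set_fieldU Sf Sc Sc') (setUSS Ac Ac').
have := charge_subadd muS Sc Sc'.
have := pj_charge_le Sc Ac; have := pj_charge_le Sc' Ac'.
have := pj_charge_ge (set_fieldU Sf Sb Sb') (setUSS bA bA').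
rewrite (charge_setU muS)//; last first.
  by rewrite -subset0 -AA'0; exact: setISS.
by split; lra.
Qed.

Local Notation T := (g_sigma_algebraType pj).

Lemma pj_measurableE (A : set T) : measurable A = pj A.
Proof. by rewrite measurable_g_measurableTypeE//; exact: pj_sigma_algebra. Qed.

Let pj_mfun (A : set T) : \bar R := (pjmu A)%:E.

Let pj_mfun0 : pj_mfun set0 = 0%E.
Proof.
by rewrite /pj_mfun pj_chargeE ?(charge_set0 muS)//; exact: set_field_set0.
Qed.

Let pj_mfun_ge0 A : (0 <= pj_mfun A)%E.
Proof. by rewrite lee_fin pj_charge_ge0. Qed.

Lemma pj_charge_bigsetU (F : nat -> set Y) n : (forall i, pj (F i)) ->
  trivIset setT F ->
  pj (\big[setU/set0]_(i < n) F i) /\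
  pjmu (\big[setU/set0]_(i < n) F i) = \sum_(i < n) pjmu (F i).
Proof.
move=> pF tF; elim: n => [|n [IHp IHm]].
  rewrite !big_ord0; split; first by apply: sub_pj_field; exact: set_field_set0.
  by rewrite pj_chargeE ?(charge_set0 muS)//; exact: set_field_set0.
rewrite !big_ord_recr/=; split; first exact: pj_fieldU.
rewrite pj_chargeU// ?IHm//.
by apply: (@trivIset_bigsetUI _ predT) => // i j _ _; exact: tF.
Qed.

Let pj_mfun_sigma_additive : semi_sigma_additive pj_mfun.
Proof.
move=> F mF tF mUF.
have pF i : pj (F i) by rewrite -pj_measurableE.
rewrite (_ : (fun n => _) = EFin \o (fun n => \sum_(i < n) pjmu (F i))); last first.
  by apply/funext => n /=; rewrite big_mkord sumEFin.
apply: cvg_EFin; first exact: nearW.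
apply/cvg_seqP => e e0.
have [n [b [c [Sb Sc bF Fc bce]]]] := pj_bigcup_approx pF e0.
exists n => k nk.
rewrite /= -(pj_charge_bigsetU k pF tF).2.
have bFk := subset_trans bF (@subset_bigsetU _ F _ _ nk).
have FkF := @bigsetU_bigcup _ F k.
have h1 := le_pj_charge FkF; have h2 := pj_charge_ge Sb bFk.
have h3 := pj_charge_le Sc Fc.
rewrite (charge_setD muS) in bce; [|by []|by []|]; last first.
  exact: (subset_trans bFk (subset_trans FkF Fc)).
by rewrite ltr_norml; apply/andP; split; lra.
Qed.

Definition pj_measure : {measure set T -> \bar R} :=
  HB.pack pj_mfun (isMeasure.Build _ _ _ pj_mfun pj_mfun0 pj_mfun_ge0
    pj_mfun_sigma_additive).

Lemma pj_measureE (A : set T) : pj_measure A = (pjmu A)%:E.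
Proof. by []. Qed.

Lemma pj_measure_space : measure_space pjmu pj_measure.
Proof. by split; [exact: pj_sigma_algebra|]. Qed.

(** A subset of a null set is sandwiched between the empty set and sets of S of
    arbitrarily small charge. *)
Lemma pj_measure_complete : measure_is_complete pj_measure.
Proof.
move=> E [A [mA A0 EA]]; rewrite pj_measurableE => e e0.
move: mA A0; rewrite pj_measurableE pj_measureE => pA [A0].
have [b [c [Sb Sc bA Ac bce]]] := pj_approx pA e0.
exists set0, c; split => //; first exact: set_field_set0.
  exact: subset_trans Ac.
by rewrite setD0; have := pj_charge_ge Sb bA; lra.
Qed.

End PeanoJordan.
(** * Convergence in measure *)

Lemma cauchy_seq_cvg (R : realType) (u : nat -> R) :
  (forall e, 0 < e -> exists N, forall i j, (N <= i)%N -> (N <= j)%N ->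
     `|u i - u j| < e) -> cvgn u.
Proof.
move=> uC; apply: R_complete; apply: cauchy_exP => e /uC[N HN].
exists (u N); exists N => // n /= Nn; exact: HN.
Qed.

Section Far.
Variables (R : realType) (X : Type).
Implicit Types (f g h : X -> R) (a b : R).

Lemma farC f g a : far f g a = far g f a.
Proof. by apply/funext => x; rewrite /far/= distrC. Qed.

Lemma far_triangle f g h a b : far f h (a + b) `<=` far f g a `|` far g h b.
Proof.
move=> x; rewrite /far/= => ab; apply/orP; rewrite -implyNb -leNgt.
apply/implyP => fga; rewrite -(ltrD2l a); apply: lt_le_trans ab _.
by apply: le_trans (ler_distD (g x) _ _) _; rewrite lerD2r.
Qed.

Lemma le_far f g a b : a <= b -> far f g b `<=` far f g a.
Proof. by move=> ab x; exact: le_lt_trans. Qed.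

(** Replacing both functions costs twice the precision in the threshold. *)
Lemma far_triangle3 f s t g a r :
  far f g a `<=` far f s r `|` (far s t (a - 2 * r) `|` far t g r).
Proof.
have -> : a = r + (a - 2 * r + r) by ring.
apply: subset_trans (@far_triangle f s g _ _) _; apply: setUS.
have -> : r + (a - 2 * r + r) - 2 * r = a - 2 * r by ring.
exact: far_triangle.
Qed.

End Far.

Section InMeasure.
Context {d : measure_display} {T : measurableType d} {R : realType}.
Variable m : {measure set T -> \bar R}.
Hypothesis mfin : (m setT < +oo)%E.
Implicit Types (f g h : T -> R) (A B : set T) (a b e : R).

Lemma measurable_far f g a : measurable_fun setT f -> measurable_fun setT g ->
  measurable (far f g a).
Proof.
move=> mf mg; rewrite (_ : far f g a = setT `&` (fun x => `|f x - g x|) @^-1` `]a, +oo[).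
  have mfg : measurable_fun setT (fun x => `|f x - g x|).
    by apply: measurableT_comp => //; exact: measurable_funB.
  by apply: mfg => //; exact: measurable_itv.
by rewrite setTI; apply/seteqP; split=> x; rewrite /far/= in_itv/= andbT.
Qed.

Lemma measureU_lt A B a b : measurable A -> measurable B ->
  (m A < a%:E)%E -> (m B < b%:E)%E -> (m (A `|` B) < (a + b)%:E)%E.
Proof.
move=> mA mB Aa Bb; apply: le_lt_trans (measureU2 _ mA mB) _.
by rewrite EFinD; exact: lteD.
Qed.

Lemma sub_measure A B : measurable A -> measurable B -> A `<=` B -> (m A <= m B)%E.
Proof. by move=> mA mB AB; apply: le_measure => //; rewrite inE. Qed.

Lemma sub_measure_lt A B (x : \bar R) : measurable A -> measurable B ->
  A `<=` B -> (m B < x)%E -> (m A < x)%E.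
Proof. by move=> mA mB AB; apply: le_lt_trans; exact: sub_measure. Qed.

Definition cvg_in_measure (u : nat -> T -> R) f : Prop :=
  forall e, 0 < e -> exists N, forall n, (N <= n)%N -> (m (far (u n) f e) < e%:E)%E.

Definition cvg_off (Z : set T) (u : nat -> T -> R) f : Prop :=
  [/\ measurable Z, m Z = 0%E & forall x, ~ Z x -> u n x @[n --> \oo] --> f x].

(** The set of points that are far from the limit infinitely often is null. *)
Lemma cvg_off_in_measure Z (u : nat -> T -> R) f :
  (forall n, measurable_fun setT (u n)) -> measurable_fun setT f ->
  cvg_off Z u f -> cvg_in_measure u f.
Proof.
move=> mu mf [mZ mZ0 uf] e e0; pose A n := far (u n) f e.
have mA n : measurable (A n) by exact: measurable_far.
have A0 : m (lim_sup_set A) = 0%E.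
  apply/eqP; rewrite -measure_le0 -mZ0; apply: sub_measure => //.
    by apply: bigcap_measurable => // k _; exact: bigcup_measurable.
  move=> x limA; apply: contrapT => /uf /cvg_seqP/(_ e e0)[N HN].
  have [n /= Nn] := limA N I.
  by rewrite /A /far/= ltNge => /negP; apply; exact/ltW/HN.
have mAN : (m (\bigcup_(k >= 0) A k) < +oo)%E.
  apply: sub_measure_lt mfin => //; exact: bigcup_measurable.
have := lim_sup_set_cvg m A mA mAN; rewrite A0 => Acvg.
have [N _ HN] : \forall n \near \oo, (m (\bigcup_(k >= n) A k) < e%:E)%E.
  by apply: (Acvg [set x | (x < e%:E)%E]); apply: open_ereal_lt'; rewrite lte_fin.
exists N => n Nn; apply: (sub_measure_lt (mA n) _ _ (HN N (leqnn N))).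
  by apply: bigcup_measurable => k _; exact: mA.
by move=> x Ax; exists n.
Qed.

(** Riesz: along a subsequence whose consecutive terms are 2^-(n+1)-close off a
    set of measure less than 2^-(n+1), Borel-Cantelli gives convergence off a null
    set; the limit function is set to 0 there. *)
Lemma cauchy_in_measure_cvg (u : nat -> T -> R) :
  (forall n, measurable_fun setT (u n)) ->
  (forall e, 0 < e -> exists N, forall i j, (N <= i)%N -> (N <= j)%N ->
     (m (far (u i) (u j) e) < e%:E)%E) ->
  exists f Z k, [/\ measurable_fun setT f, cvg_in_measure u f,
    forall n, (n <= k n)%N & cvg_off Z (u \o k) f].
Proof.
move=> mu uC; pose r n : R := 1 / (2 ^ n.+1)%:R.
have r0 n : 0 < r n by rewrite divr_gt0// ltr0n expn_gt0.
have rS n : r n = r n.+1 + r n.+1.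
  by rewrite /r (expnS 2 n.+1) natrM; field; rewrite pnatr_eq0 expn_eq0.
have /choice[N HN] n := uC _ (r0 n).
pose k := fix k n := if n is n'.+1 then maxn (N n) (k n').+1 else N 0%N.
have Nk n : (N n <= k n)%N by case: n => //= n; exact: leq_maxl.
have kS n : (k n < k n.+1)%N by rewrite /= leq_max leqnn orbT.
have kmono : forall i j, (i <= j)%N -> (k i <= k j)%N.
  by apply: (@homo_leq _ k leq) => [i|? ? ?|i]; [exact: leqnn|exact: leq_trans|exact/ltnW/kS].
have kn n : (n <= k n)%N by elim: n => // n IH; exact: leq_ltn_trans (kS n).
pose A n := far (u (k n)) (u (k n.+1)) (r n).
have mA n : measurable (A n) by exact: measurable_far.
have Ar n : (m (A n) <= (r n)%:E)%E.
  by apply/ltW/HN; [exact: Nk | exact: leq_trans (Nk n) (kmono _ _ (leqnSn n))].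
have A0 : m (lim_sup_set A) = 0%E.
  apply: lim_sup_set_cvg0 => //; apply: (@le_lt_trans _ _ 1%:E); last exact: ltry.
  apply: le_trans (epsilon_trick0 xpredT ler01).
  by apply: lee_nneseries => n *; [exact: measure_ge0 | exact: Ar].
pose Z := lim_sup_set A.
have mZ : measurable Z.
  by apply: bigcap_measurable => // i _; exact: bigcup_measurable.
pose v n x := u (k n) x * \1_(~` Z) x.
have mv n : measurable_fun setT (v n).
  by apply: measurable_funM => //; apply: measurable_indic; exact: measurableC.
have vcvg x : cvgn (v ^~ x).
  have [Zx|nZx] := pselect (Z x).
    rewrite (_ : v ^~ x = cst 0); first exact: is_cvg_cst.
    by apply/funext => n; rewrite /v indicE memNset ?mulr0//=; exact.
  have [n0 Hn0] : exists n0, forall n, (n0 <= n)%N -> ~ A n x.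
    apply: contrapT => H; apply: nZx => n0 _; apply: contrapT => H'.
    by apply: H; exists n0 => n n0n An; apply: H'; exists n.
  have step n j : (n0 <= n)%N -> `|v (n + j)%N x - v n x| <= 2 * r n - 2 * r (n + j)%N.
    move=> n0n; elim: j => [|j IH]; first by rewrite addn0 !subrr normr0.
    have vE i : v i x = u (k i) x by rewrite /v indicE mem_set// mulr1.
    have Aj : `|v (n + j).+1 x - v (n + j)%N x| <= r (n + j)%N.
      rewrite distrC !vE leNgt; apply/negP.
      exact: Hn0 (leq_trans n0n (leq_addr _ _)).
    rewrite addnS; apply: le_trans (ler_distD (v (n + j)%N x) _ _) _.
    by have := rS (n + j)%N; lra.
  apply: cauchy_seq_cvg => e e0.
  have [n1 Hn1] : exists n1, 4 * r n1 < e.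
    have [n1 _ Hn1] : \forall n \near \oo, n.+1%:R^-1 < e / 4 :> R.
      have e40 : 0 < e / 4 by rewrite divr_gt0.
      exact: (near_infty_natSinv_lt (PosNum e40)).
    exists n1; rewrite mulrC -ltr_pdivlMr//; apply: le_lt_trans (Hn1 n1 (leqnn n1)).
    rewrite /r div1r lef_pV2 ?posrE ?ltr0n ?expn_gt0// ler_nat.
    exact/ltnW/ltn_expl.
  have rle i j : (i <= j)%N -> r j <= r i.
    move=> ij; rewrite /r ler_wpM2l// lef_pV2 ?posrE ?ltr0n ?expn_gt0// ler_nat.
    by rewrite leq_exp2l.
  exists (maxn n0 n1).
  have close i : (maxn n0 n1 <= i)%N -> `|v i x - v (maxn n0 n1) x| < e / 2.
    move=> ni; have := step (maxn n0 n1) (i - maxn n0 n1)%N (leq_maxl _ _).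
    rewrite subnKC//; have := r0 i; have := rle _ _ (leq_maxr n0 n1); lra.
  move=> i j /close vi /close vj.
  apply: le_lt_trans (ler_distD (v (maxn n0 n1) x) _ _) _.
  by rewrite (distrC (v _ x) (v j x)); lra.
pose f x := limn (v ^~ x).
have vf x : v n x @[n --> \oo] --> f x by exact: vcvg.
have mf : measurable_fun setT f.
  by apply: (measurable_fun_cvg mv) => x _; exact: vf.
have ukf : cvg_off Z (u \o k) f.
  split=> // x nZx; have := vf x; rewrite (_ : v ^~ x = (fun n => (u \o k) n x))//.
  by apply/funext => n; rewrite /v indicE mem_set// mulr1.
exists f, Z, k; split=> // e e0.
have e20 : 0 < e / 2 by rewrite divr_gt0.
have [|N1 HN1] := cvg_off_in_measure _ mf ukf e20; first by move=> n; exact: mu.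
have [N2 HN2] := uC _ e20.
exists N2 => n N2n; pose j := maxn N1 N2.
rewrite (splitr e).
apply: (sub_measure_lt _ _ (@far_triangle _ _ _ (u (k j)) _ _ _)).
- exact: measurable_far.
- by apply: measurableU; exact: measurable_far.
apply: measureU_lt; [exact: measurable_far..| | ].
- by apply: HN2 => //; apply: leq_trans (kn j); exact: leq_maxr.
- by apply: HN1; exact: leq_maxl.
Qed.

Lemma ae_eq_far f g : measurable_fun setT f -> measurable_fun setT g ->
  (f = g %[ae m]) <-> (forall e, 0 < e -> m (far f g e) = 0%E).
Proof.
move=> mf mg; split=> [fg e e0|fg0].
  apply/negligibleP; first exact: measurable_far.
  case: fg => Z [mZ Z0 fgZ]; exists Z; split=> // x; rewrite /far/= => fge.
  apply: fgZ => /= /(_ I) fgx; move: fge.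
  by rewrite fgx subrr normr0 ltNge ltW.
have : m.-negligible (\bigcup_n far f g n.+1%:R^-1).
  apply: negligible_bigcup => n; apply/negligibleP; first exact: measurable_far.
  by apply: fg0; rewrite invr_gt0.
apply: negligibleS => x /= fgx.
have fgx0 : 0 < `|f x - g x|.
  by rewrite normr_gt0 subr_eq0; apply/eqP => fgE; apply: fgx.
have [n _ Hn] := near_infty_natSinv_lt (PosNum fgx0).
by exists n => //; apply: (Hn n (leqnn n)).
Qed.

End InMeasure.

(** * Lebesgue spaces on a finite measure space *)

Section Clip.
Variable R : realType.
Implicit Types K x y : R.

Definition clip K x : R := Num.max (- K) (Num.min K x).

Lemma clip_id K x : `|x| <= K -> clip K x = x.
Proof. by rewrite ler_norml /clip => /andP[Kx xK]; rewrite min_r// max_r. Qed.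

Lemma clip_le K x : 0 <= K -> `|clip K x| <= K.
Proof.
move=> K0; rewrite ler_norml /clip le_max lexx/= ge_max ge_min lexx/= andbT.
lra.
Qed.

Lemma clip_dist_le K x : 0 <= K -> `|x - clip K x| <= `|x|.
Proof.
move=> K0; have := ler_norm x; have := ler_norm (- x); rewrite normrN => h1 h2.
rewrite ler_norml /clip; case: (leP x K) => h3; case: (leP (- K) x) => h4;
  case: (leP (- K) K) => h5; apply/andP; split; try lra.
Qed.

Lemma clip_lip K x y : 0 <= K -> `|clip K x - clip K y| <= `|x - y|.
Proof.
move=> K0; have xy := ler_norm (x - y); have := ler_norm (- (x - y)).
rewrite normrN => yx; rewrite ler_norml /clip.
by case: (leP x K) => h1; case: (leP y K) => h2; case: (leP (- K) x) => h3;
  case: (leP (- K) y) => h4; case: (leP (- K) K) => h5; apply/andP; split; lra.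
Qed.

End Clip.

(** At 0 the power is squeezed by the identity; elsewhere it is differentiable. *)
Lemma continuous_norm_powR (R : realType) (p : R) : 1 <= p ->
  continuous (fun x : R => `|x| `^ p).
Proof.
move=> p1 x; have p0 : 0 < p by exact: lt_le_trans p1.
have [->|x0] := eqVneq x 0.
  rewrite /continuous_at normr0 powR0 ?gt_eqF//; apply/cvgrPdist_lt => e e0.
  have n1 : \forall y \near (0 : R), `|y| <= 1 by exact: nbhs0_le.
  have ne : \forall y \near (0 : R), `|y| < e by exact: nbhs0_lt.
  near=> y; rewrite sub0r normrN ger0_norm ?powR_ge0//.
  have [->|y0] := eqVneq y 0; first by rewrite normr0 powR0 ?gt_eqF.
  apply: (@le_lt_trans _ _ `|y|).
    apply: ge1r_powR => //; rewrite normr_gt0 y0/=.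
    by near: y.
  by near: y.
apply: (@continuous_comp _ _ _ (fun x : R => `|x|) (@powR R ^~ p)).
  exact: norm_continuous.
apply/differentiable_continuous/derivable1_diffP.
by apply: derivable_powR; rewrite in_itv/= andbT normr_gt0.
Unshelve. all: by end_near. Qed.

Section LpNorm.
Context {d : measure_display} {T : measurableType d} {R : realType}.
Variable m : {measure set T -> \bar R}.
Hypothesis mfin : (m setT < +oo)%E.
Variable p : R.
Hypothesis p1 : 1 <= p.
Implicit Types (f g h : T -> R) (e a : R).

Let p0 : 0 < p. Proof. exact: lt_le_trans p1. Qed.
Let pn0 : p != 0. Proof. by rewrite gt_eqF. Qed.

Definition pint f : \bar R := (\int[m]_x (`|f x| `^ p)%:E)%E.

Local Notation N f := ('N[m]_p%:E[EFin \o f])%E.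

Lemma pint_ge0 f : (0 <= pint f)%E.
Proof. by apply: integral_ge0 => x _; rewrite lee_fin powR_ge0. Qed.

Lemma pintE f : pint f = (N f `^ p)%E.
Proof.
by rewrite powR_Lnorm.
Qed.

Lemma LnormE f : (N f = pint f `^ p^-1)%E.
Proof.
by rewrite pintE -poweRrM mulfV// poweRe1// Lnorm_ge0.
Qed.

Lemma Lnorm_lt f e : 0 < e -> (N f < e%:E)%E <-> (pint f < (e `^ p)%:E)%E.
Proof.
move=> e0; have e0' : (e%:E \in `[0%E, +oo%E])%E by rewrite in_itv/= lee_fin ltW//= leey.
have N0 : (N f \in `[0%E, +oo%E])%E by rewrite in_itv/= Lnorm_ge0 leey.
have P0 : (pint f \in `[0%E, +oo%E])%E by rewrite in_itv/= pint_ge0 leey.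
have ep0 : ((e `^ p)%:E \in `[0%E, +oo%E])%E by rewrite in_itv/= lee_fin powR_ge0 leey.
split; apply: contraTT; rewrite -!leNgt => H.
  rewrite LnormE.
  have pV : 0 <= p^-1 by rewrite invr_ge0 ltW.
  have := gt0_ler_poweR pV ep0 P0 H.
  by rewrite poweR_EFin -powRrM mulfV// powRr1// ltW.
by rewrite pintE -poweR_EFin; apply: gt0_ler_poweR => //; exact: ltW.
Qed.

Lemma measurable_pow f : measurable_fun setT f ->
  measurable_fun setT (fun x => (`|f x| `^ p)%:E).
Proof.
move=> mf; apply/measurable_EFinP.
apply: (measurableT_comp (measurable_powR p)).
exact: measurableT_comp.
Qed.

Lemma Lfun_pintP f : f \in Lfun m p%:E <-> measurable_fun setT f /\ (pint f < +oo)%E.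
Proof.
split.
  rewrite inE => /andP[]; rewrite !inE /= => mf; rewrite /finite_norm => Nf.
  by split => //; rewrite pintE poweR_lty.
move=> [mf If]; rewrite inE; apply/andP; rewrite !inE/=; split=> //.
by rewrite /finite_norm LnormE poweR_lty.
Qed.

Lemma le_pint f g : measurable_fun setT f -> measurable_fun setT g ->
  (forall x, `|f x| <= `|g x|) -> (pint f <= pint g)%E.
Proof.
move=> mf mg fg; apply: ge0_le_integral => //.
- exact: measurable_pow.
- exact: measurable_pow.
by move=> x _; rewrite lee_fin ge0_ler_powR// ltW.
Qed.

Lemma limn_einf_le (u : nat -> \bar R) (c : \bar R) N0 :
  (forall n, (N0 <= n)%N -> (u n <= c)%E) -> (limn_einf u <= c)%E.
Proof.
move=> uc; rewrite limn_einf_lim; apply: lime_le; first exact: is_cvg_einfs.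
exists N0 => // n /= N0n; apply: le_trans (uc n N0n).
by apply: ereal_inf_lbound; exists n => /=.
Qed.

(** Fatou's lemma on the complement of Z, which does not change integrals. *)
Lemma pint_fatou Z (u : nat -> T -> R) f (c : \bar R) N0 :
  (forall n, measurable_fun setT (u n)) -> measurable_fun setT f ->
  cvg_off m Z u f -> (forall n, (N0 <= n)%N -> (pint (u n) <= c)%E) ->
  (pint f <= c)%E.
Proof.
move=> mu mf [mZ Z0 uf] uc.
have pintZ g : measurable_fun setT g ->
    pint g = (\int[m]_(x in setT `\` Z) (`|g x| `^ p)%:E)%E.
  by move=> mg; apply: ge0_negligible_integral => //; exact: measurable_pow.
rewrite pintZ// (eq_integral (fun x => limn_einf (fun n => (`|u n x| `^ p)%:E))).
  apply: (@le_trans _ _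
    (limn_einf (fun n => \int[m]_(x in setT `\` Z) (`|u n x| `^ p)%:E))%E).
    apply: fatou => //; first exact: measurableD.
    by move=> n; apply: measurable_funS (measurable_pow (mu n)).
  by apply: (@limn_einf_le _ _ N0) => n N0n; rewrite -pintZ//; exact: uc.
move=> x; rewrite inE => -[_ nZx].
have up : (`|u n x| `^ p)%:E @[n --> \oo] --> (`|f x| `^ p)%:E.
  apply: cvg_EFin; first exact: nearW.
  exact: (cvg_comp _ _ (uf x nZx) (@continuous_norm_powR _ _ p1 (f x))).
by rewrite (cvg_limn_einf_sup up).1.
Qed.

(** Markov's inequality for the p-th power of the distance. *)
Lemma measure_far_pint f g a : 0 < a -> measurable_fun setT f ->
  measurable_fun setT g -> ((a `^ p)%:E * m (far f g a) <= pint (f \- g)%R)%E.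
Proof.
move=> a0 mf mg; have mfg := measurable_pow (measurable_funB mf mg).
have ap0 : 0 < a `^ p by exact: powR_gt0.
have -> : pint (f \- g)%R = (\int[m]_x `|(`|(f \- g) x| `^ p)%:E|)%E.
  by apply: eq_integral => x _; rewrite gee0_abs// lee_fin powR_ge0.
apply: le_trans (le_integral_abse m measurableT mfg ap0).
rewrite lee_pmul2l ?lte_fin//; apply: sub_measure.
- exact: measurable_far.
- by apply: emeasurable_fun_c_infty => //; exact: measurableT_comp.
move=> x; rewrite /far/= => afg; split => //.
rewrite lee_fin ger0_norm ?powR_ge0//.
by apply: ge0_ler_powR; rewrite ?nnegrE ?normr_ge0//; exact: ltW.
Qed.

Lemma Lnorm_far e : 0 < e -> exists2 a, 0 < a &
  forall f g, measurable_fun setT f -> measurable_fun setT g ->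
    (N (f \- g)%R < a%:E)%E -> (m (far f g e) < e%:E)%E.
Proof.
move=> e0; have ep0 : 0 < e `^ p by exact: powR_gt0.
have a0 : 0 < e `^ p * e by exact: mulr_gt0.
exists ((e `^ p * e) `^ p^-1); first exact: powR_gt0.
move=> f g mf mg /Lnorm_lt; rewrite powR_gt0// => /(_ isT).
rewrite -powRrM mulVf// powRr1 ?ltW// EFinM => fge.
by have := le_lt_trans (measure_far_pint e0 mf mg) fge; rewrite lte_pmul2l.
Qed.

Lemma LnormB f g : (N (f \- g)%R = N (g \- f)%R).
Proof.
rewrite -oppe_Lnorm; apply: eq_Lnorm => x /=; congr EFin; ring.
Qed.

Lemma Lnorm_triangle f g h : measurable_fun setT f -> measurable_fun setT g ->
  measurable_fun setT h -> (N (f \- h)%R <= N (f \- g)%R + N (g \- h)%R)%E.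
Proof.
move=> mf mg mh; apply: le_trans (minkowski_EFin m _ _ p1); last 2 first.
- exact: measurable_funB.
- exact: measurable_funB.
rewrite (_ : (f \- h)%R = ((f \- g) \+ (g \- h))%R)//.
by apply/funext => x /=; ring.
Qed.

(** A Cauchy sequence in norm is Cauchy in measure, by Markov's inequality;
    Fatou's lemma along an almost everywhere convergent subsequence shows that the
    limit in measure is the limit in norm. *)
Lemma Lfun_complete (u : nat -> T -> R) :
  (forall n, u n \in Lfun m p%:E) ->
  (forall e, 0 < e -> exists n0, forall i j, (n0 <= i)%N -> (n0 <= j)%N ->
     (N (u i \- u j)%R < e%:E)%E) ->
  exists2 f, f \in Lfun m p%:E &
    forall e, 0 < e -> exists n0, forall n, (n0 <= n)%N ->
      (N (u n \- f)%R < e%:E)%E.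
Proof.
move=> uL uC; have mu n : measurable_fun setT (u n) by have /Lfun_pintP[] := uL n.
have [|f [Z [k [mf _ kn ukf]]]] := cauchy_in_measure_cvg mfin mu.
  move=> e /Lnorm_far[a a0 Ha]; have [n0 Hn0] := uC _ a0.
  by exists n0 => i j n0i n0j; apply: Ha => //; exact: Hn0.
have uf e : 0 < e -> exists n0, forall n, (n0 <= n)%N -> (N (u n \- f)%R < e%:E)%E.
  move=> e0; have e20 : 0 < e / 2 by rewrite divr_gt0.
  have [n0 Hn0] := uC _ e20; exists n0 => n n0n.
  apply/Lnorm_lt => //; apply: (@le_lt_trans _ _ ((e / 2) `^ p)%:E); last first.
    rewrite lte_fin; apply: gt0_ltr_powR => //.
    - exact/ltW/e20.
    - exact/ltW/e0.
    - by rewrite ltr_pdivrMr// ltr_pMr// ltr1n.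
  apply: (@pint_fatou Z (fun i => u n \- u (k i)) _ _ n0).
  - by move=> i; exact: measurable_funB.
  - exact: measurable_funB.
  - case: ukf => mZ Z0 ukf; split => // x nZx.
    by apply: cvgB; [exact: cvg_cst | exact: ukf].
  - move=> i n0i; apply/ltW/Lnorm_lt => //; apply: Hn0 => //.
    exact: leq_trans (kn i).
exists f => //; apply/Lfun_pintP; split => //.
have [n0 /(_ n0 (leqnn n0)) Hn0] := uf 1 ltr01.
have /Lfun_pintP[_ un0] := uL n0.
suff : (N f < +oo)%E by rewrite pintE => /poweR_lty.
have NE0 g : N g = N (g \- cst 0)%R by apply: eq_Lnorm => x /=; rewrite subr0.
have mc : measurable_fun setT (cst 0 : T -> R) by exact: measurable_cst.
rewrite NE0; apply: le_lt_trans (Lnorm_triangle mf (mu n0) mc) _.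
rewrite -NE0 LnormB lte_add_pinfty//; first exact: lt_trans Hn0 (ltry _).
by rewrite LnormE poweR_lty.
Qed.

(** Convergence in measure does not give convergence in norm, but composing with
    a fixed cut-off does: the cut-off turns a small measure into a small
    integral, and costs little on the p-integrable limit. *)
Lemma Lnorm_clip f e : f \in Lfun m p%:E -> 0 < e ->
  exists K a, [/\ 0 <= K, 0 < a & forall g, measurable_fun setT g ->
    (m (far g f a) < a%:E)%E -> (N ((clip K \o g) \- f)%R < e%:E)%E].
Proof.
move=> /Lfun_pintP[mf If] e0; have e20 : 0 < e / 2 by rewrite divr_gt0.
have mclip (g : T -> R) K : measurable_fun setT g -> measurable_fun setT (clip K \o g).
  by move=> mg; apply: measurable_maxr => //; exact: measurable_minr.
(* A level K at which cutting off f itself costs less than e / 2. *)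
have [K K0 HK] : exists2 K, 0 <= K & (N ((clip K \o f) \- f)%R < (e / 2)%:E)%E.
  have := @dominated_convergence _ _ _ m setT measurableT
    (fun n x => (`|clip n%:R (f x) - f x| `^ p)%:E) (cst 0)
    (fun x => (`|f x| `^ p)%:E).
  case.
  - move=> n; apply: measurable_pow; apply: measurable_funB => //.
    exact: mclip.
  - exact: measurable_cst.
  - apply: aeW => x _; apply: cvg_near_cst.
    have [n0 _ Hn0] : \forall n \near \oo, `|f x| <= n%:R by exact: nbhs_infty_ger.
    exists n0 => // n /= /Hn0 fxn.
    by rewrite clip_id// subrr normr0 powR0.
  - apply/integrableP; split; first exact: measurable_pow.
    by under eq_integral do rewrite gee0_abs ?lee_fin ?powR_ge0//.
  - apply: aeW => x n _; rewrite gee0_abs ?lee_fin ?powR_ge0//.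
    by apply: ge0_ler_powR; rewrite ?nnegrE ?normr_ge0 ?(ltW p0)// distrC clip_dist_le.
  move=> _ _; rewrite integral0 => I0.
  have [n _ Hn] : \forall n \near \oo,
      (pint ((clip n%:R \o f) \- f)%R < ((e / 2) `^ p)%:E)%E.
    apply: (I0 [set x | (x < ((e / 2) `^ p)%:E)%E]); apply: open_ereal_lt'.
    by rewrite lte_fin powR_gt0.
  by exists n%:R => //; apply/Lnorm_lt => //; exact: Hn (leqnn n).
(* The integrand is at most a ^ p <= a where g is close to f, and at most c
   elsewhere. *)
pose c := (2 * K) `^ p; have c0 : 0 <= c by exact: powR_ge0.
have mTf : m setT \is a fin_num by rewrite ge0_fin_numE.
pose M := fine (m setT); have M0 : 0 <= M by exact: fine_ge0.
have ep0 : 0 < (e / 2) `^ p by exact: powR_gt0.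
have Mc0 : 0 < M + c + 1 by lra.
pose a := Num.min 1 ((e / 2) `^ p / (M + c + 1)).
have a0 : 0 < a by rewrite lt_min ltr01/= divr_gt0.
have a1 : a <= 1 by rewrite ge_min lexx.
have aMc : a * (M + c) < (e / 2) `^ p.
  apply: (@lt_le_trans _ _ (a * (M + c + 1))).
    by rewrite ltr_pM2l// ltrDl.
  by rewrite -ler_pdivlMr// ge_min lexx orbT.
exists K, a; split => // g mg gfa.
rewrite [e]splitr.
rewrite EFinD; apply: le_lt_trans (Lnorm_triangle (mclip _ K mg) (mclip _ K mf) mf) _.
apply: lteD => //; apply/Lnorm_lt => //.
have mfar : measurable (far g f a) by exact: measurable_far.
apply: (@le_lt_trans _ _ (\int[m]_x (a%:E + c%:E * (\1_(far g f a) x)%:E))%E).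
  apply: ge0_le_integral => //.
  - by apply: measurable_pow; apply: measurable_funB; exact: mclip.
  - apply: emeasurable_funD => //; apply: emeasurable_funM => //.
    by apply/measurable_EFinP; exact: measurable_indic.
  - move=> x _ /=; rewrite -EFinM -EFinD lee_fin indicE.
    have [gfx|gfx] := boolP (x \in far g f a); last first.
      rewrite mulr0 addr0; apply: (@le_trans _ _ (a `^ p)).
        apply: ge0_ler_powR; rewrite ?nnegrE ?normr_ge0 ?(ltW a0) ?(ltW p0)//.
        apply: le_trans (clip_lip _ _ K0) _; rewrite leNgt; apply/negP => gfx'.
        by move: gfx; rewrite notin_setE; exact.
      by apply: ge1r_powR => //; rewrite a0.
    rewrite mulr1; apply: (@le_trans _ _ c); last by rewrite lerDr ltW.
    apply: ge0_ler_powR; rewrite ?nnegrE ?normr_ge0 ?mulr_ge0 ?(ltW p0)//.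
    apply: le_trans (ler_normB _ _) _.
    by have := clip_le (g x) K0; have := clip_le (f x) K0; rewrite /=; lra.
rewrite ge0_integralD//; last 3 first.
- by move=> x _; rewrite lee_fin ltW.
- by move=> x _; rewrite mule_ge0 ?lee_fin.
- by apply: emeasurable_funM => //; apply/measurable_EFinP; exact: measurable_indic.
rewrite ge0_integralZl//; last first.
  by apply/measurable_EFinP; exact: measurable_indic.
rewrite integral_indic// setIT (integral_cst _ measurableT).
apply: (@le_lt_trans _ _ (a%:E * M%:E + c%:E * a%:E)%E).
  by rewrite /M fineK//; apply: leeD2l; apply: lee_wpmul2l; [rewrite lee_fin|exact: ltW].
by rewrite -!EFinM -EFinD lte_fin (mulrC c) -mulrDr.
Qed.

End LpNorm.

(** * The Lebesgue spaces as complete metric spaces, for p = 0 and for p >= 1 *)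

Section LebesgueSpace.
Context {d : measure_display} {T : measurableType d} {R : realType}.
Variable m : {measure set T -> \bar R}.
Hypothesis mfin : (m setT < +oo)%E.
Implicit Types (f g h : T -> R) (p a e : R).

Lemma measure_fin_num (A : set T) : measurable A -> m A \is a fin_num.
Proof.
move=> mA; rewrite ge0_fin_numE//; apply: le_lt_trans mfin.
exact: sub_measure.
Qed.

Lemma fine_measure_lt (A : set T) e : measurable A ->
  (fine (m A) < e) = (m A < e%:E)%E.
Proof. by move=> mA; rewrite -lte_fin fineK// measure_fin_num. Qed.

(** For p = 0 the distance is small exactly when f and g are close in measure;
    the bounds d0_far and far_d0 replace an explicit norm. *)
Let d0 := lebesgue_dist m 0.

Let d0E f g : d0 f g = inf [set e + fine (m (far f g e)) | e in [set e : R | 0 < e]].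
Proof. by rewrite /d0 /lebesgue_dist eqxx. Qed.

Let d0_has_inf f g :
  has_inf [set e + fine (m (far f g e)) | e in [set e : R | 0 < e]].
Proof.
split; first by exists (1 + fine (m (far f g 1))), 1 => /=.
by exists 0 => _ [e /= e0 <-]; rewrite addr_ge0 ?fine_ge0// ltW.
Qed.

Let d0_le f g a : 0 < a -> d0 f g <= a + fine (m (far f g a)).
Proof.
move=> a0; rewrite d0E; apply: ge_inf; first by case: (d0_has_inf f g).
by exists a.
Qed.

Let d0_ge0 f g : 0 <= d0 f g.
Proof.
rewrite d0E; apply: lb_le_inf; first by case: (d0_has_inf f g).
by move=> _ [e /= e0 <-]; rewrite addr_ge0 ?fine_ge0// ltW.
Qed.

Let d0_lt f g e : d0 f g < e -> exists2 a, 0 < a & a + fine (m (far f g a)) < e.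
Proof.
move=> fge; have [|_ [a /= a0 <-]] := @inf_adherent _ _ (e - d0 f g) _ (d0_has_inf f g).
  by rewrite subr_gt0.
by rewrite -d0E subrKC => ae; exists a.
Qed.

Let d0_far f g e : measurable_fun setT f -> measurable_fun setT g ->
  d0 f g < e -> (m (far f g e) < e%:E)%E.
Proof.
move=> mf mg /d0_lt[a a0 ae].
have h0 : 0 <= fine (m (far f g a)) by rewrite fine_ge0.
have := fine_measure_lt e (measurable_far a mf mg); rewrite (_ : fine _ < e); last lra.
move=> /esym; apply: sub_measure_lt; [exact: measurable_far..|].
by apply: le_far; lra.
Qed.

Let far_d0 f g e : measurable_fun setT f -> measurable_fun setT g ->
  0 < e -> (m (far f g e) < e%:E)%E -> d0 f g < e + e.
Proof.
move=> mf mg e0; rewrite -fine_measure_lt; last exact: measurable_far.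
by move=> fge; apply: le_lt_trans (d0_le f g e0) _; rewrite ltrD2l.
Qed.

Let d0_triangle f g h : measurable_fun setT f -> measurable_fun setT g ->
  measurable_fun setT h -> d0 f h <= d0 f g + d0 g h.
Proof.
move=> mf mg mh; apply/ler_addgt0Pr => e e0.
have [|a a0 ae] := @d0_lt f g (d0 f g + e / 2); first by rewrite ltrDl divr_gt0.
have [|b b0 be] := @d0_lt g h (d0 g h + e / 2); first by rewrite ltrDl divr_gt0.
apply: le_trans (d0_le f h (addr_gt0 a0 b0)) _.
have mfg := measurable_far a mf mg; have mgh := measurable_far b mg mh.
have mfh := measurable_far (a + b) mf mh.
suff : fine (m (far f h (a + b))) <= fine (m (far f g a)) + fine (m (far g h b)) by lra.
rewrite -lee_fin EFinD !fineK ?measure_fin_num//.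
apply: le_trans (measureU2 _ mfg mgh); apply: sub_measure => //.
  exact: measurableU.
exact: far_triangle.
Qed.

Variable p : R.
Hypothesis hp : p = 0 \/ 1 <= p.

Local Notation L := (lebesgue_Lfun m p).
Local Notation rho := (lebesgue_dist m p).

Let LE f : L f <-> p = 0 /\ measurable_fun setT f \/ 1 <= p /\ f \in Lfun m p%:E.
Proof.
rewrite /lebesgue_Lfun; have [->|pn0] := eqVneq p 0.
  by split=> [|[[]|[]]]//=; [left | rewrite ler10].
split=> [/= fL|[[p0]|[]]//]; last by rewrite p0 eqxx in pn0.
by right; split => //; case: hp => // p0; rewrite p0 eqxx in pn0.
Qed.

Let p_neq0 : 1 <= p -> (p == 0) = false.
Proof. by move=> p1; rewrite gt_eqF// (lt_le_trans _ p1). Qed.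

Let rho1E f g : 1 <= p -> rho f g = fine ('N[m]_p%:E[EFin \o (f \- g)%R])%E.
Proof. by move=> p1; rewrite /lebesgue_dist p_neq0. Qed.

Lemma lebesgue_dist_pint f g : 1 <= p ->
  rho f g = fine (pint m p (f \- g)%R) `^ p^-1.
Proof. by move=> p1; rewrite rho1E// (LnormE m p1 (f \- g)%R) fine_poweR. Qed.

Lemma lebesgue_Lfun_measurable f : L f -> measurable_fun setT f.
Proof. by move=> /LE[[_ ]//|[p1 /Lfun_pintP[]]]. Qed.

Let Lfun_sub f g : 1 <= p -> f \in Lfun m p%:E -> g \in Lfun m p%:E ->
  ('N[m]_p%:E[EFin \o (f \- g)%R] < +oo)%E.
Proof.
move=> p1 fL gL; have p1' : (1 <= p%:E)%E by rewrite lee_fin.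
have : (f - g)%R \in Lfun m p%:E.
  rewrite (_ : (f - g)%R = ((-1) *: g + f)%R).
    exact: (Lfun_submod_closed m p1').2.
  by apply/funext => x; rewrite /= !fctE scaleN1r addrC.
by rewrite inE => /andP[_]; rewrite inE.
Qed.

Let rho_lt f g e : 1 <= p -> L f -> L g ->
  (rho f g < e) = ('N[m]_p%:E[EFin \o (f \- g)%R] < e%:E)%E.
Proof.
move=> p1 /LE[[p0]|[_ fL]]; first by rewrite p0 ler10 in p1.
move=> /LE[[p0]|[_ gL]]; first by rewrite p0 ler10 in p1.
rewrite rho1E// -lte_fin fineK// ge0_fin_numE ?Lnorm_ge0//.
exact: Lfun_sub.
Qed.

Lemma lebesgue_dist_ge0 f g : 0 <= rho f g.
Proof.
case: hp => [->|p1]; first exact: d0_ge0.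
by rewrite rho1E// fine_ge0// Lnorm_ge0.
Qed.

Lemma lebesgue_distC f g : rho f g = rho g f.
Proof.
case: hp => [->|p1]; last by rewrite !rho1E// LnormB.
rewrite -/(d0 f g) -/(d0 g f) !d0E; congr inf; apply: eq_imagel => e _.
by rewrite farC.
Qed.

Lemma lebesgue_dist_triangle f g h : L f -> L g -> L h ->
  rho f h <= rho f g + rho g h.
Proof.
move=> fL gL hL; have mf := lebesgue_Lfun_measurable fL.
have mg := lebesgue_Lfun_measurable gL; have mh := lebesgue_Lfun_measurable hL.
case: hp => [p0|p1]; first by rewrite p0; exact: d0_triangle.
move: fL gL hL => /LE[[p0]|[_ fL]]; first by rewrite p0 ler10 in p1.
move=> /LE[[p0]|[_ gL]]; first by rewrite p0 ler10 in p1.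
move=> /LE[[p0]|[_ hL]]; first by rewrite p0 ler10 in p1.
rewrite !rho1E// -lee_fin EFinD !fineK ?ge0_fin_numE ?Lnorm_ge0//; last 3 first.
- exact: Lfun_sub.
- exact: Lfun_sub.
- exact: Lfun_sub.
exact: Lnorm_triangle.
Qed.

(** Uniformly in f and g, closeness in the metric implies closeness in measure. *)
Lemma lebesgue_dist_far e : 0 < e -> exists2 a, 0 < a &
  forall f g, L f -> L g -> rho f g < a -> (m (far f g e) < e%:E)%E.
Proof.
move=> e0; case: hp => [p0|p1].
  exists e => // f g /lebesgue_Lfun_measurable mf /lebesgue_Lfun_measurable mg.
  by rewrite p0; exact: d0_far.
have [a a0 Ha] := Lnorm_far m p1 e0; exists a => // f g fL gL.
by rewrite rho_lt//; apply: Ha; exact: lebesgue_Lfun_measurable.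
Qed.

Lemma lebesgue_dist_complete (u : nat -> T -> R) : (forall n, L (u n)) ->
  (forall e, 0 < e -> exists n0, forall i j, (n0 <= i)%N -> (n0 <= j)%N ->
     rho (u i) (u j) < e) ->
  exists2 f, L f & forall e, 0 < e -> exists n0, forall n, (n0 <= n)%N ->
     rho (u n) f < e.
Proof.
move=> uL uC; have mu n := lebesgue_Lfun_measurable (uL n).
case: hp => [p0|p1].
  have [|f [_ [_ [mf uf _ _]]]] := cauchy_in_measure_cvg mfin mu.
    move=> e e0; have [n0 Hn0] := uC _ e0; exists n0 => i j n0i n0j.
    by apply: d0_far => //; rewrite /d0 -p0; exact: Hn0.
  exists f; first by apply/LE; left.
  move=> e e0; have [|n0 Hn0] := uf (e / 2); first by rewrite divr_gt0.
  exists n0 => n /Hn0; rewrite p0 [e in _ < e]splitr; apply: far_d0 => //.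
  by rewrite divr_gt0.
have uL' n : u n \in Lfun m p%:E.
  by have /LE[[p0]|[]//] := uL n; rewrite p0 ler10 in p1.
have [|f fL uf] := Lfun_complete mfin p1 uL'.
  move=> e e0; have [n0 Hn0] := uC _ e0; exists n0 => i j n0i n0j.
  by rewrite -rho_lt//; exact: Hn0.
have fL' : L f by apply/LE; right.
exists f => // e /uf[n0 Hn0]; exists n0 => n /Hn0.
by rewrite rho_lt.
Qed.

(** What makes approximation in measure sufficient for approximation in the
    metric: the cut-off psi depends only on f and e. *)
Lemma lebesgue_dist_cutoff f e : L f -> 0 < e -> exists psi a, 0 < a /\
  forall g, L g -> L (psi \o g) -> (m (far g f a) < a%:E)%E -> rho (psi \o g) f < e.
Proof.
move=> fL e0; case: hp => [p0|p1].
  have e20 : 0 < e / 2 by rewrite divr_gt0.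
  exists id, (e / 2); split => // g /lebesgue_Lfun_measurable mg _ gf.
  rewrite p0 [e in _ < e]splitr; apply: far_d0 => //.
  exact: lebesgue_Lfun_measurable fL.
have /LE[[p0]|[_ fL']] := fL; first by rewrite p0 ler10 in p1.
have [K [a [_ a0 Ha]]] := Lnorm_clip mfin p1 fL' e0.
exists (clip K), a; split => // g gL cL gf; rewrite rho_lt//; apply: Ha => //.
exact: lebesgue_Lfun_measurable gL.
Qed.

Lemma lebesgue_dist_eq0 f g : L f -> L g -> (rho f g = 0 <-> f = g %[ae m]).
Proof.
move=> fL gL; have mf := lebesgue_Lfun_measurable fL.
have mg := lebesgue_Lfun_measurable gL; split=> [fg0|fg].
  apply/ae_eq_far => // e e0; apply/eqP; rewrite -measure_le0.
  apply/lee_addgt0Pr => r r0; rewrite add0e.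
  have er0 : 0 < Num.min e r by rewrite lt_min e0.
  have [a a0 Ha] := lebesgue_dist_far er0.
  have := Ha f g fL gL; rewrite fg0 => /(_ a0) h.
  apply: (@le_trans _ _ (m (far f g (Num.min e r)))).
    apply: sub_measure; [exact: measurable_far..|].
    by apply: le_far; rewrite ge_min lexx.
  by apply/ltW/(lt_le_trans h); rewrite lee_fin ge_min lexx orbT.
have fg0 := (ae_eq_far m mf mg).1 fg.
case: hp => [p0|p1].
  apply/eqP; rewrite eq_le lebesgue_dist_ge0 andbT p0; apply/ler_addgt0Pr => e e0.
  by have := d0_le f g e0; rewrite fg0//= addr0 add0r.
rewrite rho1E//.
have mfg : measurable_fun setT (f \- g)%R by exact: measurable_funB.
have pn0 : p^-1 != 0 by rewrite invr_eq0 p_neq0.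
rewrite LnormE// /pint (ge0_ae_eq_integral (g := cst 0%E))//.
- by rewrite integral0 poweR0r.
- exact: measurable_pow.
- by apply: filterS fg => x /= /(_ I) fgx _; rewrite fgx subrr normr0 powR0 ?p_neq0.
Qed.

Lemma lebesgue_Lfun_ae f g : L f -> measurable_fun setT g -> f = g %[ae m] -> L g.
Proof.
move=> /LE[[p0 mf]|[p1 /Lfun_pintP fL]] mg fg; apply/LE; first by left.
right; split=> //; apply/Lfun_pintP => //; split => //.
have [mf fy] := fL p1.
suff <- : pint m p f = pint m p g by [].
apply: ge0_ae_eq_integral => //; [exact: measurable_pow..|].
by apply: filterS fg => x /= /(_ I) fgx _; rewrite fgx.
Qed.

Lemma lebesgue_LfunD f g : L f -> L g -> L (fun x => f x + g x).
Proof.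
move=> /LE[[p0 mf]|[p1 fL]] /LE[[p0' mg]|[p1' gL]]; apply/LE.
- by left; split => //; exact: measurable_funD.
- by move: p1'; rewrite p0 ler10.
- by move: p1; rewrite p0' ler10.
- right; split => //; have p1e : (1 <= p%:E)%E by rewrite lee_fin.
  rewrite (_ : (fun x => f x + g x) = (1 *: f + g)%R).
    exact: (Lfun_submod_closed m p1e).2.
  by apply/funext => x; rewrite /= !fctE scale1r.
Qed.

Lemma lebesgue_LfunZ a f : L f -> L (fun x => a * f x).
Proof.
move=> /LE[[p0 mf]|[p1 fL]]; apply/LE.
  by left; split => //; exact: measurable_funM.
right; split => //; have p1e : (1 <= p%:E)%E by rewrite lee_fin.
rewrite (_ : (fun x => a * f x) = (a *: f + 0)%R).
  apply: (Lfun_submod_closed m p1e).2 => //.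
  exact: (Lfun_submod_closed m p1e).1.
by apply/funext => x; rewrite /= !fctE addr0.
Qed.

End LebesgueSpace.
(** * Simple functions over a field of sets *)

Section Simple.
Variables (R : realType) (X : Type) (B : set (set X)).
Hypothesis Bf : set_field B.
Implicit Types (s t : X -> R) (psi : R -> R -> R).

Lemma set_field_finite_bigcup (I : choiceType) (D : set I) (F : I -> set X) :
  finite_set D -> (forall i, D i -> B (F i)) -> B (\bigcup_(i in D) F i).
Proof.
move=> /finite_seqP[r ->] BF; rewrite bigcup_seq big_seq_cond.
apply: set_field_bigsetU => // i; rewrite andbT => ir; exact: BF.
Qed.

(** The description of simple functions that is stable under pointwise
    operations; the one by partitions needs the values to be listed without
    repetition, so that no piece is empty. *)
Lemma simpleP s : simple B s <->
  finite_set (range s) /\ forall c, B (s @^-1` [set c]).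
Proof.
split=> [[n [c [A [BA [cover_A tA _] sE]]]]|[sfin Bs]].
  have sA k x : A k x -> s x = c k.
    move=> Akx; rewrite sE (bigD1 k)//= indicE mem_set// mulr1 big1 ?addr0//.
    move=> j jk; rewrite indicE memNset ?mulr0// => Ajx.
    by move/eqP: jk; apply; apply: tA => //; exists x.
  have covA x : exists k, A k x.
    by have : setT x by []; rewrite -cover_A => -[k _ Akx]; exists k.
  split.
    apply: (@sub_finite_set _ _ (c @` setT)); last exact: finite_image.
    by move=> _ [x _ <-]; have [k Akx] := covA x; exists k => //; rewrite (sA k).
  move=> c0; rewrite (_ : _ @^-1` _ = \bigcup_(k in [set k | c k = c0]) A k).
    by apply: set_field_finite_bigcup => //; exact: finite_finset.
  apply/seteqP; split=> [x /= sx|x [k /= <-] /sA//].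
  by have [k Akx] := covA x; exists k => //=; rewrite -(sA _ _ Akx).
have [r rE] := (finite_seqP _).1 sfin.
have rs x : s x \in undup r.
  have sx : range s (s x) by exists x.
  by rewrite mem_undup; rewrite rE in sx.
pose c (k : 'I_(size (undup r))) := nth 0 (undup r) k.
have cinj : injective c.
  by move=> i j /eqP; rewrite nth_uniq ?undup_uniq// => /eqP/val_inj.
have cs x : exists k, c k = s x.
  have sr := rs x; rewrite -index_mem in sr.
  by exists (Ordinal sr); rewrite /c/= nth_index.
exists _, c, (fun k => s @^-1` [set c k]); split=> //.
- split.
  + by apply/seteqP; split=> // x _; have [k kx] := cs x; exists k => //=.
  + by move=> i j _ _ [x [/= -> /cinj]].
  + move=> k _; have : range s (c k).
      by rewrite rE /= -mem_undup; exact: mem_nth.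
    by move=> [x _ sx]; exists x.
- move=> x; have [k kx] := cs x; rewrite (bigD1 k)//= indicE mem_set//= mulr1 -kx.
  rewrite big1 ?addr0// => j jk; rewrite indicE memNset ?mulr0//= => sj.
  by move/eqP: jk; apply; apply: cinj; rewrite -sj.
Qed.

Lemma simple_map2 psi s t : simple B s -> simple B t ->
  simple B (fun x => psi (s x) (t x)).
Proof.
move=> /simpleP[sfin Bs] /simpleP[tfin Bt]; apply/simpleP; split.
  apply: (@sub_finite_set _ _ ((fun ab => psi ab.1 ab.2) @` (range s `*` range t))).
    by move=> _ [x _ <-]; exists (s x, t x) => //; split; exists x.
  by apply: finite_image; exact: finite_setX.
move=> c; rewrite (_ : _ @^-1` _ = \bigcup_(ab in
    (range s `*` range t) `&` [set ab | psi ab.1 ab.2 = c])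
    (s @^-1` [set ab.1] `&` t @^-1` [set ab.2])).
  apply: set_field_finite_bigcup; last by move=> ab _; exact: set_fieldI.
  by apply: finite_setIl; exact: finite_setX.
apply/seteqP; split=> [x /= stx|x [[a b]] /= [_ /= abc] [-> ->]//].
by exists (s x, t x) => //; split => //; split; exists x.
Qed.

Lemma simple_indic b : B b -> simple B (\1_b : X -> R).
Proof.
move=> Bb; apply/simpleP; split.
  apply: (@sub_finite_set _ _ [set 0; 1]); last exact: finite_set2.
  by move=> _ [x _ <-]; rewrite indicE; case: (_ \in _); [right | left].
move=> c; have [->|c1] := eqVneq c 1.
  rewrite (_ : _ @^-1` _ = b)//; apply/seteqP; split=> x /=; rewrite indicE.
    by case: (boolP (x \in b)) => [/set_mem//|_ /eqP]; rewrite eq_sym oner_eq0.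
  by move=> bx; rewrite mem_set.
have [->|c0] := eqVneq c 0.
  rewrite (_ : _ @^-1` _ = ~` b); first exact: set_fieldC.
  apply/seteqP; split=> x /=; rewrite indicE.
    by move=> + bx; rewrite mem_set// => /eqP; rewrite oner_eq0.
  by move=> bx; rewrite memNset.
rewrite (_ : _ @^-1` _ = set0); first exact: set_field_set0.
apply/seteqP; split=> x //=; rewrite indicE => xc; move: c0 c1; rewrite -xc.
by case: (_ \in _); rewrite eqxx.
Qed.

Lemma simple_cst c : simple B (fun=> c : R).
Proof.
have h := simple_indic (set_field_setT Bf).
exact: (@simple_map2 (fun _ _ => c) _ _ h h).
Qed.

Lemma simple_map (psi : R -> R) s : simple B s -> simple B (psi \o s).
Proof. by move=> h; exact: (@simple_map2 (fun x _ => psi x) _ _ h h). Qed.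

Lemma simple_sum n (c : 'I_n -> X -> R) : (forall k, simple B (c k)) ->
  simple B (fun x => \sum_(k < n) c k x).
Proof.
elim: n c => [c _|n IH c Hc].
  by under eq_fun do rewrite big_ord0; exact: simple_cst.
under eq_fun do rewrite big_ord_recr/=.
by apply: (@simple_map2 +%R) => //; exact: IH.
Qed.

Lemma bounded_simple s : simple B s -> exists2 K, 0 <= K & forall x, `|s x| <= K.
Proof.
move=> /simpleP[/finite_seqP[r rE] _].
exists (\sum_(a <- r) `|a|); first exact: sumr_ge0.
move=> x; have : range s (s x) by exists x.
rewrite rE/= => sxr; rewrite (big_rem _ sxr)/= lerDl.
exact: sumr_ge0.
Qed.

End Simple.

(** Heine's theorem on a centred interval, in the form of one modulus r. *)
Lemma continuous_modulus (R : realType) (psi : R -> R) (K e : R) :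
  continuous psi -> 0 < e -> exists2 r, 0 < r &
  forall x y, `|x| <= K -> `|x - y| <= r -> `|psi x - psi y| <= e.
Proof.
move=> psic e0; have e20 : 0 < e / 2 by rewrite divr_gt0.
have cK := @segment_compact R (- K) K.
pose P (r x : R) := forall y, `|x - y| <= r -> `|psi x - psi y| <= e.
have : \forall r \near (0 : R)^'+, `[- K, K]%classic `<=` P r.
  have [cov _] := compact_near_coveringP `[- K, K]%classic.
  apply: (cov cK R (0 : R)^'+ P) => x _.
  have /cvgrPdist_lt/(_ _ e20)[/= w w0 Hw] := psic x.
  have w20 : 0 < w / 2 by rewrite divr_gt0.
  exists (ball x (w / 2), [set r | 0 < r < w / 2]) => /=.
    split; first exact: nbhsx_ballx.
    by exists (w / 2) => //= r /=; rewrite sub0r normrN => /ltr_normlP[_ rw] r0; rewrite r0.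
  move=> [x' r] /= [xx' /andP[r0 rw]] y x'y.
  have h1 : `|psi x - psi x'| < e / 2.
    by apply: Hw => /=; rewrite /ball/= in xx' *; lra.
  have h2 : `|psi x - psi y| < e / 2.
    apply: Hw => /=; rewrite /ball/= in xx' *.
    by apply: le_lt_trans (ler_distD x' _ _) _; lra.
  apply: le_trans (ler_distD (psi x) _ _) _; rewrite (distrC (psi x')); lra.
move=> [/= w w0 Hw]; exists (w / 2); first by rewrite divr_gt0.
move=> x y xK; apply: (Hw (w / 2)) => /=.
- by rewrite sub0r normrN gtr0_norm ?divr_gt0// ltr_pdivrMr// ltr_pMr// ltr1n.
- by rewrite divr_gt0.
- by rewrite in_itv/= -ler_norml.
Qed.

Lemma cvg_filter_prodP (R : realType) (v : nat -> nat -> R) :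
  (fun k : nat * nat => v k.1 k.2) @ filter_prod \oo \oo --> (0 : R) <->
  forall e, 0 < e -> exists n0, forall i j, (n0 <= i)%N -> (n0 <= j)%N ->
    `|v i j| < e.
Proof.
split=> [vc e e0|vc].
  have [[P Q] /= [[n1 _ P1] [n2 _ Q2]] PQ] :=
    (@cvgr0Pnorm_lt _ _ _ _ _ _).1 vc e e0.
  exists (maxn n1 n2) => i j; rewrite !geq_max => /andP[n1i _] /andP[_ n2j].
  by apply: (PQ (i, j)); split; [exact: P1|exact: Q2].
apply/cvgr0Pnorm_lt => e /vc[n0 Hn0].
exists ([set i | (n0 <= i)%N], [set j | (n0 <= j)%N]) => /=.
  by split; exists n0.
by move=> [i j] /= [n0i n0j]; exact: Hn0.
Qed.

(** * Transfer along a charge-preserving homomorphism into a measure space *)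

Section Transfer.
Variables (R : realType) (X : Type) (B : set (set X)) (mu : set X -> R).
Context {d : measure_display} {T : measurableType d}.
Variables (m : {measure set T -> \bar R}) (theta : set X -> set T).

Definition charge_hom : Prop :=
  [/\ is_charge B mu,
      forall A A', theta (A `&` A') = theta A `&` theta A',
      forall A, theta (~` A) = ~` theta A,
      forall b, B b -> measurable (theta b) &
      forall b, B b -> m (theta b) = (mu b)%:E].

Hypothesis hom : charge_hom.
Implicit Types (s t f g : X -> R) (F G : T -> R) (e a : R).

Let muB : is_charge B mu. Proof. by case: hom. Qed.
Let Bf : set_field B. Proof. by case: muB. Qed.

Lemma homI A A' : theta (A `&` A') = theta A `&` theta A'.
Proof. by case: hom. Qed.

Lemma homC A : theta (~` A) = ~` theta A.
Proof. by case: hom. Qed.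

Lemma hom0 : theta set0 = set0.
Proof. by rewrite -(setICr set0) homI homC setICr. Qed.

Lemma homT : theta setT = setT.
Proof. by rewrite -setC0 homC hom0 setC0. Qed.

Lemma homU A A' : theta (A `|` A') = theta A `|` theta A'.
Proof. by rewrite -[A `|` A']setCK setCU homC homI !homC setCI !setCK. Qed.

Lemma homS A A' : A `<=` A' -> theta A `<=` theta A'.
Proof. by move=> /setIidPl AA'; rewrite -AA' homI; exact: subIsetr. Qed.

Lemma hom_measurable b : B b -> measurable (theta b).
Proof. by case: hom => _ _ _ mB _; exact: mB. Qed.

Lemma hom_measure b : B b -> m (theta b) = (mu b)%:E.
Proof. by case: hom => _ _ _ _ mB; exact: mB. Qed.

Lemma hom_measure_fin : (m setT < +oo)%E.
Proof. by rewrite -homT hom_measure ?ltry//; exact: set_field_setT. Qed.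

Let mfin := hom_measure_fin.

(** The images of the level sets of a simple function s partition T, so that y
    determines the value c to choose. *)
Definition lift_simple s (y : T) : R := xget 0 [set c | theta (s @^-1` [set c]) y].

Lemma lift_eqP s y c : simple B s -> theta (s @^-1` [set c]) y <-> lift_simple s y = c.
Proof.
move=> /(simpleP Bf)[/finite_seqP[r rE] _].
have ex : exists a, theta (s @^-1` [set a]) y.
  have : theta (\big[setU/set0]_(a <- r) (s @^-1` [set a])) y.
    rewrite (_ : \big[_/_]_(_ <- _) _ = setT) ?homT// -bigcup_seq -rE.
    by apply/seteqP; split=> // x _; exists (s x) => //; exists x.
  elim: r {rE} => [|a r IH]; first by rewrite big_nil hom0.
  by rewrite big_cons homU => -[sa|/IH//]; exists a.
have uniq a b : theta (s @^-1` [set a]) y -> theta (s @^-1` [set b]) y -> a = b.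
  move=> sa sb; have : theta (s @^-1` [set a] `&` s @^-1` [set b]) y.
    by rewrite homI.
  have [//|ab] := eqVneq a b.
  rewrite (_ : _ `&` _ = set0) ?hom0//; apply/seteqP; split=> // x /= [-> sab].
  by move: ab; rewrite sab eqxx.
have lifty : theta (s @^-1` [set lift_simple s y]) y.
  exact: (@xgetPex _ 0 [set c | theta (s @^-1` [set c]) y] ex).
by split=> [sc|<-//]; exact: uniq sc.
Qed.

(** On theta (s = a, t = b) both sides have the value psi a b. *)
Lemma lift_map2 (psi : R -> R -> R) s t : simple B s -> simple B t ->
  lift_simple (fun x => psi (s x) (t x)) = fun y => psi (lift_simple s y) (lift_simple t y).
Proof.
move=> ss st; apply/funext => y; apply/lift_eqP; first exact: simple_map2.
have : theta (s @^-1` [set lift_simple s y] `&` t @^-1` [set lift_simple t y]) y.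
  by rewrite homI; split; apply/lift_eqP.
by apply: homS => x [/= -> ->].
Qed.

Lemma lift_map (psi : R -> R) s : simple B s -> lift_simple (psi \o s) = psi \o lift_simple s.
Proof. by move=> ss; exact: (@lift_map2 (fun x _ => psi x) _ _ ss ss). Qed.

Lemma lift_indic b : B b -> lift_simple (\1_b : X -> R) = \1_(theta b).
Proof.
move=> Bb; apply/funext => y; apply/lift_eqP; first exact: simple_indic.
rewrite indicE; case: (boolP (y \in theta b)) => [/set_mem yb|/negP yb].
  by apply: homS yb => x bx /=; rewrite indicE mem_set.
have : theta (~` b) y by rewrite homC => yb'; apply: yb; rewrite inE.
by apply: homS => x bx /=; rewrite indicE memNset.
Qed.

Lemma lift_cst c : lift_simple (fun=> c : R) = fun=> c.
Proof.
have h := simple_indic R Bf (set_field_setT Bf).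
exact: (@lift_map2 (fun _ _ => c) _ _ h h).
Qed.

Lemma lift_sum n (c : 'I_n -> X -> R) : (forall k, simple B (c k)) ->
  lift_simple (fun x => \sum_(k < n) c k x) = fun y => \sum_(k < n) lift_simple (c k) y.
Proof.
elim: n c => [c _|n IH c Hc].
  under eq_fun do rewrite big_ord0.
  by rewrite lift_cst; apply/funext => y; rewrite big_ord0.
under eq_fun do rewrite big_ord_recr/=.
rewrite (@lift_map2 +%R) ?IH//; last exact: simple_sum.
by apply/funext => y; rewrite big_ord_recr.
Qed.

Lemma lift_range s y : simple B s -> exists x, s x = lift_simple s y.
Proof.
move=> ss; apply: contrapT => nsy.
have : theta (s @^-1` [set lift_simple s y]) y by apply/lift_eqP.
rewrite (_ : _ @^-1` _ = set0) ?hom0//.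
by apply/seteqP; split=> // x /= sx; apply: nsy; exists x.
Qed.

Lemma measurable_lift s : simple B s -> measurable_fun setT (lift_simple s).
Proof.
move=> ss _ E mE; rewrite setTI; have /(simpleP Bf)[sfin Bs] := ss.
rewrite (_ : _ @^-1` _ = \bigcup_(c in range s `&` E) theta (s @^-1` [set c])).
  apply: fin_bigcup_measurable; first exact: finite_setIl.
  by move=> c _; exact: hom_measurable.
apply/seteqP; split=> [y /= Ey|y [c [_ Ec]] /(lift_eqP _ _ ss) /= -> //].
exists (lift_simple s y); last exact/lift_eqP.
by split=> //; have [x sx] := lift_range y ss; exists x.
Qed.

(** The set is a level set of the simple function psi (s, t), with psi the
    indicator of the pairs further apart than a. *)
Lemma simple_far s t a : simple B s -> simple B t ->
  B (far s t a) /\ theta (far s t a) = far (lift_simple s) (lift_simple t) a.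
Proof.
move=> ss st; pose psi (x y : R) : R := (a < `|x - y|)%R%:R.
have sp := simple_map2 Bf psi ss st.
have farE (Z : Type) (u v : Z -> R) :
    far u v a = (fun x => psi (u x) (v x)) @^-1` [set 1].
  apply/seteqP; split=> x; rewrite /far /psi/=; first by move=> ->.
  by case: (_ < _) => // /eqP; rewrite eq_sym oner_eq0.
split; first by rewrite farE; exact: ((simpleP Bf _).1 sp).2.
rewrite !farE -lift_map2//; apply/seteqP; split=> y /=.
  by move/lift_eqP => /(_ sp).
by move=> h; apply/lift_eqP.
Qed.

Lemma outer_far_simple s t a : simple B s -> simple B t ->
  outer B mu (far s t a) = fine (m (far (lift_simple s) (lift_simple t) a)).
Proof.
by move=> ss st; have [Bst <-] := simple_far a ss st;
  rewrite (outerE muB)// hom_measure.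
Qed.

Let integrable_indic_fin (A : set T) : measurable A ->
  m.-integrable setT (fun y => (\1_A y)%:E).
Proof.
move=> mA; apply/integrableP; split.
  by apply/measurable_EFinP; exact: measurable_indic.
rewrite (eq_integral (fun y => (\1_A y)%:E)).
  rewrite integral_indic// setIT; apply: le_lt_trans mfin.
  exact: sub_measure.
by move=> y _; rewrite gee0_abs// lee_fin.
Qed.

(** Each representation of s is carried by theta to one of the lift, so the sum
    that defines the integral does not depend on the representation. *)
Lemma simple_integralE s : simple B s ->
  (simple_integral B mu s)%:E = (\int[m]_y (lift_simple s y)%:E)%E.
Proof.
move=> ss.
have intE n (c : 'I_n -> R) (A : 'I_n -> set X) : simple_repr B c A s ->
    (\sum_(k < n) c k * mu (A k))%:E = (\int[m]_y (lift_simple s y)%:E)%E.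
  move=> [BA [covA tA _] sE].
  have sA k : simple B (fun x => c k * \1_(A k) x).
    exact: (simple_map Bf (fun r => c k * r) (simple_indic R Bf (BA k))).
  have -> : s = (fun x => \sum_(k < n) c k * \1_(A k) x) by exact/funext.
  rewrite lift_sum//.
  under eq_integral do rewrite -sumEFin.
  rewrite integral_sum//; last first.
    move=> k; rewrite (lift_map (fun r => c k * r) (simple_indic R Bf (BA k))).
    rewrite lift_indic//.
    have := integrableZl measurableT (c k)
      (integrable_indic_fin (hom_measurable (BA k))).
    by under [X in integrable _ _ X -> _]eq_fun do rewrite -EFinM.
  rewrite -sumEFin; apply: eq_bigr => k _.
  rewrite (lift_map (fun r => c k * r) (simple_indic R Bf (BA k))) lift_indic//=.
  under eq_integral do rewrite EFinM.
  rewrite integralZl//; last exact/integrable_indic_fin/hom_measurable.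
  by rewrite integral_indic ?setIT ?hom_measure//; exact: hom_measurable.
rewrite /simple_integral; case: xgetP => [r _ [n [c [A [sr ->]]]]|none].
  exact: intE.
have [n [c [A sr]]] := ss.
by exfalso; apply: (none (\sum_(k < n) c k * mu (A k))); exists n, c, A.
Qed.

Local Notation out := (outer B mu).
Local Notation mr A := (fine (m A)).

(** The function F on T corresponds to f when a single simple function is close
    to f and its lift is close to F, at every precision. *)
Definition tracks f F : Prop := measurable_fun setT F /\
  forall e, 0 < e -> exists s,
    [/\ simple B s, out (far s f e) < e & mr (far (lift_simple s) F e) < e].

Lemma tracks_measurable f F : tracks f F -> measurable_fun setT F.
Proof. by case. Qed.

Let mr_ge0 (A : set T) : 0 <= mr A. Proof. exact: fine_ge0. Qed.

Let le_mr (A C : set T) : measurable A -> measurable C -> A `<=` C -> mr A <= mr C.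
Proof.
move=> mA mC AC; rewrite fine_le ?(measure_fin_num mfin)//.
exact: sub_measure.
Qed.

Let mrU (A C : set T) : measurable A -> measurable C -> mr (A `|` C) <= mr A + mr C.
Proof.
move=> mA mC; have mU := measurableU _ _ mA mC.
rewrite -lee_fin EFinD !fineK ?(measure_fin_num mfin)//.
exact: measureU2.
Qed.

Let mr_far3 F G H K a r : measurable_fun setT F -> measurable_fun setT G ->
  measurable_fun setT H -> measurable_fun setT K ->
  mr (far F K a) <= mr (far F G r) + (mr (far G H (a - 2 * r)) + mr (far H K r)).
Proof.
move=> mF mG mH mK.
apply: (le_trans (le_mr _ _ (@far_triangle3 _ _ F G H K a r))).
- exact: measurable_far.
- by apply: measurableU; [|apply: measurableU]; exact: measurable_far.
apply: le_trans (mrU _ _) _; [|apply: measurableU|]; [exact: measurable_far..|].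
by rewrite lerD2l; apply: mrU; exact: measurable_far.
Qed.

Let out_far3 f s t g a r :
  out (far f g a) <= out (far f s r) + (out (far s t (a - 2 * r)) + out (far t g r)).
Proof.
apply: le_trans (le_outer muB (@far_triangle3 _ _ f s t g a r)) _.
apply: le_trans (outerU muB _ _) _; rewrite lerD2l.
exact: outerU.
Qed.

Let le_out_far f g a b : a <= b -> out (far f g b) <= out (far f g a).
Proof. by move=> ab; apply: le_outer => //; exact: le_far. Qed.

Let le_mr_far F G a b : measurable_fun setT F -> measurable_fun setT G ->
  a <= b -> mr (far F G b) <= mr (far F G a).
Proof. by move=> mF mG ab; apply: le_mr; [exact: measurable_far..|exact: le_far]. Qed.

Let tracks_le f F e : tracks f F -> 0 < e -> exists s,
  [/\ simple B s, out (far s f e) < e & mr (far (lift_simple s) F e) < e].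
Proof. by move=> [_]; exact. Qed.

(** Outer charge and measure agree exactly on simple functions; the passage from
    f, g to simple functions and from their lifts to F, G uses up the gap between
    the thresholds. *)
Lemma tracks_outer_le f g F G a b : tracks f F -> tracks g G -> a < b ->
  out (far f g b) <= mr (far F G a).
Proof.
move=> fF gG ab; apply/ler_addgt0Pr => e e0.
pose r := Num.min (e / 4) ((b - a) / 4).
have r0 : 0 < r by rewrite lt_min !divr_gt0// subr_gt0.
have re : r <= e / 4 by rewrite ge_min lexx.
have rab : r <= (b - a) / 4 by rewrite ge_min lexx orbT.
have [s [ss sf sF]] := tracks_le fF r0; have [t [st tg tG]] := tracks_le gG r0.
have mF := tracks_measurable fF; have mG := tracks_measurable gG.
have ms := measurable_lift ss; have mt := measurable_lift st.
apply: le_trans (out_far3 f s t g b r) _; rewrite (outer_far_simple _ ss st) (farC f s).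
have := mr_far3 (b - 2 * r) r ms mF mG mt; rewrite (farC G).
have := @le_mr_far F G a (b - 2 * r - 2 * r) mF mG.
have -> : a <= b - 2 * r - 2 * r by lra.
by move=> /(_ isT); lra.
Qed.

Lemma tracks_measure_le f g F G a b : tracks f F -> tracks g G -> a < b ->
  mr (far F G b) <= out (far f g a).
Proof.
move=> fF gG ab; apply/ler_addgt0Pr => e e0.
pose r := Num.min (e / 4) ((b - a) / 4).
have r0 : 0 < r by rewrite lt_min !divr_gt0// subr_gt0.
have re : r <= e / 4 by rewrite ge_min lexx.
have rab : r <= (b - a) / 4 by rewrite ge_min lexx orbT.
have [s [ss sf sF]] := tracks_le fF r0; have [t [st tg tG]] := tracks_le gG r0.
have mF := tracks_measurable fF; have mG := tracks_measurable gG.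
have ms := measurable_lift ss; have mt := measurable_lift st.
apply: le_trans (mr_far3 b r mF ms mt mG) _; rewrite -(outer_far_simple _ ss st) (farC F).
have := out_far3 s f g t (b - 2 * r) r; rewrite (farC g).
have := @le_out_far f g a (b - 2 * r - 2 * r).
have -> : a <= b - 2 * r - 2 * r by lra.
by move=> /(_ isT); lra.
Qed.

Lemma tracks_ae_eq f g F G : tracks f F -> tracks g G ->
  charge_ae_eq B mu f g <-> F = G %[ae m].
Proof.
move=> fF gG; have mF := tracks_measurable fF; have mG := tracks_measurable gG.
rewrite ae_eq_far//; split=> fg e e0; have e20 : 0 < e / 2 by rewrite divr_gt0.
- have ee : e / 2 < e by lra.
  have := tracks_measure_le fF gG ee; rewrite fg// => h.
  have /eqP : mr (far F G e) = 0 by apply/eqP; rewrite eq_le h mr_ge0.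
  by rewrite fine_eq0 ?(measure_fin_num mfin)// => [/eqP//|]; exact: measurable_far.
- have ee : e / 2 < e by lra.
  have := tracks_outer_le fF gG ee; rewrite fg//= => h.
  by apply/eqP; rewrite eq_le h (outer_ge0 muB).
Qed.

Lemma tracks_unique f F G : tracks f F -> tracks f G -> F = G %[ae m].
Proof.
move=> fF fG; apply/(tracks_ae_eq fF fG) => e e0.
rewrite (_ : far f f e = set0) ?(outerE muB) ?(charge_set0 muB)//.
  exact: set_field_set0.
by apply/seteqP; split=> x //; rewrite /far/= subrr normr0 ltNge ltW.
Qed.

Lemma tracks_simple s : simple B s -> tracks s (lift_simple s).
Proof.
move=> ss; split; first exact: measurable_lift.
move=> e e0; exists s; split=> //.
  rewrite (_ : far s s e = set0) ?(outerE muB) ?(charge_set0 muB)//.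
    exact: set_field_set0.
  by apply/seteqP; split=> x //; rewrite /far/= subrr normr0 ltNge ltW.
rewrite (_ : far _ _ e = set0) ?measure0//.
by apply/seteqP; split=> x //; rewrite /far/= subrr normr0 ltNge ltW.
Qed.

Lemma tracks_add f g F G : tracks f F -> tracks g G ->
  tracks (fun x => f x + g x) (fun y => F y + G y).
Proof.
move=> [mF fF] [mG gG]; split; first exact: measurable_funD.
move=> e e0; have e20 : 0 < e / 2 by rewrite divr_gt0.
have [s [ss sf sF]] := fF _ e20; have [t [st tg tG]] := gG _ e20.
have farD (Z : Type) (u v u' v' : Z -> R) :
    far (fun x => u x + v x) (fun x => u' x + v' x) e `<=`
    far u u' (e / 2) `|` far v v' (e / 2).
  move=> x; rewrite /far/= => uv; apply/orP; rewrite -implyNb -leNgt; apply/implyP.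
  have := ler_normD (u x - u' x) (v x - v' x).
  have -> : u x - u' x + (v x - v' x) = u x + v x - (u' x + v' x) by ring.
  lra.
exists (fun x => s x + t x); split; first exact: (simple_map2 Bf +%R).
  apply: le_lt_trans (le_outer muB (farD _ _ _ _ _)) _.
  by apply: le_lt_trans (outerU muB _ _) _; lra.
rewrite (lift_map2 +%R ss st).
have ms := measurable_lift ss; have mt := measurable_lift st.
apply: le_lt_trans (le_mr _ _ (farD _ _ _ _ _)) _.
- by apply: measurable_far => //; exact: measurable_funD.
- by apply: measurableU; exact: measurable_far.
by apply: le_lt_trans (mrU _ _) _; [exact: measurable_far..|lra].
Qed.

(** Continuity suffices, although it is not uniform: up to small measure, f and F
    take their values where one simple function does, that is, in a compact
    interval. *)
Lemma tracks_comp (psi : R -> R) f F : continuous psi -> tracks f F ->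
  tracks (psi \o f) (psi \o F).
Proof.
move=> psic [mF fF]; split.
  by apply: measurableT_comp => //; exact: continuous_measurable_fun.
(* Off a set of small outer charge f is within 1 of s0, hence bounded by K + 1. *)
move=> e e0; pose q := Num.min 1 (e / 2).
have q0 : 0 < q by rewrite lt_min ltr01 divr_gt0.
have q1 : q <= 1 by rewrite ge_min lexx.
have qe : q <= e / 2 by rewrite ge_min lexx orbT.
have [s0 [ss0 s0f s0F]] := fF q q0.
have [K K0 HK] := bounded_simple Bf ss0.
have HK' y : `|lift_simple s0 y| <= K by have [x <-] := lift_range y ss0.
have [r r0 Hr] := continuous_modulus (K + 1) psic e0.
pose w := Num.min r (e / 2).
have w0 : 0 < w by rewrite lt_min r0 divr_gt0.
have wr : w <= r by rewrite ge_min lexx.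
have we : w <= e / 2 by rewrite ge_min lexx orbT.
have [s [ss sf sF]] := fF w w0.
have farpsi (Z : Type) (u u0 v : Z -> R) : (forall z, `|u0 z| <= K) ->
    far (psi \o u) (psi \o v) e `<=` far u v w `|` far u0 v q.
  move=> u0K z; rewrite /far/= => uve; apply/orP; rewrite -implyNb -leNgt.
  apply/implyP => uvw; rewrite ltNge; apply/negP => u0v.
  move: uve; rewrite ltNge distrC => /negP; apply; apply: Hr.
    have := ler_normD (u0 z) (v z - u0 z); rewrite subrKC => h.
    by have := u0K z; rewrite distrC in u0v; lra.
  by rewrite distrC; lra.
have ms := measurable_lift ss; have ms0 := measurable_lift ss0.
exists (psi \o s); split; first exact: simple_map.
  apply: le_lt_trans (le_outer muB (farpsi _ s s0 f HK)) _.
  by apply: le_lt_trans (outerU muB _ _) _; lra.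
rewrite lift_map//.
apply: le_lt_trans (le_mr _ _ (farpsi _ _ (lift_simple s0) F HK')) _.
- by apply: measurable_far; apply: measurableT_comp => //; exact: continuous_measurable_fun.
- by apply: measurableU; exact: measurable_far.
by apply: le_lt_trans (mrU _ _) _; [exact: measurable_far..|lra].
Qed.

Lemma tracks_scale f F a : tracks f F -> tracks (fun x => a * f x) (fun y => a * F y).
Proof.
by apply: (@tracks_comp (fun x => a * x)) => x; apply: cvgMr; exact: cvg_id.
Qed.

(** Hazy convergence on one side and convergence in measure on the other are
    tested on the same sequence, which yields simple functions good for both. *)
Lemma tracks_limit (s : nat -> X -> R) f F : (forall n, simple B (s n)) ->
  hazy_cvg B mu s f -> measurable_fun setT F ->
  cvg_in_measure m (fun n => lift_simple (s n)) F -> tracks f F.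
Proof.
move=> ss sf mF sF; split=> // e e0.
have [n1 Hn1] := (cvg_seqP _ _).1 (sf e e0) e e0.
have [n2 Hn2] := sF e e0.
exists (s (maxn n1 n2)); split => //.
  have := Hn1 _ (leq_maxl n1 n2); rewrite subr0; apply: le_lt_trans.
  exact: ler_norm.
rewrite (fine_measure_lt mfin); last exact/measurable_far/mF/measurable_lift.
by apply: Hn2; exact: leq_maxr.
Qed.

(** The lifts of a hazily convergent sequence are Cauchy in measure. This is where
    countable additivity on T makes up for its absence on X. *)
Lemma T1_tracks f : T1_measurable B mu f -> exists F, tracks f F.
Proof.
move=> [s ss sf].
have [||F [Z [k [mF sF _ _]]]] := @cauchy_in_measure_cvg _ _ _ _ mfin (fun n => lift_simple (s n)).
- by move=> n; exact: measurable_lift.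
- move=> e e0; have e20 : 0 < e / 2 by rewrite divr_gt0.
  have [n0 Hn0] := (cvg_seqP _ _).1 (sf _ e20) _ e20.
  exists n0 => i j /Hn0 + /Hn0; rewrite !subr0 => hi hj.
  rewrite -(fine_measure_lt mfin); last first.
    by apply: measurable_far; exact: measurable_lift.
  rewrite -outer_far_simple// [e in _ < e]splitr.
  have h : far (s i) (s j) e `<=` far (s i) f (e / 2) `|` far (s j) f (e / 2).
    by rewrite (farC (s j)) {1}[e]splitr; exact: far_triangle.
  apply: le_lt_trans (le_outer muB h) _; apply: le_lt_trans (outerU muB _ _) _.
  by apply: ltrD; [apply: le_lt_trans hi|apply: le_lt_trans hj]; exact: ler_norm.
by exists F; exact: tracks_limit sF.
Qed.

Lemma hazy_of_harmonic (s : nat -> X -> R) f :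
  (forall n, out (far (s n) f n.+1%:R^-1) < n.+1%:R^-1) -> hazy_cvg B mu s f.
Proof.
move=> sf e e0; apply/cvg_seqP => r r0.
have q0 : 0 < Num.min e r by rewrite lt_min e0.
have [n0 _ Hn0] := near_infty_natSinv_lt (PosNum q0).
exists n0 => n n0n; have /= := Hn0 n n0n; rewrite lt_min => /andP[ne nr].
rewrite subr0 ger0_norm ?(outer_ge0 muB)//; apply: lt_trans nr.
by apply: le_lt_trans (sf n); apply: le_out_far; exact: ltW.
Qed.

Lemma tracks_T1 f F : tracks f F -> T1_measurable B mu f.
Proof.
move=> [mF fF]; have /choice[s Hs] n : exists s,
    simple B s /\ out (far s f n.+1%:R^-1) < n.+1%:R^-1.
  have n0 : 0 < n.+1%:R^-1 :> R by rewrite invr_gt0.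
  by have [s []] := fF _ n0; exists s.
by exists s; [move=> n; case: (Hs n)|apply: hazy_of_harmonic => n; case: (Hs n)].
Qed.

(** * Integrals and L_p along the homomorphism *)

Local Notation L1 := (lebesgue_Lfun m 1).
Local Notation rho1 := (lebesgue_dist m 1).
Let le11 : (1 : R) = 0 \/ 1 <= (1 : R). Proof. by right. Qed.

Lemma lift_Lfun p s : p = 0 \/ 1 <= p -> simple B s -> lebesgue_Lfun m p (lift_simple s).
Proof.
move=> hp ss; have ms := measurable_lift ss.
rewrite /lebesgue_Lfun; case: eqVneq => // pn0.
have p1 : 1 <= p by case: hp => // p0; rewrite p0 eqxx in pn0.
apply/Lfun_pintP => //; split => //; have [K K0 HK] := bounded_simple Bf ss.
apply: (@le_lt_trans _ _ (pint m p (cst K))).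
  apply: le_pint => // x /=; rewrite [leRHS]ger0_norm//.
  by have [z <-] := lift_range x ss.
have -> : pint m p (cst K) = ((`|K| `^ p)%:E * m setT)%E.
  by rewrite -(integral_cst m measurableT).
by rewrite lte_mul_pinfty// lee_fin powR_ge0.
Qed.

(** The cut-off commutes with the lift, so that approximation in measure by
    lifts becomes approximation in L_p by lifts. *)
Lemma lift_dense p F e : p = 0 \/ 1 <= p -> lebesgue_Lfun m p F -> 0 < e ->
  (forall r, 0 < r -> exists2 s, simple B s & mr (far (lift_simple s) F r) < r) ->
  exists2 s, simple B s & lebesgue_dist m p (lift_simple s) F < e.
Proof.
move=> hp FL e0 FS; have [psi [a [a0 Ha]]] := lebesgue_dist_cutoff mfin hp FL e0.
have [s ss sF] := FS a a0; exists (psi \o s); first exact: simple_map.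
rewrite lift_map//; apply: Ha; first exact: lift_Lfun.
  by rewrite -lift_map//; apply: lift_Lfun => //; exact: simple_map.
rewrite -(fine_measure_lt mfin)//; apply: measurable_far.
  exact: measurable_lift.
exact: lebesgue_Lfun_measurable FL.
Qed.

Let rho1E F G : rho1 F G = fine (\int[m]_y (`|F y - G y|)%:E)%E.
Proof. by rewrite /lebesgue_dist oner_eq0 Lnorm1. Qed.

Lemma simple_integral_dist s t : simple B s -> simple B t ->
  simple_integral B mu (fun x => `|s x - t x|) = rho1 (lift_simple s) (lift_simple t).
Proof.
move=> ss st; rewrite rho1E.
have := simple_integralE (simple_map2 Bf (fun x y => `|x - y|) ss st).
by rewrite (lift_map2 (fun x y => `|x - y|) ss st) => <-.
Qed.

Let L1_integrable F : L1 F -> m.-integrable setT (EFin \o F).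
Proof.
by rewrite /lebesgue_Lfun oner_eq0 => /Lfun1_integrable.
Qed.

Lemma integral_dist_le F G : L1 F -> L1 G ->
  `|fine (\int[m]_y (F y)%:E)%E - fine (\int[m]_y (G y)%:E)%E| <= rho1 F G.
Proof.
move=> /L1_integrable iF /L1_integrable iG.
have iFG := integrableB measurableT iF iG.
have := le_abse_integral m measurableT (measurable_int _ iFG).
rewrite (integralB_EFin measurableT iF iG) => h.
rewrite rho1E -lee_fin fineK; last first.
  by apply: integrable_fin_num => //; exact: integrable_abse iFG.
apply: le_trans h; rewrite -(fineK (integrable_fin_num measurableT iF)).
by rewrite -(fineK (integrable_fin_num measurableT iG)).
Qed.

(** The lifts of a determining sequence are Cauchy in L_1 of the measure, so the
    limit of the integrals is an integral. *)
Lemma determining_tracks (s : nat -> X -> R) f : determining B mu s f -> exists F,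
  [/\ tracks f F, L1 F &
      simple_integral B mu (s n) @[n --> \oo] --> fine (\int[m]_y (F y)%:E)%E].
Proof.
move=> [ss sf sC].
have sL n : L1 (lift_simple (s n)) by exact: lift_Lfun.
have [|F FL sF] := lebesgue_dist_complete mfin le11 sL.
  move=> e e0.
  have [n0 Hn0] := (cvg_filter_prodP (fun i j => simple_integral B mu
    (fun x => `|s i x - s j x|))).1 sC e e0.
  exists n0 => i j n0i n0j; rewrite -simple_integral_dist//.
  exact: le_lt_trans (ler_norm _) (Hn0 i j n0i n0j).
exists F; split => //.
  apply: (tracks_limit ss sf); first exact: lebesgue_Lfun_measurable FL.
  move=> e /(lebesgue_dist_far mfin le11)[a a0 Ha].
  by have [n0 Hn0] := sF a a0; exists n0 => n /Hn0; exact: Ha.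
apply/cvg_seqP => e /sF[n0 Hn0]; exists n0 => n /Hn0; apply: le_lt_trans.
have := integral_dist_le (sL n) FL.
by rewrite -simple_integralE.
Qed.

(** From right to left, a determining sequence is obtained from lifts that
    approximate F in L_1: closeness in L_1 is closeness in measure, hence closeness
    to f in outer charge. *)
Lemma charge_integrableP f F : tracks f F -> charge_integrable B mu f <-> L1 F.
Proof.
move=> fF; split=> [[s sf]|FL].
  have [G [fG GL _]] := determining_tracks sf.
  apply: (lebesgue_Lfun_ae le11 GL); first exact: tracks_measurable fF.
  exact: tracks_unique fG fF.
have FS r : 0 < r -> exists2 s, simple B s & mr (far (lift_simple s) F r) < r.
  by move=> r0; have [s [ss _ sF]] := tracks_le fF r0; exists s.
have /choice[s Hs] n : exists s, simple B s /\ rho1 (lift_simple s) F < n.+1%:R^-1.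
  have n0 : 0 < n.+1%:R^-1 :> R by rewrite invr_gt0.
  by have [s] := lift_dense le11 FL n0 FS; exists s.
have ss n : simple B (s n) by case: (Hs n).
have sL n : L1 (lift_simple (s n)) by exact: lift_Lfun.
have sF e : 0 < e -> exists n0, forall n, (n0 <= n)%N -> rho1 (lift_simple (s n)) F < e.
  move=> e0; have [n0 _ Hn0] := near_infty_natSinv_lt (PosNum e0).
  by exists n0 => n n0n; apply: lt_trans (Hs n).2 _; exact: (Hn0 n n0n).
exists s; split => //.
  move=> e e0; apply/cvg_seqP => r r0; have e20 : 0 < e / 2 by rewrite divr_gt0.
  have q0 : 0 < Num.min (e / 2) r by rewrite lt_min e20.
  have [a a0 Ha] := lebesgue_dist_far mfin le11 q0.
  have [n0 Hn0] := sF a a0; exists n0 => n n0n.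
  rewrite subr0 ger0_norm ?(outer_ge0 muB)//.
  have qe : Num.min (e / 2) r < e by rewrite gt_min; apply/orP; left; lra.
  apply: le_lt_trans (tracks_outer_le (tracks_simple (ss n)) fF qe) _.
  have := Ha _ _ (sL n) FL (Hn0 n n0n); rewrite -(fine_measure_lt mfin).
    by move=> h; apply: lt_le_trans h _; rewrite ge_min lexx orbT.
  apply: measurable_far; first exact: measurable_lift.
  exact: tracks_measurable fF.
apply/(cvg_filter_prodP (fun i j => simple_integral B mu (fun x => `|s i x - s j x|))).
move=> e e0; have [|n0 Hn0] := sF (e / 2); first by rewrite divr_gt0.
exists n0 => i j /Hn0 si /Hn0 sj; rewrite simple_integral_dist//.
rewrite ger0_norm ?lebesgue_dist_ge0//.
apply: le_lt_trans (lebesgue_dist_triangle mfin le11 (sL i) FL (sL j)) _.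
by rewrite (lebesgue_distC m le11 F); lra.
Qed.

Lemma charge_integralE f F : tracks f F -> L1 F ->
  charge_integral B mu f = fine (\int[m]_y (F y)%:E)%E.
Proof.
move=> fF FL.
have detE (s : nat -> X -> R) : determining B mu s f -> simple_integral B mu (s n) @[n --> \oo] -->
    fine (\int[m]_y (F y)%:E)%E.
  move=> /determining_tracks[G [fG GL sG]].
  suff -> : (\int[m]_y (F y)%:E = \int[m]_y (G y)%:E)%E by [].
  have mF := tracks_measurable fF; have mG := tracks_measurable fG.
  apply: ae_eq_integral => //; [exact/measurable_EFinP..|].
  by apply: filterS (tracks_unique fF fG) => x /= /(_ I) FGx _; rewrite FGx.
rewrite /charge_integral; case: xgetP => [r _ [s sf sr]|none].
  exact: cvg_unique sr (detE s sf).
have [s sf] := (charge_integrableP fF).2 FL.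
by exfalso; apply: (none (fine (\int[m]_y (F y)%:E)%E)); exists s => //; exact: detE.
Qed.

Variable p : R.
Hypothesis hp : p = 0 \/ 1 <= p.
Local Notation L := (lebesgue_Lfun m p).
Local Notation rho := (lebesgue_dist m p).

Let tracks_pow f F : 1 <= p -> tracks f F ->
  tracks (fun x => `|f x| `^ p) (fun y => `|F y| `^ p).
Proof. by move=> p1; exact: tracks_comp (continuous_norm_powR p1). Qed.

Let pow_L1 F : 1 <= p -> measurable_fun setT F ->
  L1 (fun y => `|F y| `^ p) <-> L F.
Proof.
move=> p1 mF; rewrite /lebesgue_Lfun oner_eq0 gt_eqF ?(lt_le_trans ltr01)//=.
have E : pint m 1 (fun y => `|F y| `^ p) = pint m p F.
  by apply: eq_integral => y _; rewrite powRr1// ger0_norm// powR_ge0.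
have mp : measurable_fun setT (fun y => `|F y| `^ p).
  exact/measurable_EFinP/measurable_pow.
split=> [/(Lfun_pintP m (lexx 1))[_ h]|/(Lfun_pintP m p1)[_ h]].
  by apply/(Lfun_pintP m p1); rewrite -E.
by apply/(Lfun_pintP m (lexx 1)); rewrite E.
Qed.

Lemma charge_Lfun_tracks f : charge_Lfun B mu p f -> exists F, tracks f F.
Proof.
by rewrite /charge_Lfun; case: ifP => _ /= => [|[+ _]]; exact: T1_tracks.
Qed.

(** The p-th power of f corresponds to that of F, and integrability is decided on
    the side of F. *)
Lemma charge_LfunP f F : tracks f F -> charge_Lfun B mu p f <-> L F.
Proof.
move=> fF; have mF := tracks_measurable fF; have fT := tracks_T1 fF.
case: hp => [p0|p1]; first by rewrite /charge_Lfun /lebesgue_Lfun p0 eqxx.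
rewrite -(pow_L1 p1 mF) -(charge_integrableP (tracks_pow p1 fF)) /charge_Lfun.
by rewrite gt_eqF ?(lt_le_trans ltr01)//=; split=> [[]|].
Qed.

Lemma charge_distE f g F G : tracks f F -> tracks g G -> L F -> L G ->
  charge_dist B mu p f g = rho F G.
Proof.
move=> fF gG FL GL; have mF := tracks_measurable fF.
have mG := tracks_measurable gG; case: hp => [p0|p1].
  rewrite /charge_dist /lebesgue_dist p0 eqxx.
  (* An infimum of e + u e does not see a shift of the argument of u by an
     arbitrarily small amount. *)
  have inf_le (u v : R -> R) : (forall e, 0 <= u e) -> (forall e, 0 <= v e) ->
      (forall a b, a < b -> v b <= u a) ->
      inf [set e + v e | e in [set e : R | 0 < e]] <=
      inf [set e + u e | e in [set e : R | 0 < e]].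
    move=> u0 v0 uv; apply: lb_le_inf; first by exists (1 + u 1), 1 => /=.
    move=> _ [a /= a0 <-]; apply/ler_addgt0Pr => e e0.
    apply: (@le_trans _ _ ((a + e) + v (a + e))).
      apply: ge_inf; last by exists (a + e) => //=; rewrite addr_gt0.
      by exists 0 => _ [b /= b0 <-]; rewrite addr_ge0// ltW.
    by have := uv a (a + e); rewrite ltrDl => /(_ e0); lra.
  apply/eqP; rewrite eq_le; apply/andP; split.
    apply: (inf_le (fun e => mr (far F G e)) (fun e => out (far f g e))) => [e|e|a b].
    - exact: fine_ge0.
    - exact: (outer_ge0 muB).
    - exact: tracks_outer_le.
  apply: (inf_le (fun e => out (far f g e)) (fun e => mr (far F G e))) => [e|e|a b].
  - exact: (outer_ge0 muB).
  - exact: fine_ge0.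
  - exact: tracks_measure_le.
have FGL : L (fun y => F y + (-1) * G y).
  by apply: lebesgue_LfunD => //; exact: lebesgue_LfunZ.
have fgFG := tracks_add fF (tracks_scale (-1) gG).
have mFG := tracks_measurable fgFG.
rewrite (lebesgue_dist_pint m F G p1) /charge_dist gt_eqF ?(lt_le_trans ltr01)//.
rewrite (_ : (fun x => `|f x - g x| `^ p) = (fun x => `|f x + (-1) * g x| `^ p)).
  rewrite (charge_integralE (tracks_pow p1 fgFG)); last exact/pow_L1.
  suff -> : (\int[m]_y (`|F y + (-1) * G y| `^ p)%:E)%E = pint m p (F \- G)%R by [].
  by rewrite /pint; under eq_integral do rewrite mulN1r.
by apply/funext => x; rewrite mulN1r.
Qed.

End Transfer.
(** * Quotients of function spaces *)

(** What makes the quotient of L by e, with the pseudometric d, a metric vector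
    space. *)
Record metric_funspace (R : realType) (X : Type) (L : set (X -> R))
    (e : (X -> R) -> (X -> R) -> Prop) (d : (X -> R) -> (X -> R) -> R) : Prop :=
  MetricFunspace {
  mfs_add : forall f g, L f -> L g -> L (fun x => f x + g x) ;
  mfs_scale : forall a f, L f -> L (fun x => a * f x) ;
  mfs_ge0 : forall f g, L f -> L g -> 0 <= d f g ;
  mfs_sym : forall f g, L f -> L g -> d f g = d g f ;
  mfs_triangle : forall f g h, L f -> L g -> L h -> d f h <= d f g + d g h ;
  mfs_refl : forall f, L f -> e f f ;
  mfs_eq0 : forall f g, L f -> L g -> e f g <-> d f g = 0 ;
  mfs_eq_add : forall f f' g g', L f -> L f' -> L g -> L g' -> e f f' -> e g g' ->
    e (fun x => f x + g x) (fun x => f' x + g' x) ;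
  mfs_eq_scale : forall a f f', L f -> L f' -> e f f' ->
    e (fun x => a * f x) (fun x => a * f' x) }.

Section Quotient.
Variables (R : realType) (X : Type) (L : set (X -> R)).
Variables (e : (X -> R) -> (X -> R) -> Prop) (d : (X -> R) -> (X -> R) -> R).
Hypothesis H : metric_funspace L e d.
Implicit Types (f g h : X -> R) (C : set (X -> R)).

Local Notation Q := (fquot L e d).

Let e_sym f g : L f -> L g -> e f g -> e g f.
Proof.
by move=> Lf Lg /(mfs_eq0 H Lf Lg) fg; apply/(mfs_eq0 H Lg Lf); rewrite (mfs_sym H).
Qed.

Let e_trans f g h : L f -> L g -> L h -> e f g -> e g h -> e f h.
Proof.
move=> Lf Lg Lh /(mfs_eq0 H Lf Lg) fg /(mfs_eq0 H Lg Lh) gh.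
apply/(mfs_eq0 H Lf Lh)/eqP; rewrite eq_le (mfs_ge0 H)// andbT.
by apply: le_trans (mfs_triangle H Lf Lg Lh) _; rewrite fg gh addr0.
Qed.

Lemma fclass_eqP f g : L f -> L g -> fclass L e f = fclass L e g <-> e f g.
Proof.
move=> Lf Lg; split=> [fg|fg].
  have : fclass L e g g by split => //; exact: (mfs_refl H).
  by rewrite -fg => -[].
apply/seteqP; split=> h [Lh hh]; split => //.
  exact: e_trans Lg Lf Lh (e_sym Lf Lg fg) hh.
exact: e_trans Lf Lg Lh fg hh.
Qed.

Lemma frepr_fclass f : L f -> L (frepr (fclass L e f)) /\ e f (frepr (fclass L e f)).
Proof.
move=> Lf; suff : fclass L e f (frepr (fclass L e f)) by [].
by apply: (@xgetPex _ _ (fclass L e f)); exists f; split => //; exact: (mfs_refl H).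
Qed.

Lemma fquot_ptsP C : pts Q C -> exists2 f, L f & C = fclass L e f.
Proof. by move=> [f Lf <-]; exists f. Qed.

Lemma vadd_fclass f g : L f -> L g ->
  vadd Q (fclass L e f) (fclass L e g) = fclass L e (fun x => f x + g x).
Proof.
move=> Lf Lg; have [Lf' ff'] := frepr_fclass Lf; have [Lg' gg'] := frepr_fclass Lg.
apply/fclass_eqP; [exact: (mfs_add H)|exact: (mfs_add H)|].
by apply: (mfs_eq_add H) => //; exact: e_sym.
Qed.

Lemma vscale_fclass a f : L f ->
  vscale Q a (fclass L e f) = fclass L e (fun x => a * f x).
Proof.
move=> Lf; have [Lf' ff'] := frepr_fclass Lf.
apply/fclass_eqP; [exact: (mfs_scale H)|exact: (mfs_scale H)|].
by apply: (mfs_eq_scale H) => //; exact: e_sym.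
Qed.

Lemma vdist_fclass f g : L f -> L g ->
  vdist Q (fclass L e f) (fclass L e g) = d f g.
Proof.
move=> Lf Lg; have [Lf' ff'] := frepr_fclass Lf; have [Lg' gg'] := frepr_fclass Lg.
rewrite /vdist/=; set f' := frepr _ in Lf' ff' *; set g' := frepr _ in Lg' gg' *.
move/(mfs_eq0 H Lf Lf') : ff' => ff'; move/(mfs_eq0 H Lg Lg') : gg' => gg'.
apply/eqP; rewrite eq_le; apply/andP; split.
  have := mfs_triangle H Lf' Lf Lg'; have := mfs_triangle H Lf Lg Lg'.
  by rewrite (mfs_sym H Lf' Lf) ff' gg'; lra.
have := mfs_triangle H Lf Lf' Lg; have := mfs_triangle H Lf' Lg' Lg.
by rewrite (mfs_sym H Lg' Lg) ff' gg'; lra.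
Qed.

Lemma fquot_complete :
  (forall u : nat -> X -> R, (forall n, L (u n)) ->
    (forall r, 0 < r -> exists n0, forall i j, (n0 <= i)%N -> (n0 <= j)%N ->
      d (u i) (u j) < r) ->
    exists2 f, L f & forall r, 0 < r -> exists n0, forall n, (n0 <= n)%N ->
      d (u n) f < r) ->
  mv_complete Q.
Proof.
move=> Lc U UQ UC.
have /choice[u Hu] n : exists f, L f /\ U n = fclass L e f.
  by have [f] := fquot_ptsP (UQ n); exists f.
have Lu n : L (u n) by case: (Hu n).
have [|f Lf uf] := Lc u Lu.
  move=> r r0; have [n0 Hn0] := (cvg_filter_prodP (fun i j => vdist Q (U i) (U j))).1 UC r r0.
  exists n0 => i j n0i n0j; have := Hn0 i j n0i n0j.
  by rewrite (Hu i).2 (Hu j).2 vdist_fclass//; apply: le_lt_trans; exact: ler_norm.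
exists (fclass L e f); first by exists f.
apply/cvg_seqP => r /uf[n0 Hn0]; exists n0 => n /Hn0.
by rewrite subr0 (Hu n).2 vdist_fclass// ger0_norm// (mfs_ge0 H).
Qed.

End Quotient.

(** Used to give a charge space the metric structure of the Lebesgue space with
    the same functions. *)
Lemma metric_funspace_eq (R : realType) (X : Type) (L L' : set (X -> R)) e e' d d' :
  metric_funspace L e d -> L = L' ->
  (forall f g, L f -> L g -> e f g <-> e' f g) ->
  (forall f g, L f -> L g -> d f g = d' f g) ->
  metric_funspace L' e' d'.
Proof.
move=> [HD HZ H0 HS HT HR HE HED HEZ] <- ee dd; split => //.
- by move=> f g Lf Lg; rewrite -dd//; exact: H0.
- by move=> f g Lf Lg; rewrite -!dd//; exact: HS.
- by move=> f g h Lf Lg Lh; rewrite -!dd//; exact: HT.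
- by move=> f Lf; apply/ee => //; exact: HR.
- by move=> f g Lf Lg; rewrite -ee// -dd//; exact: HE.
- move=> f f' g g' Lf Lf' Lg Lg' /(ee _ _ Lf Lf') ff' /(ee _ _ Lg Lg') gg'.
  by apply/ee; [exact: HD|exact: HD|exact: HED].
- move=> a f f' Lf Lf' /(ee _ _ Lf Lf') ff'.
  by apply/ee; [exact: HZ|exact: HZ|exact: HEZ].
Qed.

Lemma fquot_coincide (R : realType) (X : Type) (L L' : set (X -> R)) e e' d d' :
  metric_funspace L e d -> L = L' ->
  (forall f g, L f -> L g -> e f g <-> e' f g) ->
  (forall f g, L f -> L g -> d f g = d' f g) ->
  mv_coincide (fquot L e d) (fquot L' e' d').
Proof.
move=> H <- ee dd.
have cE f : L f -> fclass L e f = fclass L e' f.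
  by move=> Lf; apply/seteqP; split=> g [Lg fg]; split => //; exact/ee.
have rE C : pts (fquot L e d) C -> L (frepr C).
  by move=> [f Lf <-]; have [] := frepr_fclass H Lf.
split.
- by apply/seteqP; split=> _ [f Lf <-]; exists f => //; rewrite cE.
- by move=> C C' /rE Lf /rE Lg; apply: cE; exact: (mfs_add H).
- by move=> a C /rE Lf; apply: cE; exact: (mfs_scale H).
- by move=> C C' /rE Lf /rE Lg; exact: dd.
Qed.

(** * Isometries between quotients induced by a relation on functions *)

Section QuotientRelation.
Variables (R : realType) (X Y : Type).
Variables (L : set (X -> R)) (e : (X -> R) -> (X -> R) -> Prop)
  (d : (X -> R) -> (X -> R) -> R).
Variables (L' : set (Y -> R)) (e' : (Y -> R) -> (Y -> R) -> Prop)
  (d' : (Y -> R) -> (Y -> R) -> R).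
Variable rel : (X -> R) -> (Y -> R) -> Prop.
Hypothesis H' : metric_funspace L' e' d'.
Hypothesis rel_ex : forall f, L f -> exists F, rel f F.
Hypothesis rel_L : forall f F, rel f F -> L f <-> L' F.
Hypothesis rel_e : forall f g F G, rel f F -> rel g G -> e f g <-> e' F G.
Hypothesis rel_d : forall f g F G, rel f F -> rel g G -> L' F -> L' G ->
  d f g = d' F G.
Hypothesis rel_add : forall f g F G, rel f F -> rel g G ->
  rel (fun x => f x + g x) (fun y => F y + G y).
Hypothesis rel_scale : forall a f F, rel f F ->
  rel (fun x => a * f x) (fun y => a * F y).

Let rel_exL f : L f -> exists2 F, rel f F & L' F.
Proof. by move=> Lf; have [F fF] := rel_ex Lf; exists F => //; exact/(rel_L fF). Qed.

(** All the axioms are pulled back along the relation, including closure of L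
    under sums: f + g is in L because F + G is in L'. *)
Lemma rel_metric_funspace : metric_funspace L e d.
Proof.
split.
- move=> f g /rel_exL[F fF LF] /rel_exL[G gG LG].
  by apply/(rel_L (rel_add fF gG)); exact: (mfs_add H').
- move=> a f /rel_exL[F fF LF].
  by apply/(rel_L (rel_scale a fF)); exact: (mfs_scale H').
- move=> f g /rel_exL[F fF LF] /rel_exL[G gG LG].
  by rewrite (rel_d fF gG)//; exact: (mfs_ge0 H').
- move=> f g /rel_exL[F fF LF] /rel_exL[G gG LG].
  by rewrite (rel_d fF gG)// (rel_d gG fF)//; exact: (mfs_sym H').
- move=> f g h /rel_exL[F fF LF] /rel_exL[G gG LG] /rel_exL[K hK LK].
  rewrite (rel_d fF hK)// (rel_d fF gG)// (rel_d gG hK)//.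
  exact: (mfs_triangle H').
- by move=> f /rel_exL[F fF LF]; apply/(rel_e fF fF); exact: (mfs_refl H').
- move=> f g /rel_exL[F fF LF] /rel_exL[G gG LG].
  by rewrite (rel_d fF gG)// (rel_e fF gG); exact: (mfs_eq0 H').
- move=> f f' g g' /rel_exL[F fF LF] /rel_exL[F' fF' LF'].
  move=> /rel_exL[G gG LG] /rel_exL[G' gG' LG'] /(rel_e fF fF') FF' /(rel_e gG gG') GG'.
  apply/(rel_e (rel_add fF gG) (rel_add fF' gG')).
  exact: (mfs_eq_add H').
- move=> a f f' /rel_exL[F fF LF] /rel_exL[F' fF' LF'] /(rel_e fF fF') FF'.
  apply/(rel_e (rel_scale a fF) (rel_scale a fF')).
  exact: (mfs_eq_scale H').
Qed.

Let H := rel_metric_funspace.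
Local Notation Q := (fquot L e d).
Local Notation Q' := (fquot L' e' d').

Definition rel_image : set (set (Y -> R)) :=
  [set C | exists f F, [/\ L f, rel f F & C = fclass L' e' F]].

Lemma rel_image_subspace : L !=set0 -> mv_subspace Q' rel_image.
Proof.
move=> [f0 Lf0]; split.
- by move=> _ [f [F [Lf fF ->]]]; exists F => //; exact/(rel_L fF).
- by have [F fF] := rel_ex Lf0; exists (fclass L' e' F), f0, F.
- move=> _ _ [f [F [Lf fF ->]]] [g [G [Lg gG ->]]].
  have LF := (rel_L fF).1 Lf; have LG := (rel_L gG).1 Lg.
  exists (fun x => f x + g x), (fun y => F y + G y); split.
  + exact: (mfs_add H).
  + exact: rel_add.
  + exact: (vadd_fclass H').
- move=> a _ [f [F [Lf fF ->]]]; have LF := (rel_L fF).1 Lf.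
  exists (fun x => a * f x), (fun y => a * F y); split.
  + exact: (mfs_scale H).
  + exact: rel_scale.
  + exact: (vscale_fclass H').
Qed.

Lemma rel_image_isometric : mv_isometric Q (mv_restrict Q' rel_image).
Proof.
pose h C := fclass L' e' (xget (fun=> 0) [set F | rel (frepr C) F]).
have hE f F : L f -> rel f F -> h (fclass L e f) = fclass L' e' F.
  move=> Lf fF; have LF := (rel_L fF).1 Lf.
  have [Lf' ff'] := frepr_fclass H Lf.
  have fG : rel (frepr (fclass L e f))
      (xget (fun=> 0) [set F | rel (frepr (fclass L e f)) F]).
    exact: (@xgetPex _ _ [set F | rel (frepr (fclass L e f)) F] (rel_ex Lf')).
  have LG := (rel_L fG).1 Lf'.
  apply/(fclass_eqP H') => //; apply/(rel_e fG fF).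
  have /(mfs_eq0 H Lf Lf') := ff'; rewrite (mfs_sym H Lf Lf') => ?.
  exact/(mfs_eq0 H Lf' Lf).
exists h; split.
- split.
  + by move=> _ [f Lf <-]; have [F fF] := rel_ex Lf; exists f, F; rewrite (hE f F).
  + move=> _ _ /set_mem[f Lf <-] /set_mem[g Lg <-].
    have [F fF LF] := rel_exL Lf; have [G gG LG] := rel_exL Lg.
    rewrite (hE f F)// (hE g G)// => /(fclass_eqP H' LF LG) FG.
    by apply/(fclass_eqP H Lf Lg); apply/(rel_e fF gG).
  + by move=> _ [f [F [Lf fF ->]]]; exists (fclass L e f); [exists f|exact: hE].
- move=> _ _ [f Lf <-] [g Lg <-].
  have [F fF LF] := rel_exL Lf; have [G gG LG] := rel_exL Lg.
  rewrite (vadd_fclass H)// (hE _ _ _ (rel_add fF gG)); last exact: (mfs_add H).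
  by rewrite (hE f F)// (hE g G)// (vadd_fclass H').
- move=> a _ [f Lf <-]; have [F fF LF] := rel_exL Lf.
  rewrite (vscale_fclass H)// (hE _ _ _ (rel_scale a fF)); last exact: (mfs_scale H).
  by rewrite (hE f F)// (vscale_fclass H').
- move=> _ _ [f Lf <-] [g Lg <-].
  have [F fF LF] := rel_exL Lf; have [G gG LG] := rel_exL Lg.
  rewrite (hE f F)// (hE g G)//.
  by rewrite [LHS](vdist_fclass H')// (vdist_fclass H)// (rel_d fF gG).
Qed.

(** A dense isometric copy of Q inside the complete space Q' is all of Q' as soon
    as Q is complete. *)
Lemma fquot_complete_iff : mv_complete Q' -> mv_dense Q' rel_image ->
  mv_complete Q <-> mv_isometric Q Q'.
Proof.
move=> Q'c dens; have [h [[hfun hinj hsurj] hD hZ hd]] := rel_image_isometric.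
split=> [Qc|[k [[kfun kinj ksurj] _ _ kd]]]; last first.
  move=> u uQ uC.
  have [||_ /ksurj[C CQ <-] Cu] := Q'c (fun n => k (u n)).
  - by move=> n; exact: kfun.
  - by under eq_fun do rewrite kd//.
  by exists C => //; under eq_fun do rewrite -kd//.
suff imT : rel_image = pts Q' by exists h; rewrite -imT.
apply/seteqP; split=> [_ [f [F [Lf fF ->]]]|_ [F LF <-]].
  by exists F => //; exact/(rel_L fF).
(* The classes D n of the image converge to the class of F; their preimages are
   Cauchy in Q, and the image of the limit has to be the class of F. *)
have FQ : pts Q' (fclass L' e' F) by exists F.
have /choice[D HD] n : exists D, rel_image D /\ vdist Q' (fclass L' e' F) D < n.+1%:R^-1.
  have n0 : 0 < n.+1%:R^-1 :> R by rewrite invr_gt0.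
  by have [D] := dens _ FQ _ n0; exists D.
have /choice[u Hu] n : exists C, pts Q C /\ h C = D n.
  by have [C] := hsurj _ (HD n).1; exists C.
have /choice[G HG] n : exists G, L' G /\ D n = fclass L' e' G.
  by have [[f [G [Lf fG ->]]] _] := HD n; exists G; split => //; exact/(rel_L fG).
have FG r : 0 < r -> exists n0, forall n, (n0 <= n)%N -> d' F (G n) < r.
  move=> r0; have [n0 _ Hn0] := near_infty_natSinv_lt (PosNum r0).
  exists n0 => n n0n; have [_] := HD n; rewrite (HG n).2 (vdist_fclass H')//; last first.
    by case: (HG n).
  by move=> /lt_trans; apply; exact: (Hn0 n n0n).
have [|C CQ Cu] := Qc u (fun n => (Hu n).1).
  apply/(cvg_filter_prodP (fun i j => vdist Q (u i) (u j))) => r r0.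
  have [|n0 Hn0] := FG (r / 2); first by rewrite divr_gt0.
  exists n0 => i j /Hn0 Fi /Hn0 Fj.
  have [ui hui] := Hu i; have [uj huj] := Hu j.
  have [Gi Di] := HG i; have [Gj Dj] := HG j.
  rewrite -hd// hui huj Di Dj [vdist _ _ _](vdist_fclass H')//.
  rewrite ger0_norm ?(mfs_ge0 H')//.
  apply: le_lt_trans (mfs_triangle H' Gi LF Gj) _.
  by rewrite (mfs_sym H' Gi LF); lra.
have [f [K [Lf fK hCK]]] := hfun _ CQ; have LK := (rel_L fK).1 Lf.
suff /(fclass_eqP H' LF LK) -> : e' F K by exists f, K.
apply/(mfs_eq0 H' LF LK)/eqP; rewrite eq_le (mfs_ge0 H')// andbT.
apply/ler_addgt0Pr => r r0; rewrite add0r.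
have r20 : 0 < r / 2 by rewrite divr_gt0.
have [n1 Hn1] := FG _ r20.
have [n2 Hn2] := (cvg_seqP _ _).1 Cu _ r20.
pose n := maxn n1 n2; have := Hn1 n (leq_maxl _ _) => FGn.
have := Hn2 n (leq_maxr _ _); have [un hun] := Hu n; have [Gn Dn] := HG n.
rewrite subr0 -hd// hun Dn hCK [vdist _ _ _](vdist_fclass H')//.
move=> /(le_lt_trans (ler_norm _)) GK.
by apply: le_trans (mfs_triangle H' LF Gn LK) _; lra.
Qed.

End QuotientRelation.
(** * Dense homomorphisms *)

Lemma measurable_set_field d (T : measurableType d) :
  set_field (@measurable d T).
Proof. by split; [|move=> A B; exact: measurableU|move=> A; exact: measurableC]. Qed.

Section HomDense.
Import HBSimple.
Variables (R : realType) (X : Type) (B : set (set X)) (mu : set X -> R).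
Context {d : measure_display} {T : measurableType d}.
Variables (m : {measure set T -> \bar R}) (theta : set X -> set T).
Hypothesis hom : charge_hom B mu m theta.
Hypothesis dense : forall E r, measurable E -> 0 < r ->
  exists2 b, B b & (m (theta b `+` E) < r%:E)%E.

Let Bf : set_field B. Proof. by case: hom => -[]. Qed.

Let measurableY (A E : set T) : measurable A -> measurable E -> measurable (A `+` E).
Proof. by move=> mA mE; apply: measurableU; exact: measurableD. Qed.

Let measure_bigsetU_le n (F : 'I_n -> set T) (r : R) : (forall k, measurable (F k)) ->
  (forall k, (m (F k) <= r%:E)%E) ->
  (m (\big[setU/set0]_(k < n) F k) <= (n%:R * r)%:E)%E.
Proof.
elim: n F => [|n IH] F mF Fr; first by rewrite big_ord0 measure0 mul0r.
rewrite big_ord_recl; apply: le_trans (measureU2 _ _ _) _ => //.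
  exact: bigsetU_measurable.
rewrite -natr1 mulrDl mul1r (addrC _ r) EFinD; apply: leeD; first exact: Fr.
by apply: (IH (fun k => F (lift ord0 k))) => k.
Qed.

(** A linear combination of indicators is imitated by replacing each set by the
    image of a set of B, at the cost of the symmetric differences. *)
Let hom_dense_simple (t : T -> R) (e : R) : simple measurable t -> 0 < e ->
  exists2 s, simple B s & exists Z,
    [/\ measurable Z, (m Z < e%:E)%E & forall y, ~ Z y -> lift_simple theta s y = t y].
Proof.
move=> [n [c [A [mA _ tE]]]] e0; pose r := e / n.+1%:R.
have r0 : 0 < r by rewrite divr_gt0.
have /choice[b Hb] (k : 'I_n) : exists b, B b /\ (m (theta b `+` A k) < r%:E)%E.
  by have [b] := dense (mA k) r0; exists b.
have Bb k : B (b k) by case: (Hb k).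
have sb k : simple B (fun x => c k * \1_(b k) x).
  exact: (simple_map Bf (fun a => c k * a) (simple_indic R Bf (Bb k))).
exists (fun x => \sum_(k < n) c k * \1_(b k) x); first exact: simple_sum.
pose Z := \big[setU/set0]_(k < n) (theta (b k) `+` A k).
have mZk k : measurable (theta (b k) `+` A k).
  by apply: measurableY => //; apply: (hom_measurable hom).
exists Z; split.
- exact: bigsetU_measurable.
- apply: (@le_lt_trans _ _ (n%:R * r)%:E).
    by apply: measure_bigsetU_le => // k; case: (Hb k) => _ /ltW.
  by rewrite lte_fin /r mulrCA gtr_pMr// ltr_pdivrMr// mul1r ltr_nat.
- move=> y nZy; rewrite (lift_sum hom)// tE; apply: eq_bigr => k _.
  have := lift_map hom (fun a => c k * a) (simple_indic R Bf (Bb k)).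
  move=> /(congr1 (fun f => f y)) /= ->; rewrite (lift_indic hom)//.
  have nk : ~ (theta (b k) `+` A k) y.
    by move=> yk; apply: nZy; rewrite /Z (bigD1 k)//=; left.
  congr (_ * _); rewrite !indicE; congr (_%:R); congr nat_of_bool.
  apply/idP/idP; rewrite !inE => yk; apply: contrapT => nyk; apply: nk.
    by left.
  by right.
Qed.

(** Measurable functions are limits in measure of simple functions, and these are
    imitated by lifts. *)
Lemma hom_dense_lift (F : T -> R) (e : R) : measurable_fun setT F -> 0 < e ->
  exists2 s, simple B s & fine (m (far (lift_simple theta s) F e)) < e.
Proof.
move=> mF e0; have mfin := hom_measure_fin hom.
have e20 : 0 < e / 2 by rewrite divr_gt0.
have mEF : measurable_fun setT (EFin \o F) by exact/measurable_EFinP.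
have [g gF] := approximation_sfun measurableT mEF.
have mg n : measurable_fun setT (g n) by [].
have gF' : cvg_off m set0 (fun n => g n) F.
  by split=> // y _; have /fine_cvg := gF y I.
have [n /(_ n (leqnn n)) gnF] := cvg_off_in_measure mfin mg mF gF' e20.
have sg : simple measurable (g n).
  apply/(simpleP (measurable_set_field T)); split; first exact: fimfunP.
  by move=> c; rewrite -[X in measurable X]setTI; apply: mg.
have [s ss [Z [mZ Ze sE]]] := hom_dense_simple sg e20.
have ms := measurable_lift hom ss.
exists s => //; rewrite (fine_measure_lt mfin); last exact: measurable_far.
have e2 : e = e / 2 + e / 2 by exact: splitr.
have sub : far (lift_simple theta s) F e `<=` Z `|` far (g n) F (e / 2).
  rewrite {1}e2 => y /(@far_triangle _ _ _ (g n))[sgy|]; last by right.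
  left; apply: contrapT => /sE sy; move: sgy.
  by rewrite /far/= sy subrr normr0 ltNge ltW.
have mgF : measurable (far (g n) F (e / 2)) by exact: measurable_far.
rewrite [X in (_ < X%:E)%E]e2; apply: sub_measure_lt sub _.
- exact: measurable_far.
- exact: measurableU.
- exact: measureU_lt.
Qed.

End HomDense.
(** * Charge spaces whose Lebesgue spaces are those of a measure *)

Lemma lebesgue_metric_funspace d (T : measurableType d) (R : realType)
    (m : {measure set T -> \bar R}) (p : R) : (m setT < +oo)%E ->
  p = 0 \/ 1 <= p ->
  metric_funspace (lebesgue_Lfun m p) (fun f g => f = g %[ae m]) (lebesgue_dist m p).
Proof.
move=> mfin hp; split.
- by move=> f g; exact: lebesgue_LfunD.
- by move=> a f; exact: lebesgue_LfunZ.
- by move=> f g _ _; exact: lebesgue_dist_ge0.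
- by move=> f g _ _; exact: lebesgue_distC.
- by move=> f g h; exact: lebesgue_dist_triangle.
- by move=> f _; exact: ae_eq_refl.
- by move=> f g Lf Lg; have [h1 h2] := lebesgue_dist_eq0 mfin hp Lf Lg; split.
- move=> f f' g g' _ _ _ _ ff' gg'; apply: filterS2 ff' gg' => x fx gx _.
  by rewrite fx// gx.
- by move=> a f f' _ _; apply: filterS => x fx _; rewrite fx.
Qed.

Section IdentityHom.
Variable R : realType.
Context {d : measure_display} {T : measurableType d}.
Variables (m : {measure set T -> \bar R}) (B : set (set T)) (mu : set T -> R).
Hypothesis hom : charge_hom B mu m id.
Hypothesis m_complete : measure_is_complete m.
Hypothesis outer_approx : forall E r, measurable E -> 0 < r ->
  exists c, [/\ B c, E `<=` c & (m (c `\` E) < r%:E)%E].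

Let muB : is_charge B mu. Proof. by case: hom. Qed.
Let Bf : set_field B. Proof. by case: muB. Qed.
Let mfin : (m setT < +oo)%E := hom_measure_fin hom.
Implicit Types f g s : T -> R.

Lemma lift_simple_id s : simple B s -> lift_simple id s = s.
Proof. by move=> ss; apply/funext => y; exact/(lift_eqP hom y (s y) ss). Qed.

Let outer_le_measure E : measurable E -> outer B mu E <= fine (m E).
Proof.
move=> mE; apply/ler_addgt0Pr => r r0; have [c [Bc Ec cEr]] := outer_approx mE r0.
apply: le_trans (outer_le muB Bc Ec) _.
have mc : measurable c by exact: (hom_measurable hom Bc).
have mcE : measurable (c `\` E) by exact: measurableD.
rewrite -lee_fin -(hom_measure hom Bc) EFinD fineK ?(measure_fin_num mfin)//.
apply: (@le_trans _ _ (m (E `|` (c `\` E)))); first by rewrite setDUK.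
by apply: le_trans (measureU2 _ mE mcE) _; apply: leeD2l; exact: ltW.
Qed.

Let dense E r : measurable E -> 0 < r -> exists2 b, B b & (m (b `+` E) < r%:E)%E.
Proof.
move=> mE r0; have [c [Bc Ec cEr]] := outer_approx mE r0; exists c => //.
by rewrite (_ : c `+` E = c `\` E)// /setY (_ : E `\` c = set0) ?setU0// setD_eq0.
Qed.

(** Outer approximation by sets of B makes the outer charge of a measurable set at
    most its measure, so a simple function close to f in measure is close in outer
    charge. *)
Lemma id_tracks f : measurable_fun setT f -> tracks B mu m id f f.
Proof.
move=> mf; split => // e e0.
have [s ss sf] := hom_dense_lift hom dense mf e0; exists s; split => //.
rewrite lift_simple_id// in sf; apply: le_lt_trans sf.
apply: outer_le_measure; apply: measurable_far => //.
by have := measurable_lift hom ss; rewrite lift_simple_id.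
Qed.

(** A hazy limit f agrees with the measurable function F that it corresponds to
    off sets of arbitrarily small measure, hence almost everywhere; completeness
    makes it measurable. *)
Lemma T1_measurable_fun f : T1_measurable B mu f -> measurable_fun setT f.
Proof.
move=> /(T1_tracks hom)[F [mF fF]].
have far_small e r : 0 < e -> 0 < r -> exists C,
    [/\ measurable C, (m C < r%:E)%E & far f F e `<=` C].
  move=> e0 r0; pose q := Num.min (e / 2) (r / 2).
  have q0 : 0 < q by rewrite lt_min !divr_gt0.
  have qe2 : q <= e / 2 by rewrite ge_min lexx.
  have qe : q + q <= e by lra.
  have qr : q <= r / 2 by rewrite ge_min lexx orbT.
  have [s [ss + sF]] := fF q q0; rewrite lift_simple_id// in sF.
  move=> /(outer_lt muB)[b [Bb sb bq]].
  have mb : measurable b by exact: (hom_measurable hom Bb).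
  have ms : measurable_fun setT s.
    by have := measurable_lift hom ss; rewrite lift_simple_id.
  have msF : measurable (far s F q) by exact: measurable_far.
  exists (b `|` far s F q); split; first exact: measurableU.
    rewrite [r]splitr; apply: measureU_lt => //.
      by rewrite (hom_measure hom Bb) lte_fin; exact: lt_le_trans qr.
    by rewrite -(fine_measure_lt mfin)//; exact: lt_le_trans qr.
  apply: (subset_trans (@le_far _ _ f F _ _ qe)).
  apply: (subset_trans (@far_triangle _ _ _ s _ _ _)).
  by apply: setSU; rewrite farC.
have far0 e : 0 < e -> m.-negligible (far f F e).
  move=> e0; have /choice[C HC] n : exists C,
      [/\ measurable C, (m C < (n.+1%:R^-1)%:E)%E & far f F e `<=` C].
    by apply: far_small => //; rewrite invr_gt0.
  exists (\bigcap_n C n); split.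
  - by apply: bigcap_measurable => // n _; case: (HC n).
  - apply/eqP; rewrite -measure_le0; apply/lee_addgt0Pr => r r0; rewrite add0e.
    have [n _ Hn] := near_infty_natSinv_lt (PosNum r0).
    have [mC Cn _] := HC n; apply: (@le_trans _ _ (m (C n))).
      apply: sub_measure => //; last by move=> x; exact.
      by apply: bigcap_measurable => // k _; case: (HC k).
    apply/ltW/(lt_trans Cn); rewrite lte_fin; exact: (Hn n (leqnn n)).
  - by move=> x fx n _; case: (HC n) => _ _; exact.
have Ff : F = f %[ae m].
  have : m.-negligible (\bigcup_n far f F n.+1%:R^-1).
    by apply: negligible_bigcup => n; apply: far0; rewrite invr_gt0.
  apply: negligibleS => x /= Fx.
  have fx0 : 0 < `|f x - F x|.
    by rewrite normr_gt0 subr_eq0; apply/eqP => fE; apply: Fx.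
  have [n _ Hn] := near_infty_natSinv_lt (PosNum fx0).
  by exists n => //; exact: (Hn n (leqnn n)).
apply/measurable_EFinP.
apply: (ae_measurable_fun m_complete (f := EFin \o F)); last exact/measurable_EFinP.
by apply: filterS Ff => x Fx _ /=; rewrite Fx.
Qed.

Variable p : R.
Hypothesis hp : p = 0 \/ 1 <= p.

Lemma id_charge_Lfun : charge_Lfun B mu p = lebesgue_Lfun m p.
Proof.
apply/seteqP; split=> f fL.
  have mf : measurable_fun setT f.
    apply: T1_measurable_fun; move: fL; rewrite /charge_Lfun.
    by case: ifP => _ // -[].
  exact/(charge_LfunP hom hp (id_tracks mf)).
have mf := lebesgue_Lfun_measurable hp fL.
exact/(charge_LfunP hom hp (id_tracks mf)).
Qed.

Lemma id_ae_eq f g : lebesgue_Lfun m p f -> lebesgue_Lfun m p g ->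
  f = g %[ae m] <-> charge_ae_eq B mu f g.
Proof.
move=> /(lebesgue_Lfun_measurable hp) mf /(lebesgue_Lfun_measurable hp) mg.
by have [h1 h2] := tracks_ae_eq hom (id_tracks mf) (id_tracks mg); split.
Qed.

Lemma id_charge_dist f g : lebesgue_Lfun m p f -> lebesgue_Lfun m p g ->
  lebesgue_dist m p f g = charge_dist B mu p f g.
Proof.
move=> Lf Lg; have mf := lebesgue_Lfun_measurable hp Lf.
have mg := lebesgue_Lfun_measurable hp Lg.
by rewrite (charge_distE hom hp (id_tracks mf) (id_tracks mg)).
Qed.

Lemma id_metric_funspace :
  metric_funspace (charge_Lfun B mu p) (charge_ae_eq B mu) (charge_dist B mu p).
Proof.
apply: metric_funspace_eq (lebesgue_metric_funspace mfin hp) _ id_ae_eq id_charge_dist.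
by rewrite id_charge_Lfun.
Qed.

Lemma id_coincide : mv_coincide (charge_Lspace B mu p) (lebesgue_Lspace m p).
Proof.
apply: (fquot_coincide id_metric_funspace id_charge_Lfun) => f g;
  rewrite id_charge_Lfun => Lf Lg.
  by split; apply id_ae_eq.
by rewrite id_charge_dist.
Qed.

Lemma id_complete : mv_complete (charge_Lspace B mu p).
Proof.
apply: (fquot_complete id_metric_funspace) => u; rewrite id_charge_Lfun => Lu uC.
have [|f Lf uf] := lebesgue_dist_complete mfin hp Lu.
  move=> r /uC[n0 Hn0]; exists n0 => i j n0i n0j.
  by rewrite id_charge_dist//; exact: Hn0.
by exists f => // r /uf[n0 Hn0]; exists n0 => n /Hn0; rewrite id_charge_dist.
Qed.

End IdentityHom.
(** * The measure space of a representation *)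

Section Representation.
Variables (R : realType) (A : set (set posn)) (Y : pointedType).
Variable phi : pow_mod_null R -> set Y.
Hypotheses (Af : set_field A) (Ad : A `<=` has_density R).
Hypothesis rep : representation phi.
Implicit Types x y : pow_mod_null R.

Local Notation M := (sigma_cls R A).
Local Notation S := (phi @` M).
Local Notation nuY := (density_rep phi).

Let phi_inj : injective phi. Proof. by case: rep. Qed.

Let phiI x y : phi (x `&` y)%O = phi x `&` phi y.
Proof. by case: rep => _ h _ _; exact: h. Qed.

Let phiU x y : phi (x `|` y)%O = phi x `|` phi y.
Proof. by case: rep => _ _ h _; exact: h. Qed.

Let phiC x : phi (~` x)%O = ~` phi x.
Proof. by case: rep => _ _ _ h; exact: h. Qed.

Let phi0 : phi \bot%O = set0.
Proof. by rewrite -(meetxC (\bot : pow_mod_null R)%O) phiI phiC setICr. Qed.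

Let phiT : phi \top%O = setT.
Proof. by rewrite -compl0 phiC phi0 setC0. Qed.

Let le_phi x y : (x <= y)%O <-> phi x `<=` phi y.
Proof.
rewrite leEmeet; split=> [/eqP <-|/setIidPl xy].
  by rewrite phiI; exact: subIsetr.
by apply/eqP/phi_inj; rewrite phiI.
Qed.

Lemma density_repE x : nuY (phi x) = qdensity x.
Proof.
by congr qdensity; apply: xget_unique => // y /= /phi_inj.
Qed.

Let Malg : subalgebra M := sigma_cls_subalgebra Af Ad.

Let S_field : set_field S.
Proof.
have [MT MU MC] := Malg; split.
- by exists \top%O => //; exact: phiT.
- by move=> _ _ [x Mx <-] [y My <-]; exists (x `|` y)%O => //; exact: MU.
- by move=> _ [x Mx <-]; exists (~` x)%O => //; exact: MC.
Qed.

Lemma density_rep_charge : is_charge S nuY.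
Proof.
split=> // [_ [x Mx <-]|_ _ [x Mx <-] [y My <-] xy0].
  by rewrite density_repE; apply/qdensity_ge0/(sigma_cls_density Ad).
rewrite -phiU !density_repE; apply: qdensity_join.
- exact: (sigma_cls_density Ad).
- exact: (sigma_cls_density Ad).
- by apply: phi_inj; rewrite phiI phi0.
Qed.

(** The set C represents the supremum of the classes, which can be larger than the
    union of the sets F n. *)
Lemma density_rep_sup (F : nat -> set Y) : (forall n, S (F n)) ->
  (forall n, F n `<=` F n.+1) ->
  exists C, [/\ S C, forall n, F n `<=` C & nuY (F n) @[n --> \oo] --> nuY C].
Proof.
move=> SF FS; have /choice[x Hx] n : exists x, M x /\ phi x = F n.
  by have [x] := SF n; exists x.
have [||s [Ms xs qs]] := sigma_cls_supremum Ad (x := x).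
- by move=> n; case: (Hx n).
- apply/nondecreasing_seqP => n; apply/le_phi.
  by rewrite (Hx n).2 (Hx n.+1).2.
exists (phi s); split; first by exists s.
  by move=> n; rewrite -(Hx n).2; apply/le_phi/xs.1; exists n.
rewrite density_repE (_ : (fun n => _) = fun n => qdensity (x n))//.
by apply/funext => n; rewrite -(Hx n).2 density_repE.
Qed.

Local Notation pjS := (pj_field S nuY).
Local Notation T := (g_sigma_algebraType pjS).

Definition rep_measure : {measure set T -> \bar R} :=
  pj_measure density_rep_charge density_rep_sup.

Local Notation m := rep_measure.

Let measurableE (E : set T) : measurable E = pjS E.
Proof. exact: (pj_measurableE density_rep_charge density_rep_sup). Qed.

Let mE (E : set T) : S E -> m E = (nuY E)%:E.
Proof.
by move=> SE; rewrite pj_measureE (pj_chargeE density_rep_charge).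
Qed.

Let S_measurable (E : set T) : S E -> measurable E.
Proof. by rewrite measurableE; exact: (sub_pj_field density_rep_charge). Qed.

Lemma rep_measure_complete : measure_is_complete m.
Proof. exact: pj_measure_complete. Qed.

Lemma rep_measure_space : measure_space (pj_charge S nuY) m.
Proof. exact: pj_measure_space. Qed.

Lemma rep_hom_S : charge_hom (X := T) S nuY m id.
Proof. by split => //; exact: density_rep_charge. Qed.

Lemma rep_outer_approx_S (E : set T) (r : R) : measurable E -> 0 < r ->
  exists c : set T, [/\ S c, E `<=` c & (m (c `\` E) < r%:E)%E].
Proof.
rewrite measurableE => pE r0.
have [b [c [Sb Sc bE Ec bcr]]] := pE _ r0; exists c; split => //.
have Scb : S (c `\` b) by exact: set_fieldD.
apply: (@sub_measure_lt _ _ _ m (c `\` E) (c `\` b)).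
- by apply: measurableD; [exact: S_measurable|rewrite measurableE].
- exact: S_measurable.
- exact: setDS.
- by rewrite mE.
Qed.

Lemma rep_hom_pj : charge_hom (X := T) pjS (pj_charge S nuY) m id.
Proof.
have h := density_rep_charge; have h' := density_rep_sup.
split => //; last by move=> E pE; rewrite measurableE.
split; last by move=> E E'; exact: pj_chargeU.
  split.
  - by apply: (sub_pj_field h); exact: set_field_setT.
  - by move=> E E'; exact: (pj_fieldU h h').
  - by move=> E; exact: (pj_fieldC h).
by move=> E _; exact: (pj_charge_ge0 h).
Qed.

Lemma rep_outer_approx_pj (E : set T) (r : R) : measurable E -> 0 < r ->
  exists c : set T, [/\ pjS c, E `<=` c & (m (c `\` E) < r%:E)%E].
Proof.
by rewrite measurableE => pE r0; exists E; split => //; rewrite setDv measure0 lte_fin.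
Qed.

Lemma rep_hom_A : charge_hom A (asym_density R) m (phi \o cls R).
Proof.
have SA a : A a -> S (phi (cls R a)).
  by move=> Aa; exists (cls R a) => //; apply: sub_smallest_monotone_class; exists a.
split.
- split=> // [a Aa|a b Aa Ab ab0]; first exact: dens_ge0 (has_dens (Ad Aa)).
  apply: dens_asym; apply: densU ab0 _ _; exact/has_dens/Ad.
- by move=> a b; rewrite /= clsI phiI.
- by move=> a; rewrite /= clsC phiC.
- by move=> a Aa; apply: S_measurable; exact: SA.
- move=> a Aa; rewrite mE; last exact: SA.
  by rewrite density_repE qdensity_cls//; exact: Ad.
Qed.

Let approx x : Prop := forall r, 0 < r ->
  exists2 a, A a & nuY (phi (cls R a) `+` phi x) < r.

Let SY E E' : S E -> S E' -> S (E `+` E').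
Proof. by move=> SE SE'; apply: set_fieldU => //; exact: set_fieldD. Qed.

Let MA a : A a -> M (cls R a).
Proof. by move=> Aa; apply: sub_smallest_monotone_class; exists a. Qed.

Let approx_compl x : approx x -> approx (~` x)%O.
Proof.
move=> ax r /ax[a Aa ar]; exists (~` a); first exact: set_fieldC.
rewrite clsC !phiC (_ : ~` _ `+` _ = phi (cls R a) `+` phi x)//.
by rewrite /setY !setDE !setCK setUC (setIC (phi x)) (setIC (phi (cls R a))).
Qed.

(** By continuity some term of the sequence is close to the supremum, and what
    approximates this term approximates the supremum. *)
Let approx_supremum (x : nat -> pow_mod_null R) :
  (forall n, M (x n) /\ approx (x n)) -> nondecreasing_seq x ->
  exists2 s, M s /\ approx s & supremums (range x) s.
Proof.
move=> Mx xm.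
have [s [Ms xs qs]] := sigma_cls_supremum Ad (fun n => (Mx n).1) xm.
exists s => //; split => // r r0; have r20 : 0 < r / 2 by rewrite divr_gt0.
have [n /(_ n (leqnn n)) xn] := (cvg_seqP _ _).1 qs _ r20.
have [Mxn axn] := Mx n; have [a Aa ar] := axn _ r20; exists a => //.
have xns : phi (x n) `<=` phi s by apply/le_phi/xs.1; exists n.
have Sxn : S (phi (x n)) by exists (x n).
have Ss : S (phi s) by exists s.
have Sa : S (phi (cls R a)) by exists (cls R a) => //; exact: MA.
have h := density_rep_charge.
have : nuY (phi (cls R a) `+` phi s) <=
    nuY ((phi (cls R a) `+` phi (x n)) `|` (phi s `\` phi (x n))).
  apply: (le_charge h); [exact: SY|apply: set_fieldU; [|exact: SY|exact: set_fieldD]|] => //.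
  by move=> y; rewrite /setY/=; have := xns y; case: (pselect (phi (x n) y)); tauto.
have := charge_subadd h (SY Sa Sxn) (set_fieldD S_field Ss Sxn).
rewrite (charge_setD h)// !density_repE; move: xn; rewrite distrC => /ltr_normlP[_].
by lra.
Qed.

(** The approximable elements form a monotone class; for decreasing sequences one
    takes complements. *)
Lemma sigma_cls_approx x : M x -> approx x.
Proof.
suff : M `<=` [set x | M x /\ approx x] by move=> /(_ x) /[apply] -[].
apply: smallest_monotone_class_ind; last first.
  move=> _ [a Aa <-]; split; first exact: MA.
  by move=> r r0; exists a => //; rewrite setYK (charge_set0 density_rep_charge).
split=> u uM um; first exact: approx_supremum.
have [_ _ MC] := Malg.
have [||s [Ms sa] us] := @approx_supremum (fun n => ~` u n)%O.
- by move=> n; have [Mu au] := uM n; split; [exact: MC|exact: approx_compl].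
- by move=> i j ij; rewrite leC; exact: um.
exists (~` s)%O; first by split; [exact: MC|exact: approx_compl].
rewrite (_ : range u = range (fun n => ~` ~` u n)%O); first exact: supremums_compl us.
by apply: eq_imagel => n _; rewrite complK.
Qed.

Lemma rep_dense_A (E : set T) (r : R) : measurable E -> 0 < r ->
  exists2 a, A a & (m ((phi \o cls R) a `+` E) < r%:E)%E.
Proof.
move=> mEE r0; have r20 : 0 < r / 2 by rewrite divr_gt0.
have [_ [[x Mx <-] Ex xEr]] := rep_outer_approx_S mEE r20.
have [a Aa ar] := sigma_cls_approx Mx r20; exists a => //=.
have Sx : S (phi x) by exists x.
have Sa : S (phi (cls R a)) by exists (cls R a) => //; exact: MA.
have SYax := SY Sa Sx.
apply: (@sub_measure_lt _ _ _ m _ ((phi (cls R a) `+` phi x) `|` (phi x `\` E))).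
- by apply: measurableU; apply: measurableD => //; exact: S_measurable.
- apply: measurableU; first exact: S_measurable.
  by apply: measurableD => //; exact: S_measurable.
- move=> y; rewrite /setY/=; have := Ex y.
  by case: (pselect (E y)); case: (pselect (phi x y)); tauto.
rewrite [r]splitr; apply: measureU_lt => //.
- exact: S_measurable.
- by apply: measurableD => //; exact: S_measurable.
- by rewrite mE.
Qed.

End Representation.
(** * Comparison of the spaces of the field and of the representation *)

Theorem theorem9p1 (R : realType) (A : set (set posn)) (p : R)
    (Y : pointedType) (phi : pow_mod_null R -> set Y) :
  set_field A -> A `<=` has_density R ->
  p = 0 \/ 1 <= p ->
  representation phi ->
  let S := phi @` sigma_cls R A in
  let nuY := density_rep phi in
  let LA := charge_Lspace A (asym_density R) p in
  let LY := charge_Lspace S nuY p in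
  [/\ S `<=` [set phi (cls R a) | a in has_density R],
      complete_measure_space (pj_field S nuY) (pj_charge S nuY),
      lebesgue_function_space (pj_field S nuY) (pj_charge S nuY) p,
      exists D, [/\ mv_subspace LY D, mv_dense LY D &
                    mv_isometric LA (mv_restrict LY D)] &
      mv_complete LA <-> mv_isometric LA LY].
Proof.
move=> Af Ad hp rep S nuY LA LY.
pose m := rep_measure Af Ad rep.
have mcomplete : measure_is_complete m by exact: rep_measure_complete.
have homS := rep_hom_S Af Ad rep.
have homA : charge_hom A (asym_density R) m (phi \o cls R) := rep_hom_A Af Ad rep.
have approxS := @rep_outer_approx_S R A Y phi Af Ad rep.
have YH := id_metric_funspace homS mcomplete approxS hp.
have YL := id_charge_Lfun homS mcomplete approxS hp.
have Yd := id_charge_dist homS approxS hp.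
have Yt := id_tracks homS approxS.
pose rel := tracks A (asym_density R) m (phi \o cls R).
have rel_L f F : rel f F -> charge_Lfun A (asym_density R) p f <-> charge_Lfun S nuY p F.
  by move=> fF; rewrite YL; exact: (charge_LfunP homA hp fF).
have rel_e f g F G : rel f F -> rel g G ->
    charge_ae_eq A (asym_density R) f g <-> charge_ae_eq S nuY F G.
  move=> fF gG; rewrite (tracks_ae_eq homA fF gG).
  have mF := tracks_measurable fF; have mG := tracks_measurable gG.
  by have [h1 h2] := tracks_ae_eq homS (Yt F mF) (Yt G mG); split.
have rel_d f g F G : rel f F -> rel g G -> charge_Lfun S nuY p F ->
    charge_Lfun S nuY p G ->
    charge_dist A (asym_density R) p f g = charge_dist S nuY p F G.
  rewrite YL => fF gG LF LG.
  by rewrite (charge_distE homA hp fF gG LF LG); exact: Yd.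
have rel_ex f : charge_Lfun A (asym_density R) p f -> exists F, rel f F.
  exact: (charge_Lfun_tracks homA).
have rel_add f g F G : rel f F -> rel g G ->
    rel (fun x => f x + g x) (fun y => F y + G y) by exact: (tracks_add homA).
have rel_scale a f F : rel f F -> rel (fun x => a * f x) (fun y => a * F y).
  exact: (tracks_scale homA).
have simple_LA s : simple A s -> charge_Lfun A (asym_density R) p s.
  move=> ss; apply/(charge_LfunP homA hp (tracks_simple homA ss)).
  exact: (lift_Lfun homA).
pose D := rel_image (charge_Lfun A (asym_density R) p) (charge_Lfun S nuY p)
  (charge_ae_eq S nuY) rel.
have densD : mv_dense LY D.
  move=> _ [F LF <-] e e0; have LF' := LF; rewrite YL in LF'.
  have mF := lebesgue_Lfun_measurable hp LF'.
  have [|s ss sF] := lift_dense homA hp LF' e0.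
    move=> r r0.
    exact: (hom_dense_lift homA (@rep_dense_A R A Y phi Af Ad rep) mF r0).
  have sLs := tracks_simple homA ss.
  have Ls := (rel_L _ _ sLs).1 (simple_LA _ ss).
  move: sF sLs Ls; set G := lift_simple _ s => sF sLs Ls.
  exists (fclass (charge_Lfun S nuY p) (charge_ae_eq S nuY) (G : Y -> R)).
    by exists s, G; split => //; exact: simple_LA.
  rewrite [ltLHS](vdist_fclass YH)// (mfs_sym YH)//.
  by rewrite -Yd// -YL.
split.
- by move=> _ [x /(sigma_cls_density Ad)[a ad <-] <-]; exists a.
- by exists m => //; exact: rep_measure_space.
- exists m; first exact: rep_measure_space.
  exact: (id_coincide (rep_hom_pj Af Ad rep) mcomplete
    (@rep_outer_approx_pj R A Y phi Af Ad rep) hp).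
- exists D; split => //.
  + apply: (rel_image_subspace YH rel_ex rel_L rel_e rel_d rel_add rel_scale).
    exists (fun=> 0); apply: simple_LA; exact: simple_cst.
  + exact: (rel_image_isometric YH rel_ex rel_L rel_e rel_d rel_add rel_scale).
- apply: (fquot_complete_iff YH rel_ex rel_L rel_e rel_d rel_add rel_scale) densD.
  exact: (id_complete homS mcomplete approxS hp).
Qed.
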